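(* If $0<p<1$, then the function $t\mapsto\Phi_1(p,t)$ on $[0,1]$ is increasing from $\Phi_1(p,0)=1$ to \[\Phi_1\big(p,(1-p/2)^{1/p}\big)=(1-p/2)^{1/p}\,\frac{2}{\sqrt{p(2-p)}}\] (that is, it is increasing on $0\leq t\leq(1-p/2)^{1/p}$), and then decreasing to $\Phi_1(p,1)=0$ (that is, it is decreasing on $(1-p/2)^{1/p}\leq t\leq1$).
   Context: Let $\mathbb{D}$ be the open unit disc. For $0<p<\infty$, $H^p$ is the space of analytic functions $f$ in $\mathbb{D}$ with $\|f\|_{H^p}^p=\lim_{r\to1^-}\int_0^{2\pi}|f(re^{i\theta})|^p\,\frac{d\theta}{2\pi}<\infty$. For $0\leq t\leq1$, \[\Phi_1(p,t)=\sup\left\{\operatorname{Re} f'(0)\,:\,f\in H^p,\ \|f\|_{H^p}\leq1\text{ and }f(0)=t\right\}.\] *)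

(* Defs.v *)
From Stdlib Require Import Reals.
From Coquelicot Require Import Coquelicot.
Open Scope R_scope.

Definition analytic_on_disc (f : C -> C) : Prop :=
  forall z : C, Cmod z < 1 -> ex_derive (K := C_AbsRing) (V := C_NormedModule) f z.

(* The power x^a for x >= 0 and a > 0.  [Rpower] alone is not enough:
   since [ln 0 = 0] in Stdlib, [Rpower 0 a] is [1]. *)
Definition rpow (x a : R) : R :=
  if Req_EM_T x 0 then 0 else Rpower x a.

Definition circle_mean (p : R) (f : C -> C) (r : R) : R :=
  RInt (fun theta => rpow (Cmod (f (r * cos theta, r * sin theta))) p) 0 (2 * PI)
  / (2 * PI).

(* [is_Hp_norm p f N]: the limit of the means as r -> 1- exists, is finite, and
   equals N^p.  No such N exists when the limit is infinite. *)
Definition is_Hp_norm (p : R) (f : C -> C) (N : R) : Prop :=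
  0 <= N /\ filterlim (circle_mean p f) (at_left 1) (locally (rpow N p)).

Definition in_Hp (p : R) (f : C -> C) : Prop :=
  analytic_on_disc f /\ exists N : R, is_Hp_norm p f N.

(* The supremum is taken in the extended reals.  [C_derive] is defined by limits
   along the real axis; it is the complex derivative (see [C_derive_correct])
   because [in_Hp] makes f complex differentiable at 0. *)
Definition Phi1 (p t : R) : Rbar :=
  Lub_Rbar (fun y : R =>
    exists f : C -> C,
      in_Hp p f /\
      (exists N : R, is_Hp_norm p f N /\ N <= 1) /\
      f (RtoC 0) = RtoC t /\
      y = Re (C_derive f (RtoC 0))).

(* Main.v *)
Require Import Defs.
From Stdlib Require Import Reals ZArith Lra Lia Psatz List.
From Coquelicot Require Import Coquelicot.
Open Scope R_scope.

(* Upper bound.  Goursat's argument in the coordinates (log |z|, arg z) gives Cauchy's formula on circles,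
   so f(rz) is a uniform limit of polynomials on the closed disc, and a polynomial may replace f.  Reflecting its zeros in the circle
   writes it there as B F, with B a Blaschke product and F zero-free; then F = g^(2/p), and the bounds
   |B'(0)| <= 1 - |B(0)|^2 and |g(0)|^2 + |g'(0)|^2 <= ||g||_2^2 give Re f'(0) <= G(x, t) with
     G(x, t) = A - t^2/A + (2/p) t x,   A = (1 + x^2)^(-1/p) >= t,   x = |g'(0)/g(0)|.
   For x > 1 one has G(x, t) <= G(1/x, t), so that one may assume x <= 1.
   Lower bound.  For x <= 1, G(x, t) is the value at A (b + z)/(1 + b z) (1 + x z)^(2/p), b = t/A.
   Monotonicity.  dG/dx has the sign of t - x A(x) for x <= 1, and x A(x) increases up to
   x = sqrt(p/(2-p)), where A(x) = (1-p/2)^(1/p), and then decreases. *)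

(** * Closed differential forms on rectangles *)

(** In G, A stands for |F(0)| and t/A for |B(0)|: the term A - t^2/A bounds the contribution of B',
    the term (2/p) t x that of F', and A^p (1 + x^2) <= 1 is the norm condition. Polynomials have
    finitely many zeros, so neither infinite products nor boundary values enter. The price is that
    the approximating polynomial only has mean at most 1 + eta, and normalising it multiplies f(0)
    by a factor slightly below 1: the upper bound at t is a value of G at a slightly smaller point.
    This loss shapes the end of the proof. On the increasing side it is absorbed by a strict
    domination of all values of G at points s < t by one value at t. On the decreasing side Phi_1 is
    computed and the loss is absorbed by continuity. For fixed t the candidates for the maximum of G
    are the critical point x A(x) = t and the end A(x) = t of the range of x. Once t exceeds the
    maximum of x A(x), only the end remains. This happens strictly before t reaches (1-p/2)^(1/p),
    since the maximum point sqrt(p/(2-p)) is below 1. *)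

Lemma pow2_pos (n : nat) : 0 < 2 ^ n.
Proof. apply pow_lt; lra. Qed.

Lemma div_pow2_lt (L d : R) : 0 < d -> exists N : nat, forall n : nat, (N <= n)%nat -> L / 2 ^ n < d.
Proof.
  intros Hd.
  destruct (Rle_lt_dec L 0) as [HL|HL].
  { exists 0%nat; intros n _. apply Rle_lt_trans with 0; [|exact Hd].
    assert (Hp := pow2_pos n). unfold Rdiv.
    assert (0 < / 2 ^ n) by (apply Rinv_0_lt_compat; lra). nra. }
  destruct (pow_lt_1_zero (/2)) with (y := d / L) as [N HN].
  { rewrite Rabs_pos_eq; lra. }
  { apply Rdiv_lt_0_compat; lra. }
  exists N; intros n Hn. specialize (HN n Hn).
  assert (Hp := pow2_pos n).
  rewrite pow_inv in HN. rewrite Rabs_pos_eq in HN.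
  2:{ left; apply Rinv_0_lt_compat; lra. }
  apply Rmult_lt_compat_r with (r := L) in HN; [|lra].
  replace (d / L * L) with d in HN by (field; lra). unfold Rdiv; lra.
Qed.

Lemma nested_halving (u : nat -> R) (L : R) : 0 < L ->
  (forall n, u n <= u (S n)) -> (forall n, u (S n) + L / 2 ^ (S n) <= u n + L / 2 ^ n) ->
  exists X, forall n, u n <= X <= u n + L / 2 ^ n.
Proof.
  intros HL Hinc Hdec.
  assert (Hmono : forall n k, u n <= u (n + k)%nat).
  { intros n k; induction k as [|k IH]; [rewrite Nat.add_0_r; lra|].
    rewrite Nat.add_succ_r. specialize (Hinc (n + k)%nat); lra. }
  assert (Hmono2 : forall n k, u (n + k)%nat + L / 2 ^ (n + k) <= u n + L / 2 ^ n).
  { intros n k; induction k as [|k IH]; [rewrite Nat.add_0_r; lra|].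
    rewrite Nat.add_succ_r. specialize (Hdec (n + k)%nat); lra. }
  assert (Hpos : forall n, 0 < L / 2 ^ n).
  { intro n; apply Rdiv_lt_0_compat; [lra|apply pow2_pos]. }
  assert (Hub : forall n m, u m <= u n + L / 2 ^ n).
  { intros n m. destruct (Nat.le_ge_cases n m) as [H|H].
    - replace m with (n + (m - n))%nat by lia.
      specialize (Hmono2 n (m - n)%nat); specialize (Hpos (n + (m - n))%nat); lra.
    - replace n with (m + (n - m))%nat by lia.
      specialize (Hmono m (n - m)%nat); specialize (Hpos (m + (n - m))%nat); lra. }
  destruct (completeness (fun x => exists n, x = u n)) as [X [HX1 HX2]].
  - exists (u 0%nat + L / 2 ^ 0). intros x [n ->]; apply Hub.
  - exists (u 0%nat), 0%nat; reflexivity.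
  - exists X; intro n; split.
    + apply HX1; exists n; reflexivity.
    + apply HX2; intros x [m ->]; apply Hub.
Qed.

(** If [m] were positive on the whole rectangle, some quarter would keep it positive at every stage,
    and the corners would converge to a point contradicting the local hypothesis. All rectangles
    keep the proportions of the first one, which the local estimate at exceptional points uses. *)
Lemma quartering (m : R -> R -> R -> R -> R) (x0 y0 L0 H0 : R) :
  0 < L0 -> 0 < H0 ->
  (forall x y L H, 0 < L -> 0 < H -> x0 <= x -> x + L <= x0 + L0 ->
     y0 <= y -> y + H <= y0 + H0 ->
     m x y L H <= m x y (L/2) (H/2) + m (x + L/2) y (L/2) (H/2)
       + m x (y + H/2) (L/2) (H/2) + m (x + L/2) (y + H/2) (L/2) (H/2)) ->
  (forall X Y, x0 <= X <= x0 + L0 -> y0 <= Y <= y0 + H0 ->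
     exists d, 0 < d /\ forall n x y, x0 <= x -> x + L0 / 2 ^ n <= x0 + L0 ->
       y0 <= y -> y + H0 / 2 ^ n <= y0 + H0 ->
       x <= X <= x + L0 / 2 ^ n -> y <= Y <= y + H0 / 2 ^ n ->
       L0 / 2 ^ n < d -> H0 / 2 ^ n < d -> m x y (L0 / 2 ^ n) (H0 / 2 ^ n) <= 0) ->
  m x0 y0 L0 H0 <= 0.
Proof.
  intros HL HH Hsup Hloc.
  destruct (Rle_lt_dec (m x0 y0 L0 H0) 0) as [|Hbad]; [assumption|exfalso].
  (* A quarter with positive [m] is kept; the upper right one is the default, being positive when
     the other three are not. *)
  set (step := fun (n : nat) (z : R * R) =>
    let (x, y) := z in
    let l := L0 / 2 ^ S n in let h := H0 / 2 ^ S n in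
    if Rle_lt_dec (m x y l h) 0 then
      if Rle_lt_dec (m (x + l) y l h) 0 then
        if Rle_lt_dec (m x (y + h) l h) 0 then (x + l, y + h) else (x, y + h)
      else (x + l, y)
    else (x, y)).
  set (s := fix s n := match n with O => (x0, y0) | S n => step n (s n) end).
  set (inv := fun (n : nat) (z : R * R) =>
    x0 <= fst z /\ fst z + L0 / 2 ^ n <= x0 + L0 /\
    y0 <= snd z /\ snd z + H0 / 2 ^ n <= y0 + H0 /\
    0 < m (fst z) (snd z) (L0 / 2 ^ n) (H0 / 2 ^ n)).
  assert (Hhalf : forall a n, a / 2 ^ n = a / 2 ^ S n + a / 2 ^ S n).
  { intros a n. simpl. field. assert (Hp := pow2_pos n); lra. }
  assert (Hpos : forall a n, 0 < a -> 0 < a / 2 ^ n).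
  { intros a n Ha; apply Rdiv_lt_0_compat; [lra|apply pow2_pos]. }
  assert (Hstep : forall n z, inv n z -> inv (S n) (step n z) /\
     fst z <= fst (step n z) <= fst z + L0 / 2 ^ S n /\
     snd z <= snd (step n z) <= snd z + H0 / 2 ^ S n).
  { intros n [x y]. unfold inv. cbn [fst snd]. intros (A1 & A2 & A3 & A4 & A5).
    assert (Hq := Hsup x y (L0 / 2 ^ n) (H0 / 2 ^ n) (Hpos _ _ HL) (Hpos _ _ HH) A1 A2 A3 A4).
    assert (B1 := Hhalf L0 n). assert (B2 := Hhalf H0 n).
    replace (L0 / 2 ^ n / 2) with (L0 / 2 ^ S n) in Hq by lra.
    replace (H0 / 2 ^ n / 2) with (H0 / 2 ^ S n) in Hq by lra.
    assert (B3 := Hpos L0 (S n) HL). assert (B4 := Hpos H0 (S n) HH).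
    unfold step. destruct Rle_lt_dec; [destruct Rle_lt_dec; [destruct Rle_lt_dec|]|];
      cbn [fst snd]; repeat split; lra. }
  assert (Hinv : forall n, inv n (s n)).
  { induction n as [|n IH]; [|apply (Hstep n (s n) IH)].
    unfold inv. cbn [s fst snd pow]. unfold Rdiv; rewrite Rinv_1, !Rmult_1_r. repeat split; lra. }
  destruct (nested_halving (fun n => fst (s n)) L0 HL) as [X HX].
  { intro n; apply (Hstep n (s n) (Hinv n)). }
  { intro n; generalize (Hstep n (s n) (Hinv n)) (Hhalf L0 n). cbn [s]. lra. }
  destruct (nested_halving (fun n => snd (s n)) H0 HH) as [Y HY].
  { intro n; apply (Hstep n (s n) (Hinv n)). }
  { intro n; generalize (Hstep n (s n) (Hinv n)) (Hhalf H0 n). cbn [s]. lra. }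
  assert (HX0 := HX 0%nat). assert (HY0 := HY 0%nat).
  cbn [s fst snd pow] in HX0, HY0. unfold Rdiv in HX0, HY0; rewrite Rinv_1, Rmult_1_r in HX0, HY0.
  destruct (Hloc X Y HX0 HY0) as (d & Hd & Hsmall).
  destruct (div_pow2_lt L0 d Hd) as [N1 HN1]. destruct (div_pow2_lt H0 d Hd) as [N2 HN2].
  pose (n := Nat.max N1 N2).
  destruct (Hinv n) as (A1 & A2 & A3 & A4 & A5).
  specialize (Hsmall n _ _ A1 A2 A3 A4 (HX n) (HY n) (HN1 n ltac:(lia)) (HN2 n ltac:(lia))). lra.
Qed.

Lemma continuity_2d_pt_section (f : R -> R -> R) (x y : R) : continuity_2d_pt f x y ->
  continuity_pt (fun u => f u y) x /\ continuity_pt (fun v => f x v) y.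
Proof.
  intros Hc. split; apply continuity_pt_filterlim; intros P [e He]; destruct (Hc e) as [d Hd];
    exists d; intros w Hw; apply He; apply Hd; try exact Hw;
    rewrite Rminus_diag, Rabs_R0; apply cond_pos.
Qed.

(** The integral of the form p dx + q dy around the boundary, counterclockwise. *)
Definition rect_int (p q : R -> R -> R) (x y L H : R) : R :=
  RInt (fun u => p u y) x (x + L) + RInt (fun v => q (x + L) v) y (y + H)
  - RInt (fun u => p u (y + H)) x (x + L) - RInt (fun v => q x v) y (y + H).

Lemma RInt_near_affine (f : R -> R) (a b al be e : R) : a <= b -> ex_RInt f a b ->
  (forall t, a <= t <= b -> Rabs (f t - (al + be * t)) <= e) ->
  Rabs (RInt f a b - (al * (b - a) + be * (b ^ 2 - a ^ 2) / 2)) <= e * (b - a).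
Proof.
  intros Hab Hf Hb.
  assert (Haff : is_RInt (fun t => al + be * t) a b (al * (b - a) + be * (b ^ 2 - a ^ 2) / 2)).
  { replace (al * (b - a) + be * (b ^ 2 - a ^ 2) / 2) with
      (minus (al * b + be * b ^ 2 / 2) (al * a + be * a ^ 2 / 2)) by (unfold minus, plus, opp; simpl; field).
    apply (is_RInt_derive (fun t => al * t + be * t ^ 2 / 2)).
    - intros x _. auto_derive; [trivial|field].
    - intros x _. apply continuity_pt_filterlim. reg. }
  assert (Hd : is_RInt (fun t => f t - (al + be * t)) a b
     (RInt f a b - (al * (b - a) + be * (b ^ 2 - a ^ 2) / 2))).
  { apply (is_RInt_minus f); [apply (RInt_correct (V := R_CompleteNormedModule)), Hf|exact Haff]. }
  rewrite (Rmult_comm e). apply (norm_RInt_le_const (fun t => f t - (al + be * t)) a b); assumption.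
Qed.

(** The affine approximations of [p] and [q] share the coefficient [b], so they make a closed form
    whose boundary integral vanishes; only the error [e] times the perimeter remains. *)
Lemma rect_int_affine_bound (p q : R -> R -> R) (x y L H a0 a b c0 c e : R) :
  0 <= L -> 0 <= H ->
  ex_RInt (fun u => p u y) x (x + L) -> ex_RInt (fun u => p u (y + H)) x (x + L) ->
  ex_RInt (fun v => q x v) y (y + H) -> ex_RInt (fun v => q (x + L) v) y (y + H) ->
  (forall u v, x <= u <= x + L -> y <= v <= y + H ->
     Rabs (p u v - (a0 + a * u + b * v)) <= e /\ Rabs (q u v - (c0 + b * u + c * v)) <= e) ->
  Rabs (rect_int p q x y L H) <= 2 * e * (L + H).
Proof.
  intros HL HH E1 E2 E3 E4 Hb.
  assert (I1 : Rabs (RInt (fun u => p u y) x (x + L) -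
     ((a0 + b * y) * (x + L - x) + a * ((x + L) ^ 2 - x ^ 2) / 2)) <= e * (x + L - x)).
  { apply RInt_near_affine; [lra|assumption|]. intros t Ht.
    replace (a0 + b * y + a * t) with (a0 + a * t + b * y) by ring. apply Hb; lra. }
  assert (I2 : Rabs (RInt (fun u => p u (y + H)) x (x + L) -
     ((a0 + b * (y + H)) * (x + L - x) + a * ((x + L) ^ 2 - x ^ 2) / 2)) <= e * (x + L - x)).
  { apply RInt_near_affine; [lra|assumption|]. intros t Ht.
    replace (a0 + b * (y + H) + a * t) with (a0 + a * t + b * (y + H)) by ring. apply Hb; lra. }
  assert (I3 : Rabs (RInt (fun v => q x v) y (y + H) -
     ((c0 + b * x) * (y + H - y) + c * ((y + H) ^ 2 - y ^ 2) / 2)) <= e * (y + H - y)).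
  { apply RInt_near_affine; [lra|assumption|]. intros t Ht. apply Hb; lra. }
  assert (I4 : Rabs (RInt (fun v => q (x + L) v) y (y + H) -
     ((c0 + b * (x + L)) * (y + H - y) + c * ((y + H) ^ 2 - y ^ 2) / 2)) <= e * (y + H - y)).
  { apply RInt_near_affine; [lra|assumption|]. intros t Ht. apply Hb; lra. }
  unfold rect_int.
  apply Rabs_le_between in I1. apply Rabs_le_between in I2.
  apply Rabs_le_between in I3. apply Rabs_le_between in I4.
  apply Rabs_le. split; nra.
Qed.

(** [sqrt] vanishes on negative numbers, so this is the odd extension of the square root. *)
Definition root_weight (u : R) : R := sqrt u - sqrt (- u).

Lemma root_weight_incr (u v : R) : u <= v -> root_weight u <= root_weight v.
Proof.
  intro H. unfold root_weight.
  assert (A := sqrt_le_1_alt u v H). assert (B := sqrt_le_1_alt (- v) (- u)). lra.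
Qed.

Lemma root_weight_gap (u v : R) : u <= 0 <= v -> sqrt (v - u) <= root_weight v - root_weight u.
Proof.
  intros [Hu Hv]. unfold root_weight. rewrite (sqrt_neg_0 u), (sqrt_neg_0 (- v)) by lra.
  assert (A := sqrt_pos v). assert (B := sqrt_pos (- u)).
  apply Rsqr_incr_0_var; [|lra].
  rewrite Rsqr_sqrt by lra. unfold Rsqr.
  assert (C1 := sqrt_sqrt v Hv). assert (C2 := sqrt_sqrt (- u) ltac:(lra)). nra.
Qed.

(* The exceptional points are [(X0, Y)] with [Ey Y]; they are absorbed by an additive weight,
   the product of the increments of [root_weight] and [W], which on a small rectangle containing
   such a point is comparable to the side length, whereas its area is not. *)
Lemma rect_int_closed (p q : R -> R -> R) (x0 y0 L0 H0 X0 : R) (Ey : R -> Prop) (W : R -> R) :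
  0 < L0 -> 0 < H0 ->
  (forall a b, a <= b -> W a <= W b) ->
  (forall a b Y, Ey Y -> a <= Y <= b -> sqrt (b - a) <= W b - W a) ->
  (forall x y, x0 <= x <= x0 + L0 -> y0 <= y <= y0 + H0 ->
     continuity_2d_pt p x y /\ continuity_2d_pt q x y) ->
  (forall x y, x0 <= x <= x0 + L0 -> y0 <= y <= y0 + H0 -> ~ (x = X0 /\ Ey y) ->
     exists a b c, differentiable_pt_lim p x y a b /\ differentiable_pt_lim q x y b c) ->
  rect_int p q x0 y0 L0 H0 = 0.
Proof.
  intros HL HH HW1 HW2 Hc Hd.
  set (lam := fun x y L H => (root_weight (x + L - X0) - root_weight (x - X0)) * (W (y + H) - W y)).
  (* Halving both sides keeps the proportions, so [sqrt L * sqrt H = kap * (L + H)] on every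
     rectangle of the subdivision. *)
  set (kap := sqrt (L0 * H0) / (L0 + H0)).
  assert (Hkap : 0 < kap).
  { apply Rdiv_lt_0_compat; [apply sqrt_lt_R0; nra|lra]. }
  assert (Hexp : forall x a b, x0 <= x <= x0 + L0 -> y0 <= a -> a <= b -> b <= y0 + H0 ->
     ex_RInt (fun v => q x v) a b).
  { intros x a b Hx Ha Hab Hb. apply ex_RInt_Reals_1. apply continuity_implies_RiemannInt; [assumption|].
    intros v Hv. apply (continuity_2d_pt_section q x v), Hc; lra. }
  assert (Hexq : forall y a b, y0 <= y <= y0 + H0 -> x0 <= a -> a <= b -> b <= x0 + L0 ->
     ex_RInt (fun u => p u y) a b).
  { intros y a b Hy Ha Hab Hb. apply ex_RInt_Reals_1. apply continuity_implies_RiemannInt; [assumption|].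
    intros v Hv. apply (continuity_2d_pt_section p v y), Hc; lra. }
  set (tot := (L0 + H0) ^ 2 + lam x0 y0 L0 H0).
  assert (Htot : 0 < tot).
  { unfold tot, lam. assert (A := root_weight_incr (x0 - X0) (x0 + L0 - X0) ltac:(lra)).
    assert (B := HW1 y0 (y0 + H0) ltac:(lra)). nra. }
  assert (Hmain : forall eps, 0 < eps -> Rabs (rect_int p q x0 y0 L0 H0) <= eps * tot).
  { intros eps Heps.
    (* Both terms of the weight are additive under quartering. The square of [L + H] absorbs the
       error near points of differentiability, [lam] the error near exceptional points, where only
       continuity is available. *)
    set (m := fun x y L H => Rabs (rect_int p q x y L H) - eps * ((L + H) ^ 2 + lam x y L H)).
    enough (m x0 y0 L0 H0 <= 0) by (unfold m in *; fold tot in H; lra).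
    apply quartering; [assumption|assumption| |].
    - intros x y L H HLp HHp Hx1 Hx2 Hy1 Hy2. unfold m.
      assert (Hadd : rect_int p q x y L H = rect_int p q x y (L/2) (H/2)
         + rect_int p q (x + L/2) y (L/2) (H/2) + rect_int p q x (y + H/2) (L/2) (H/2)
         + rect_int p q (x + L/2) (y + H/2) (L/2) (H/2)).
      { unfold rect_int.
        replace (x + L / 2 + L / 2) with (x + L) by field.
        replace (y + H / 2 + H / 2) with (y + H) by field.
        assert (Cp : forall v, y0 <= v <= y0 + H0 -> RInt (fun u => p u v) x (x + L) =
           RInt (fun u => p u v) x (x + L/2) + RInt (fun u => p u v) (x + L/2) (x + L)).
        { intros v Hv. symmetry. apply (RInt_Chasles (fun u => p u v)); apply Hexq; lra. }
        assert (Cq : forall u, x0 <= u <= x0 + L0 -> RInt (fun v => q u v) y (y + H) =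
           RInt (fun v => q u v) y (y + H/2) + RInt (fun v => q u v) (y + H/2) (y + H)).
        { intros u Hu. symmetry. apply (RInt_Chasles (fun v => q u v)); apply Hexp; lra. }
        rewrite (Cp y), (Cp (y + H)), (Cq x), (Cq (x + L)) by lra.
        ring. }
      assert (Hlam : lam x y L H = lam x y (L/2) (H/2) + lam (x + L/2) y (L/2) (H/2)
         + lam x (y + H/2) (L/2) (H/2) + lam (x + L/2) (y + H/2) (L/2) (H/2)).
      { unfold lam.
        replace (x + L / 2 + L / 2) with (x + L) by field.
        replace (y + H / 2 + H / 2) with (y + H) by field. ring. }
      rewrite Hadd, Hlam.
      set (j1 := rect_int _ _ x y _ _). set (j2 := rect_int _ _ (x + L / 2) y _ _).
      set (j3 := rect_int _ _ x (y + H / 2) _ _). set (j4 := rect_int _ _ (x + L / 2) (y + H / 2) _ _).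
      assert (T1 := Rabs_triang (j1 + j2 + j3) j4). assert (T2 := Rabs_triang (j1 + j2) j3).
      assert (T3 := Rabs_triang j1 j2).
      replace ((L + H) ^ 2) with ((L/2 + H/2) ^ 2 * 4) by field. lra.
    - intros X Y HX HY.
      destruct (Classical_Prop.classic (X = X0 /\ Ey Y)) as [[-> HEy]|Hne].
      + set (e := eps * kap / 2).
        assert (He : 0 < e) by (unfold e; apply Rdiv_lt_0_compat; [nra|lra]).
        destruct (Hc X0 Y HX HY) as [C1 C2].
        destruct (C1 (mkposreal e He)) as [d1 Hd1]. destruct (C2 (mkposreal e He)) as [d2 Hd2].
        exists (Rmin d1 d2). split; [apply Rmin_pos; apply cond_pos|].
        intros n x y Hx1 Hx2 Hy1 Hy2 HXx HYy Hsm1 Hsm2. unfold m.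
        set (L := L0 / 2 ^ n) in *. set (H := H0 / 2 ^ n) in *.
        assert (Hp2 := pow2_pos n).
        assert (HLp : 0 < L) by (apply Rdiv_lt_0_compat; lra).
        assert (HHp : 0 < H) by (apply Rdiv_lt_0_compat; lra).
        assert (Hm1 := Rmin_l d1 d2). assert (Hm2 := Rmin_r d1 d2).
        assert (HJ : Rabs (rect_int p q x y L H) <= 2 * e * (L + H)).
        { apply (rect_int_affine_bound p q x y L H (p X0 Y) 0 0 (q X0 Y) 0);
            [lra|lra|apply Hexq; lra|apply Hexq; lra|apply Hexp; lra|apply Hexp; lra|].
          intros u v Hu Hv. rewrite !Rmult_0_l, !Rplus_0_r.
          split; left; [apply Hd1|apply Hd2]; apply Rabs_lt_between; lra. }
        assert (Hlam : kap * (L + H) <= lam x y L H).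
        { unfold lam.
          assert (A := root_weight_gap (x - X0) (x + L - X0) ltac:(lra)).
          assert (B := HW2 y (y + H) Y HEy HYy).
          replace (x + L - X0 - (x - X0)) with L in A by ring.
          replace (y + H - y) with H in B by ring.
          replace (kap * (L + H)) with (sqrt L * sqrt H).
          - apply Rmult_le_compat; try apply sqrt_pos; assumption.
          - rewrite <- sqrt_mult by lra. unfold kap, L, H.
            replace (L0 / 2 ^ n * (H0 / 2 ^ n)) with ((L0 * H0) * (/ 2 ^ n * / 2 ^ n)) by (field; lra).
            assert (0 < / 2 ^ n) by (apply Rinv_0_lt_compat; lra).
            rewrite sqrt_mult by nra. rewrite sqrt_square by lra. field; lra. }
        assert (Hsq : 0 <= (L + H) ^ 2) by nra.
        assert (2 * e * (L + H) = eps * (kap * (L + H))) by (unfold e; field).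
        nra.
      + destruct (Hd X Y HX HY Hne) as (a & b & c & D1 & D2).
        set (e := eps / 2). assert (He : 0 < e) by (unfold e; lra).
        destruct (D1 (mkposreal e He)) as [d1 Hd1]. destruct (D2 (mkposreal e He)) as [d2 Hd2].
        exists (Rmin d1 d2). split; [apply Rmin_pos; apply cond_pos|].
        intros n x y Hx1 Hx2 Hy1 Hy2 HXx HYy Hsm1 Hsm2. unfold m.
        set (L := L0 / 2 ^ n) in *. set (H := H0 / 2 ^ n) in *.
        assert (Hp2 := pow2_pos n).
        assert (HLp : 0 < L) by (apply Rdiv_lt_0_compat; lra).
        assert (HHp : 0 < H) by (apply Rdiv_lt_0_compat; lra).
        assert (Hm1 := Rmin_l d1 d2). assert (Hm2 := Rmin_r d1 d2).
        assert (HJ : Rabs (rect_int p q x y L H) <= 2 * (e * (L + H)) * (L + H)).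
        { apply (rect_int_affine_bound p q x y L H (p X Y - a * X - b * Y) a b (q X Y - b * X - c * Y) c);
            [lra|lra|apply Hexq; lra|apply Hexq; lra|apply Hexp; lra|apply Hexp; lra|].
          intros u v Hu Hv.
          assert (Hu' : Rabs (u - X) <= L) by (apply Rabs_le_between; lra).
          assert (Hv' : Rabs (v - Y) <= H) by (apply Rabs_le_between; lra).
          assert (Hmx : Rmax (Rabs (u - X)) (Rabs (v - Y)) <= L + H) by (apply Rmax_lub; lra).
          split.
          - replace (p u v - (p X Y - a * X - b * Y + a * u + b * v)) with
              (p u v - p X Y - (a * (u - X) + b * (v - Y))) by ring.
            eapply Rle_trans; [apply Hd1; lra|]. simpl. apply Rmult_le_compat_l; lra.
          - replace (q u v - (q X Y - b * X - c * Y + b * u + c * v)) with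
              (q u v - q X Y - (b * (u - X) + c * (v - Y))) by ring.
            eapply Rle_trans; [apply Hd2; lra|]. simpl. apply Rmult_le_compat_l; lra. }
        assert (Hlam : 0 <= lam x y L H).
        { unfold lam. assert (A := root_weight_incr (x - X0) (x + L - X0) ltac:(lra)).
          assert (B := HW1 y (y + H) ltac:(lra)). nra. }
        assert (2 * (e * (L + H)) * (L + H) = eps * (L + H) ^ 2) by (unfold e; field).
        nra. }
  destruct (Req_dec (rect_int p q x0 y0 L0 H0) 0) as [|Hne]; [assumption|exfalso].
  assert (Hpos := Rabs_pos_lt _ Hne).
  specialize (Hmain (Rabs (rect_int p q x0 y0 L0 H0) / (2 * tot))).
  replace (Rabs (rect_int p q x0 y0 L0 H0) / (2 * tot) * tot) with
    (Rabs (rect_int p q x0 y0 L0 H0) / 2) in Hmain by (field; lra).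
  assert (0 < Rabs (rect_int p q x0 y0 L0 H0) / (2 * tot)) by (apply Rdiv_lt_0_compat; lra).
  specialize (Hmain H). lra.
Qed.

(** * Complex derivatives and circle integrals *)

Definition cderiv (F : C -> C) (z l : C) : Prop :=
  is_derive (K := C_AbsRing) (V := C_NormedModule) F z l.

Lemma cderiv_eps (F : C -> C) (z l : C) :
  cderiv F z l <->
  forall eps : R, 0 < eps -> exists d : R, 0 < d /\ forall w : C, Cmod (w - z) < d ->
    Cmod (F w - F z - (w - z) * l) <= eps * Cmod (w - z).
Proof.
  split.
  - intros [_ H] eps Heps.
    destruct (H z (fun P HP => HP) (mkposreal eps Heps)) as [d Hd].
    exists d. split; [apply cond_pos|]. intros w Hw. exact (Hd w Hw).
  - intros H. split.
    + apply is_linear_scal_l.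
    + intros x Hx eps.
      replace x with z by exact (is_filter_lim_locally_unique (V := AbsRing_NormedModule C_AbsRing) z x Hx).
      destruct (H eps (cond_pos eps)) as (d & Hd & Hb).
      exists (mkposreal d Hd). intros w Hw. exact (Hb w Hw).
Qed.

(* Coquelicot has two normed module structures on C over itself; its product and chain rules
   need this one. *)
Lemma cderiv_AbsRing (F : C -> C) (z l : C) :
  cderiv F z l <-> is_derive (K := C_AbsRing) (V := AbsRing_NormedModule C_AbsRing) F z l.
Proof.
  rewrite cderiv_eps. split.
  - intros H. split.
    + apply is_linear_scal_l.
    + intros x Hx eps.
      replace x with z by exact (is_filter_lim_locally_unique (V := AbsRing_NormedModule C_AbsRing) z x Hx).
      destruct (H eps (cond_pos eps)) as (d & Hd & Hb).
      exists (mkposreal d Hd). intros w Hw. exact (Hb w Hw).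
  - intros [_ H] eps Heps.
    destruct (H z (fun P HP => HP) (mkposreal eps Heps)) as [d Hd].
    exists d. split; [apply cond_pos|]. intros w Hw. exact (Hd w Hw).
Qed.

Lemma cderiv_eq (F : C -> C) (z l l' : C) : cderiv F z l -> l = l' -> cderiv F z l'.
Proof. intros H <-; exact H. Qed.

Lemma cderiv_const (c z : C) : cderiv (fun _ => c) z 0%C.
Proof. exact (is_derive_const (K := C_AbsRing) (V := C_NormedModule) c z). Qed.

Lemma cderiv_id (z : C) : cderiv (fun w => w) z 1%C.
Proof. apply cderiv_AbsRing. exact (is_derive_id (K := C_AbsRing) z). Qed.

Lemma cderiv_plus (F G : C -> C) (z l m : C) :
  cderiv F z l -> cderiv G z m -> cderiv (fun w => F w + G w)%C z (l + m)%C.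
Proof. exact (is_derive_plus (K := C_AbsRing) (V := C_NormedModule) F G z l m). Qed.

Lemma cderiv_minus (F G : C -> C) (z l m : C) :
  cderiv F z l -> cderiv G z m -> cderiv (fun w => F w - G w)%C z (l - m)%C.
Proof. exact (is_derive_minus (K := C_AbsRing) (V := C_NormedModule) F G z l m). Qed.

Lemma cderiv_mult (F G : C -> C) (z l m : C) :
  cderiv F z l -> cderiv G z m -> cderiv (fun w => F w * G w)%C z (l * G z + F z * m)%C.
Proof.
  rewrite !cderiv_AbsRing. intros HF HG.
  exact (is_derive_mult (K := C_AbsRing) F G z l m HF HG Cmult_comm).
Qed.

Lemma cderiv_comp (F G : C -> C) (z l m : C) :
  cderiv F (G z) l -> cderiv G z m -> cderiv (fun w => F (G w)) z (m * l)%C.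
Proof.
  rewrite (cderiv_AbsRing G). intros HF HG.
  exact (is_derive_comp (K := C_AbsRing) (V := C_NormedModule) F G z l m HF HG).
Qed.

Lemma cderiv_unique (F : C -> C) (z l m : C) : cderiv F z l -> cderiv F z m -> l = m.
Proof.
  intros H1 H2. rewrite <- (is_C_derive_unique F z l H1). apply is_C_derive_unique, H2.
Qed.

Definition cdiff (F : C -> C) (z : C) : Prop := exists l : C, cderiv F z l.

Definition ccont (F : C -> C) (z : C) : Prop :=
  forall eps : R, 0 < eps -> exists d : R, 0 < d /\
    forall w : C, Cmod (w - z) < d -> Cmod (F w - F z) < eps.

Lemma Rabs_fst_le (z : C) : Rabs (fst z) <= Cmod z.
Proof. eapply Rle_trans; [|apply Rmax_Cmod]. apply Rmax_l. Qed.

Lemma Rabs_snd_le (z : C) : Rabs (snd z) <= Cmod z.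
Proof. eapply Rle_trans; [|apply Rmax_Cmod]. apply Rmax_r. Qed.

Lemma Cmod_le_2Rmax (z : C) : Cmod z <= 2 * Rmax (Rabs (fst z)) (Rabs (snd z)).
Proof.
  eapply Rle_trans; [apply Cmod_2Rmax|]. apply Rmult_le_compat_r.
  - eapply Rle_trans; [apply Rabs_pos|apply Rmax_l].
  - rewrite <- (sqrt_square 2) at 2 by lra. apply sqrt_le_1_alt; lra.
Qed.

Lemma cdiff_ccont (F : C -> C) (z : C) :
  cdiff F z -> ccont F z.
Proof.
  intros [l Hl] eps Heps. rewrite cderiv_eps in Hl.
  destruct (Hl 1 Rlt_0_1) as (d & Hd & Hb).
  assert (Hk : 0 < 1 + Cmod l) by (generalize (Cmod_ge_0 l); lra).
  exists (Rmin d (eps / (1 + Cmod l))). split.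
  { apply Rmin_pos; [assumption|apply Rdiv_lt_0_compat; lra]. }
  intros w Hw.
  assert (H1 := Rlt_le_trans _ _ _ Hw (Rmin_l _ _)). assert (H2 := Rlt_le_trans _ _ _ Hw (Rmin_r _ _)).
  specialize (Hb w H1).
  replace (F w - F z)%C with ((F w - F z - (w - z) * l) + (w - z) * l)%C by ring.
  eapply Rle_lt_trans; [apply Cmod_triangle|]. rewrite Cmod_mult.
  apply Rmult_lt_compat_r with (r := 1 + Cmod l) in H2; [|lra].
  replace (eps / (1 + Cmod l) * (1 + Cmod l)) with eps in H2 by (field; lra). nra.
Qed.

(** The Cauchy-Riemann equations. Read forwards they make the real and imaginary parts of F dz
    closed forms; read backwards they give the derivatives of the exponential and the logarithm from
    real calculus. *)
Lemma cderiv_real (F : C -> C) (x y a b : R) :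
  cderiv F (x, y) (a, b) <->
  differentiable_pt_lim (fun u v => fst (F (u, v))) x y a (- b) /\
  differentiable_pt_lim (fun u v => snd (F (u, v))) x y b a.
Proof.
  rewrite cderiv_eps. split.
  - intros H.
    assert (Hg : forall eps : posreal, locally_2d (fun u v =>
      Rabs (fst (F (u, v)) - fst (F (x, y)) - (a * (u - x) + - b * (v - y)))
        <= eps * Rmax (Rabs (u - x)) (Rabs (v - y)) /\
      Rabs (snd (F (u, v)) - snd (F (x, y)) - (b * (u - x) + a * (v - y)))
        <= eps * Rmax (Rabs (u - x)) (Rabs (v - y))) x y).
    { intros eps.
      destruct (H (eps / 2)) as (d & Hd & Hb); [generalize (cond_pos eps); lra|].
      assert (Hd2 : 0 < d / 2) by lra.
      exists (mkposreal _ Hd2). intros u v Hu Hv. simpl in Hu, Hv.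
      assert (Hm : Cmod ((u, v) - (x, y))%C <= 2 * Rmax (Rabs (u - x)) (Rabs (v - y))).
      { apply (Cmod_le_2Rmax ((u, v) - (x, y))%C). }
      assert (Hmx : Rmax (Rabs (u - x)) (Rabs (v - y)) < d / 2) by (apply Rmax_lub_lt; assumption).
      specialize (Hb (u, v) ltac:(lra)).
      assert (E := cond_pos eps).
      assert (Hc : Cmod (F (u, v) - F (x, y) - ((u, v) - (x, y)) * (a, b))%C
                   <= eps * Rmax (Rabs (u - x)) (Rabs (v - y))) by nra.
      split; (eapply Rle_trans; [|exact Hc]).
      - eapply Rle_trans; [|apply Rabs_fst_le]. right. f_equal.
        unfold Cminus, Cplus, Copp, Cmult; simpl. ring.
      - eapply Rle_trans; [|apply Rabs_snd_le]. right. f_equal.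
        unfold Cminus, Cplus, Copp, Cmult; simpl. ring. }
    split; intros eps; destruct (Hg eps) as [d Hd]; exists d; intros u v Hu Hv; apply Hd; assumption.
  - intros [H1 H2] eps Heps.
    assert (He : 0 < eps / 2) by lra.
    destruct (H1 (mkposreal _ He)) as [d1 Hd1]. destruct (H2 (mkposreal _ He)) as [d2 Hd2].
    exists (Rmin d1 d2). split; [apply Rmin_pos; apply cond_pos|].
    intros [u v] Hw.
    assert (Hu := Rabs_fst_le ((u, v) - (x, y))%C). assert (Hv := Rabs_snd_le ((u, v) - (x, y))%C).
    simpl fst in Hu. simpl snd in Hv.
    assert (Hm1 := Rmin_l d1 d2). assert (Hm2 := Rmin_r d1 d2).
    specialize (Hd1 u v). specialize (Hd2 u v). simpl in Hd1, Hd2. unfold Rminus in Hd1, Hd2.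
    specialize (Hd1 ltac:(lra) ltac:(lra)). specialize (Hd2 ltac:(lra) ltac:(lra)).
    eapply Rle_trans; [apply Cmod_le_2Rmax|].
    assert (Hmm : Rmax (Rabs (u + - x)) (Rabs (v + - y)) <= Cmod ((u, v) - (x, y))%C) by (apply Rmax_lub; assumption).
    assert (Hk : Rmax (Rabs (fst (F (u, v) - F (x, y) - ((u, v) - (x, y)) * (a, b))%C))
       (Rabs (snd (F (u, v) - F (x, y) - ((u, v) - (x, y)) * (a, b))%C))
       <= eps / 2 * Rmax (Rabs (u + - x)) (Rabs (v + - y))).
    { apply Rmax_lub.
      - eapply Rle_trans; [|exact Hd1]. right. f_equal.
        unfold Cminus, Cplus, Copp, Cmult; simpl. ring.
      - eapply Rle_trans; [|exact Hd2]. right. f_equal.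
        unfold Cminus, Cplus, Copp, Cmult; simpl. ring. }
    nra.
Qed.

Lemma differentiable_pt_lim_eq (f : R -> R -> R) (x y a b a' b' : R) :
  differentiable_pt_lim f x y a b -> a = a' -> b = b' -> differentiable_pt_lim f x y a' b'.
Proof. intros H -> ->; exact H. Qed.

Lemma differentiable_pt_lim_proj2_0 (f : R -> R) (x y l : R) :
  derivable_pt_lim f y l -> differentiable_pt_lim (fun _ v => f v) x y 0 l.
Proof.
  intros H.
  apply (differentiable_pt_lim_eq _ _ _ (l * 0 + 0 * 0) (l * 1 + 0 * 0)); [|ring|ring].
  apply (differentiable_pt_lim_comp (fun u _ => f u) (fun _ v => v) (fun _ _ => 0)).
  - apply differentiable_pt_lim_proj1_0, H.
  - intros eps. exists (mkposreal 1 Rlt_0_1). intros u v _ _.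
    replace (v - y - (0 * (u - x) + 1 * (v - y))) with 0 by ring. rewrite Rabs_R0.
    apply Rmult_le_pos; [left; apply cond_pos|]. eapply Rle_trans; [apply Rabs_pos|apply Rmax_l].
  - intros eps. exists (mkposreal 1 Rlt_0_1). intros u v _ _.
    replace (0 - 0 - (0 * (u - x) + 0 * (v - y))) with 0 by ring. rewrite Rabs_R0.
    apply Rmult_le_pos; [left; apply cond_pos|]. eapply Rle_trans; [apply Rabs_pos|apply Rmax_l].
Qed.

Lemma differentiable_pt_lim_mult2 (x y : R) : differentiable_pt_lim Rmult x y y x.
Proof.
  intros eps. exists eps. intros u v Hu Hv.
  replace (u * v - x * y - (y * (u - x) + x * (v - y))) with ((u - x) * (v - y)) by ring.
  rewrite Rabs_mult. apply Rmult_le_compat; try apply Rabs_pos; [lra|apply Rmax_r].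
Qed.

Lemma differentiable_pt_lim_mult (f g : R -> R -> R) (x y a b c d : R) :
  differentiable_pt_lim f x y a b -> differentiable_pt_lim g x y c d ->
  differentiable_pt_lim (fun u v => f u v * g u v) x y
    (g x y * a + f x y * c) (g x y * b + f x y * d).
Proof. intros Hf Hg. apply (differentiable_pt_lim_comp Rmult f g); [apply differentiable_pt_lim_mult2|assumption..]. Qed.

Definition cexp (z : C) : C := (exp (fst z) * cos (snd z), exp (fst z) * sin (snd z)).

Lemma cderiv_cexp (z : C) : cderiv cexp z (cexp z).
Proof.
  destruct z as [x y]. apply cderiv_real. simpl. split.
  - eapply differentiable_pt_lim_eq.
    + apply (differentiable_pt_lim_mult (fun u v => exp u) (fun u v => cos v)).
      * apply differentiable_pt_lim_proj1_0, derivable_pt_lim_exp.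
      * apply differentiable_pt_lim_proj2_0, derivable_pt_lim_cos.
    + simpl; ring.
    + simpl; ring.
  - eapply differentiable_pt_lim_eq.
    + apply (differentiable_pt_lim_mult (fun u v => exp u) (fun u v => sin v)).
      * apply differentiable_pt_lim_proj1_0, derivable_pt_lim_exp.
      * apply differentiable_pt_lim_proj2_0, derivable_pt_lim_sin.
    + simpl; ring.
    + simpl; ring.
Qed.

Definition cis (t : R) : C := (cos t, sin t).

Lemma Cmod_cis (t : R) : Cmod (cis t) = 1.
Proof.
  unfold Cmod, cis; simpl. rewrite !Rmult_1_r.
  replace (cos t * cos t + sin t * sin t) with 1; [apply sqrt_1|].
  generalize (sin2_cos2 t); unfold Rsqr; lra.
Qed.

(** Integration is against dt, so this is 2 pi times the mean, or the contour integral of F(w) dw /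
    (i w). Cauchy's kernel therefore appears below as w / (w - z). *)
Definition circle_int (F : C -> C) (r : R) : C :=
  (RInt (fun t => fst (F (r * cis t)%C)) 0 (2 * PI),
   RInt (fun t => snd (F (r * cis t)%C)) 0 (2 * PI)).

Lemma cos_eq_1_near (u : R) : Rabs u <= 2 * PI -> cos u = 1 -> u = 0 \/ u = 2 * PI \/ u = - (2 * PI).
Proof.
  intros Hu Hc.
  assert (Hs : sin (u / 2) = 0).
  { replace u with (2 * (u / 2)) in Hc by field. rewrite cos_2a_sin in Hc.
    assert (sin (u / 2) * sin (u / 2) = 0) by lra. apply Rmult_integral in H; tauto. }
  apply Rabs_le_between in Hu.
  destruct (Rle_lt_dec 0 u) as [H|H].
  - destruct (sin_eq_O_2PI_0 (u / 2)) as [E|[E|E]]; [lra|lra|assumption|lra|lra|].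
    generalize PI_RGT_0; lra.
  - assert (Hs' : sin (- (u / 2)) = 0) by (rewrite sin_neg; lra).
    destruct (sin_eq_O_2PI_0 (- (u / 2))) as [E|[E|E]]; [lra|lra|assumption|lra|lra|].
    generalize PI_RGT_0; lra.
Qed.

Lemma ccont_2d (F : C -> C) (a b : R -> R -> R) (x y : R) :
  ccont F (a x y, b x y) -> continuity_2d_pt a x y -> continuity_2d_pt b x y ->
  continuity_2d_pt (fun u v => fst (F (a u v, b u v))) x y /\
  continuity_2d_pt (fun u v => snd (F (a u v, b u v))) x y.
Proof.
  intros HF Ha Hb.
  assert (H : forall eps : posreal, locally_2d (fun u v =>
     Cmod (F (a u v, b u v) - F (a x y, b x y)) < eps) x y).
  { intros eps. destruct (HF eps (cond_pos eps)) as (d & Hd & HFd).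
    assert (Hd2 : 0 < d / 2) by lra.
    destruct (Ha (mkposreal _ Hd2)) as [d1 H1]. destruct (Hb (mkposreal _ Hd2)) as [d2 H2].
    assert (Hd3 : 0 < Rmin d1 d2) by (apply Rmin_pos; apply cond_pos).
    exists (mkposreal _ Hd3). simpl. intros u v Hu Hv.
    assert (M1 := Rmin_l d1 d2). assert (M2 := Rmin_r d1 d2).
    specialize (H1 u v ltac:(lra) ltac:(lra)). specialize (H2 u v ltac:(lra) ltac:(lra)).
    simpl in H1, H2. apply HFd.
    eapply Rle_lt_trans; [apply Cmod_le_2Rmax|]. simpl.
    enough (Rmax (Rabs (a u v + - a x y)) (Rabs (b u v + - b x y)) < d / 2) by lra.
    apply Rmax_lub_lt; assumption. }
  split; intros eps; destruct (H eps) as [d Hd]; exists d; intros u v Hu Hv;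
    (eapply Rle_lt_trans; [|apply (Hd u v Hu Hv)]).
  - exact (Rabs_fst_le (F (a u v, b u v) - F (a x y, b x y))%C).
  - exact (Rabs_snd_le (F (a u v, b u v) - F (a x y, b x y))%C).
Qed.

Lemma continuity_2d_pt_fst (f : R -> R) (x y : R) : continuity_pt f x -> continuity_2d_pt (fun u _ => f u) x y.
Proof.
  intros H. apply (continuity_1d_2d_pt_comp f (fun u _ => u)); [assumption|apply continuity_2d_pt_id1].
Qed.

Lemma continuity_2d_pt_snd (f : R -> R) (x y : R) : continuity_pt f y -> continuity_2d_pt (fun _ v => f v) x y.
Proof.
  intros H. apply (continuity_1d_2d_pt_comp f (fun _ v => v)); [assumption|apply continuity_2d_pt_id2].
Qed.

Lemma Cmod_polar (r t : R) : 0 <= r -> Cmod (r * cis t)%C = r.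
Proof. intro H. rewrite Cmod_mult, Cmod_cis, Cmod_R, Rabs_pos_eq by assumption. ring. Qed.

(** In the coordinates w = exp(x + iy) the annulus becomes a rectangle of height 2 pi: the
    horizontal sides cancel by periodicity and the vertical sides are the two circle integrals. At
    [z0] only continuity is assumed, because the lemma is applied to difference quotients, whose
    differentiability at the base point is not known beforehand. *)
Lemma circle_int_const (F : C -> C) (z0 : C) (r1 r2 : R) : 0 < r1 -> r1 < r2 ->
  (forall w, r1 <= Cmod w <= r2 -> ccont F w) ->
  (forall w, r1 <= Cmod w <= r2 -> w <> z0 -> cdiff F w) ->
  circle_int F r1 = circle_int F r2.
Proof.
  intros Hr1 Hr2 Hcont Hder.
  assert (HPI := PI_RGT_0).
  assert (Hln : ln r1 < ln r2) by (apply ln_increasing; assumption).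
  assert (Hrange : forall x, ln r1 <= x <= ln r2 -> r1 <= exp x <= r2).
  { intros x [Hx1 Hx2]. split.
    - rewrite <- (exp_ln r1) by lra. destruct Hx1 as [Hx1| ->]; [left; apply exp_increasing; assumption|lra].
    - rewrite <- (exp_ln r2) by lra. destruct Hx2 as [Hx2| ->]; [left; apply exp_increasing; assumption|lra]. }
  set (pt := fun x y => (exp x * cos y, exp x * sin y) : C).
  assert (Hpt : forall x y, pt x y = (exp x * cis y)%C).
  { intros x y. unfold pt, cis, Cmult, RtoC; simpl. f_equal; ring. }
  assert (Hptm : forall x y, Cmod (pt x y) = exp x).
  { intros x y. rewrite Hpt. apply Cmod_polar. left; apply exp_pos. }
  set (U := fun x y => fst (F (pt x y))). set (V := fun x y => snd (F (pt x y))).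
  set (Vn := fun x y => - V x y).
  assert (Hc : forall x y, ln r1 <= x <= ln r2 -> continuity_2d_pt U x y /\ continuity_2d_pt V x y).
  { intros x y Hx. apply ccont_2d.
    - apply Hcont. change (r1 <= Cmod (pt x y) <= r2). rewrite Hptm. apply Hrange, Hx.
    - apply continuity_2d_pt_mult; [apply continuity_2d_pt_fst; reg|apply continuity_2d_pt_snd; reg].
    - apply continuity_2d_pt_mult; [apply continuity_2d_pt_fst; reg|apply continuity_2d_pt_snd; reg]. }
  assert (Hd : forall x y, ln r1 <= x <= ln r2 -> pt x y <> z0 ->
     exists a b, differentiable_pt_lim U x y a (- b) /\ differentiable_pt_lim V x y b a).
  { intros x y Hx Hne.
    destruct (Hder (pt x y)) as [[a b] Hab]; [rewrite Hptm; apply Hrange, Hx|assumption|].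
    assert (HD : cderiv (fun w => F (cexp w)) (x, y)
        (cexp (x, y) * (a, b))%C).
    { apply (cderiv_comp F cexp).
      - exact Hab.
      - exact (cderiv_cexp (x, y)). }
    destruct (cexp (x, y) * (a, b))%C as [a' b'].
    apply cderiv_real in HD. exists a', b'. exact HD. }
  (* The preimages of [z0] lie on one vertical line, at a height [Y0] or at its translates by 2 pi;
     the translates matter when [z0] lies on the seam between the angles 0 and 2 pi. *)
  assert (HEy : exists Y0, forall x y, 0 <= y <= 2 * PI -> pt x y = z0 ->
     x = ln (Cmod z0) /\ (y = Y0 \/ y = Y0 + 2 * PI \/ y = Y0 - 2 * PI)).
  { destruct (Classical_Prop.classic (exists Y0, 0 <= Y0 <= 2 * PI /\ exists x, pt x Y0 = z0)) as [(Y0 & HY0 & x0 & E0)|Hno].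
    - exists Y0. intros x y Hy E.
      assert (Ex : x = ln (Cmod z0)) by (rewrite <- E, Hptm, ln_exp; reflexivity).
      assert (Ex0 : x0 = ln (Cmod z0)) by (rewrite <- E0, Hptm, ln_exp; reflexivity).
      split; [assumption|]. subst x x0.
      assert (E1 := eq_trans E0 (eq_sym E)). unfold pt in E1. injection E1 as Ec Es.
      set (e := exp (ln (Cmod z0))) in *. assert (He : 0 < e) by apply exp_pos.
      apply Rmult_eq_reg_l in Ec; [|lra]. apply Rmult_eq_reg_l in Es; [|lra].
      destruct (cos_eq_1_near (y - Y0)) as [G|[G|G]].
      + apply Rabs_le; lra.
      + rewrite cos_minus, Ec, Es. generalize (sin2_cos2 y); unfold Rsqr; lra.
      + left; lra.
      + right; left; lra.
      + right; right; lra.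
    - exists 0. intros x y Hy E. exfalso. apply Hno. exists y. split; [assumption|exists x; assumption]. }
  destruct HEy as [Y0 HEy].
  set (Ey := fun y => y = Y0 \/ y = Y0 + 2 * PI \/ y = Y0 - 2 * PI).
  set (W := fun y => root_weight (y - Y0) + root_weight (y - (Y0 + 2 * PI)) + root_weight (y - (Y0 - 2 * PI))).
  assert (HW1 : forall a b, a <= b -> W a <= W b).
  { intros a b Hab. unfold W.
    assert (A1 := root_weight_incr (a - Y0) (b - Y0) ltac:(lra)).
    assert (A2 := root_weight_incr (a - (Y0 + 2 * PI)) (b - (Y0 + 2 * PI)) ltac:(lra)).
    assert (A3 := root_weight_incr (a - (Y0 - 2 * PI)) (b - (Y0 - 2 * PI)) ltac:(lra)). lra. }
  assert (HW2 : forall a b Y, Ey Y -> a <= Y <= b -> sqrt (b - a) <= W b - W a).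
  { intros a b Y HY Hab. unfold W.
    assert (A1 := root_weight_incr (a - Y0) (b - Y0) ltac:(lra)).
    assert (A2 := root_weight_incr (a - (Y0 + 2 * PI)) (b - (Y0 + 2 * PI)) ltac:(lra)).
    assert (A3 := root_weight_incr (a - (Y0 - 2 * PI)) (b - (Y0 - 2 * PI)) ltac:(lra)).
    assert (A4 := root_weight_gap (a - Y) (b - Y) ltac:(lra)).
    replace (b - Y - (a - Y)) with (b - a) in A4 by ring.
    destruct HY as [->|[->| ->]]; lra. }
  (* With F = U + iV, the form F (dx + i dy) has imaginary part V dx + U dy, treated here, and real
     part U dx - V dy, treated in [J2]. *)
  assert (J1 : rect_int V U (ln r1) 0 (ln r2 - ln r1) (2 * PI) = 0).
  { apply rect_int_closed with (X0 := ln (Cmod z0)) (Ey := Ey) (W := W); try assumption; try lra.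
    - intros x y Hx Hy. destruct (Hc x y ltac:(lra)); split; assumption.
    - intros x y Hx Hy Hne. destruct (Hd x y ltac:(lra)) as (a & b & D1 & D2).
      + intro E. apply Hne. apply HEy; [lra|assumption].
      + exists b, a, (- b). split; assumption. }
  assert (J2 : rect_int U Vn (ln r1) 0 (ln r2 - ln r1) (2 * PI) = 0).
  { apply rect_int_closed with (X0 := ln (Cmod z0)) (Ey := Ey) (W := W); try assumption; try lra.
    - intros x y Hx Hy. destruct (Hc x y ltac:(lra)); split; [assumption|].
      apply continuity_2d_pt_opp; assumption.
    - intros x y Hx Hy Hne. destruct (Hd x y ltac:(lra)) as (a & b & D1 & D2).
      + intro E. apply Hne. apply HEy; [lra|assumption].
      + exists a, (- b), (- a). split; [assumption|].
        assert (Hm := differentiable_pt_lim_mult (fun _ _ => -1) V x y 0 0 b a).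
        simpl in Hm. eapply differentiable_pt_lim_eq.
        * eapply differentiable_pt_lim_ext; [|apply Hm; [|exact D2]].
          -- exists (mkposreal 1 Rlt_0_1). intros u v _ _. unfold Vn. simpl; ring.
          -- apply (differentiable_pt_lim_proj1_0 (fun _ => -1)). apply derivable_pt_lim_const.
        * simpl; ring.
        * simpl; ring. }
  assert (Hper : forall (G : R -> R -> R), (forall x y, G x y = U x y) \/ (forall x y, G x y = V x y) ->
     forall x, G x (0 + 2 * PI) = G x 0).
  { intros G HG x. assert (E : pt x (0 + 2 * PI) = pt x 0).
    { unfold pt. rewrite cos_plus, sin_plus, cos_2PI, sin_2PI, cos_0, sin_0. f_equal; ring. }
    destruct HG as [HG|HG]; rewrite !HG; unfold U, V; rewrite E; reflexivity. }
  unfold rect_int in J1, J2.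
  replace (ln r1 + (ln r2 - ln r1)) with (ln r2) in J1, J2 by ring.
  rewrite (RInt_ext (fun u => V u (0 + 2 * PI)) (fun u => V u 0)) in J1
    by (intros; apply Hper; right; reflexivity).
  rewrite (RInt_ext (fun u => U u (0 + 2 * PI)) (fun u => U u 0)) in J2
    by (intros; apply Hper; left; reflexivity).
  rewrite Rplus_0_l in J1, J2.
  assert (HexV : forall x, ln r1 <= x <= ln r2 -> ex_RInt (fun y => V x y) 0 (2 * PI)).
  { intros x Hx. apply ex_RInt_Reals_1. apply continuity_implies_RiemannInt; [lra|].
    intros v Hv. apply (continuity_2d_pt_section V x v), Hc, Hx. }
  unfold Vn in J2.
  assert (RV : forall x, ln r1 <= x <= ln r2 -> RInt (fun v => - V x v) 0 (2 * PI) = - RInt (fun v => V x v) 0 (2 * PI)).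
  { intros x Hx. exact (RInt_opp (V := R_CompleteNormedModule) (fun v => V x v) 0 (2 * PI) (HexV x Hx)). }
  rewrite !RV in J2 by lra.
  assert (Hcirc : forall r, 0 < r -> circle_int F r =
    (RInt (fun y => U (ln r) y) 0 (2 * PI), RInt (fun y => V (ln r) y) 0 (2 * PI))).
  { intros r Hr. unfold circle_int, U, V. f_equal; apply RInt_ext; intros t _; rewrite Hpt, exp_ln by lra; reflexivity. }
  rewrite !Hcirc by lra. f_equal; lra.
Qed.

(** * Cauchy's formula and Bessel's inequality *)

Lemma ccont_const (c z : C) : ccont (fun _ => c) z.
Proof. apply cdiff_ccont. exists 0%C. apply cderiv_const. Qed.

Lemma cdiff_plus (F G : C -> C) (z : C) : cdiff F z -> cdiff G z -> cdiff (fun w => F w + G w)%C z.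
Proof. intros [l Hl] [m Hm]. eexists; apply cderiv_plus; eassumption. Qed.

Lemma cdiff_minus (F G : C -> C) (z : C) : cdiff F z -> cdiff G z -> cdiff (fun w => F w - G w)%C z.
Proof. intros [l Hl] [m Hm]. eexists; apply cderiv_minus; eassumption. Qed.

Lemma cdiff_mult (F G : C -> C) (z : C) : cdiff F z -> cdiff G z -> cdiff (fun w => F w * G w)%C z.
Proof. intros [l Hl] [m Hm]. eexists; apply cderiv_mult; eassumption. Qed.

Lemma cdiff_comp (F G : C -> C) (z : C) : cdiff F (G z) -> cdiff G z -> cdiff (fun w => F (G w)) z.
Proof. intros [l Hl] [m Hm]. eexists; apply cderiv_comp; eassumption. Qed.

Lemma cdiff_const (c z : C) : cdiff (fun _ => c) z.
Proof. eexists; apply cderiv_const. Qed.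

Lemma cdiff_id (z : C) : cdiff (fun w => w) z.
Proof. eexists; apply cderiv_id. Qed.

Lemma cderiv_ext_loc (F G : C -> C) (z l : C) (d : R) : 0 < d ->
  (forall w, Cmod (w - z) < d -> F w = G w) -> cderiv F z l -> cderiv G z l.
Proof.
  intros Hd Heq HF. rewrite cderiv_eps in HF. rewrite cderiv_eps. intros eps Heps.
  destruct (HF eps Heps) as (d1 & Hd1 & Hb).
  exists (Rmin d d1). split; [apply Rmin_pos; assumption|]. intros w Hw.
  rewrite <- !Heq.
  - apply Hb. eapply Rlt_le_trans; [exact Hw|apply Rmin_r].
  - replace (z - z)%C with (RtoC 0) by ring. rewrite Cmod_0. assumption.
  - eapply Rlt_le_trans; [exact Hw|apply Rmin_l].
Qed.

Lemma Cmod_minus_sym (z w : C) : Cmod (z - w) = Cmod (w - z).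
Proof. rewrite <- Cmod_opp. f_equal. ring. Qed.

Lemma Cmod_triangle_rev (z w : C) : Cmod z - Cmod w <= Cmod (z - w).
Proof.
  assert (H := Cmod_triangle (z - w) w). replace (z - w + w)%C with z in H by ring. lra.
Qed.

Lemma Cmod_pos_neq (z : C) : 0 < Cmod z -> z <> 0%C.
Proof. intro H. apply Cmod_gt_0, H. Qed.

Lemma cderiv_inv (z : C) : z <> 0%C -> cderiv Cinv z (- / (z * z))%C.
Proof.
  intros Hz. assert (Hm := proj1 (Cmod_gt_0 z) Hz).
  apply cderiv_eps. intros eps Heps.
  set (m := Cmod z) in *.
  assert (Hm3 : 0 < m ^ 3) by (apply pow_lt; assumption).
  exists (Rmin (m / 2) (eps * m ^ 3 / 2)). split; [apply Rmin_pos; nra|].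
  intros w Hw.
  assert (H1 := Rlt_le_trans _ _ _ Hw (Rmin_l _ _)). assert (H2 := Rlt_le_trans _ _ _ Hw (Rmin_r _ _)).
  assert (Hwm : m / 2 < Cmod w).
  { assert (H := Cmod_triangle_rev z w). rewrite Cmod_minus_sym in H. fold m in H. lra. }
  assert (Hw0 : w <> 0%C) by (apply Cmod_pos_neq; lra).
  replace (/ w - / z - (w - z) * - / (z * z))%C with ((w - z) * (w - z) / (w * (z * z)))%C
    by (field; split; assumption).
  rewrite Cmod_div, !Cmod_mult by (repeat apply Cmult_neq_0; assumption).
  fold m. apply Rle_div_l; [assert (0 < m * m) by nra; nra|].
  assert (0 <= Cmod (w - z)) by apply Cmod_ge_0.
  assert (m ^ 3 / 2 <= Cmod w * (m * m)) by (replace (m ^ 3 / 2) with (m / 2 * (m * m)) by field; nra).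
  assert (Cmod (w - z) <= eps * (Cmod w * (m * m))) by nra. nra.
Qed.

Lemma cdiff_inv (F : C -> C) (z : C) : cdiff F z -> F z <> 0%C -> cdiff (fun w => / F w)%C z.
Proof.
  intros HF Hz. apply (cdiff_comp Cinv F); [|assumption]. eexists; apply cderiv_inv; assumption.
Qed.

Lemma cdiff_div (F G : C -> C) (z : C) : cdiff F z -> cdiff G z -> G z <> 0%C -> cdiff (fun w => F w / G w)%C z.
Proof. intros HF HG Hz. apply cdiff_mult; [assumption|apply cdiff_inv; assumption]. Qed.

Lemma continuous_of_eps (f : R -> R) (x : R) :
  (forall eps, 0 < eps -> exists d, 0 < d /\ forall y, Rabs (y - x) < d -> Rabs (f y - f x) < eps) ->
  continuous f x.
Proof.
  intros H P [e He]. destruct (H e (cond_pos e)) as (d & Hd & Hb).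
  exists (mkposreal d Hd). intros y Hy. apply He, Hb, Hy.
Qed.

Lemma cis_lip (s t : R) : Cmod (cis s - cis t) <= 2 * Rabs (s - t).
Proof.
  eapply Rle_trans; [apply Cmod_le_2Rmax|]. apply Rmult_le_compat_l; [lra|]. simpl.
  apply Rmax_lub.
  - destruct (MVT_abs cos (fun x => - sin x) t s) as (c & Hc & _).
    { intros c _. apply derivable_pt_lim_cos. }
    unfold Rminus in Hc. rewrite Hc. rewrite Rabs_Ropp.
    assert (Rabs (sin c) <= 1) by (apply Rabs_le; apply SIN_bound).
    generalize (Rabs_pos (s + - t)); unfold Rminus; nra.
  - destruct (MVT_abs sin cos t s) as (c & Hc & _).
    { intros c _. apply derivable_pt_lim_sin. }
    unfold Rminus in Hc. rewrite Hc.
    assert (Rabs (cos c) <= 1) by (apply Rabs_le; apply COS_bound).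
    generalize (Rabs_pos (s + - t)); unfold Rminus; nra.
Qed.

Lemma ccont_circle (F : C -> C) (r t : R) : 0 <= r -> ccont F (r * cis t)%C ->
  forall eps, 0 < eps -> exists d, 0 < d /\ forall s, Rabs (s - t) < d ->
    Cmod (F (r * cis s)%C - F (r * cis t)%C) < eps.
Proof.
  intros Hr HF eps Heps. destruct (HF eps Heps) as (d & Hd & Hb).
  exists (d / (2 * r + 1)). split; [apply Rdiv_lt_0_compat; lra|].
  intros s Hs. apply Hb.
  replace (r * cis s - r * cis t)%C with (r * (cis s - cis t))%C by ring.
  rewrite Cmod_mult, Cmod_R, Rabs_pos_eq by assumption.
  apply Rmult_lt_compat_r with (r := 2 * r + 1) in Hs; [|lra].
  replace (d / (2 * r + 1) * (2 * r + 1)) with d in Hs by (field; lra).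
  assert (H := cis_lip s t). generalize (Rabs_pos (s - t)). nra.
Qed.

Definition circle_ccont (F : C -> C) (r : R) : Prop := forall t, ccont F (r * cis t)%C.

Lemma circle_ccont_ball (F : C -> C) (r R0 : R) : 0 <= r < R0 ->
  (forall w, Cmod w < R0 -> cdiff F w) -> circle_ccont F r.
Proof. intros Hr H t. apply cdiff_ccont, H. rewrite Cmod_polar; lra. Qed.

Lemma circle_continuous (F : C -> C) (r t : R) : 0 <= r -> circle_ccont F r ->
  continuous (fun s => fst (F (r * cis s)%C)) t /\ continuous (fun s => snd (F (r * cis s)%C)) t.
Proof.
  intros Hr HF.
  split; apply continuous_of_eps; intros eps Heps;
    destruct (ccont_circle F r t Hr (HF t) eps Heps) as (d & Hd & Hb);
    exists d; (split; [assumption|]); intros s Hs; (eapply Rle_lt_trans; [|apply (Hb s Hs)]).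
  - apply (Rabs_fst_le (F (r * cis s)%C - F (r * cis t)%C)%C).
  - apply (Rabs_snd_le (F (r * cis s)%C - F (r * cis t)%C)%C).
Qed.

Lemma ex_RInt_circle (F : C -> C) (r a b : R) : 0 <= r -> circle_ccont F r ->
  ex_RInt (fun s => fst (F (r * cis s)%C)) a b /\ ex_RInt (fun s => snd (F (r * cis s)%C)) a b.
Proof.
  intros Hr HF. split; apply (ex_RInt_continuous (V := R_CompleteNormedModule)); intros t _;
    apply (circle_continuous F r t Hr HF).
Qed.

Lemma circle_int_ext (F G : C -> C) (r : R) :
  (forall t, F (r * cis t)%C = G (r * cis t)%C) -> circle_int F r = circle_int G r.
Proof. intros H. unfold circle_int. f_equal; apply RInt_ext; intros t _; rewrite H; reflexivity. Qed.

Lemma circle_int_plus (F G : C -> C) (r : R) : 0 <= r -> circle_ccont F r -> circle_ccont G r ->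
  circle_int (fun w => F w + G w)%C r = (circle_int F r + circle_int G r)%C.
Proof.
  intros Hr HF HG. destruct (ex_RInt_circle F r 0 (2 * PI) Hr HF) as [F1 F2].
  destruct (ex_RInt_circle G r 0 (2 * PI) Hr HG) as [G1 G2].
  unfold circle_int, Cplus; simpl. f_equal.
  - exact (RInt_plus (V := R_CompleteNormedModule) _ _ 0 (2 * PI) F1 G1).
  - exact (RInt_plus (V := R_CompleteNormedModule) _ _ 0 (2 * PI) F2 G2).
Qed.

Lemma RInt_lincomb (f g : R -> R) (a b al be : R) : ex_RInt f a b -> ex_RInt g a b ->
  RInt (fun t => al * f t + be * g t) a b = al * RInt f a b + be * RInt g a b.
Proof.
  intros Hf Hg. apply is_RInt_unique.
  apply (is_RInt_plus (V := R_NormedModule) (fun t => al * f t) (fun t => be * g t)).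
  - apply (is_RInt_scal (V := R_NormedModule) f a b al), (RInt_correct (V := R_CompleteNormedModule)), Hf.
  - apply (is_RInt_scal (V := R_NormedModule) g a b be), (RInt_correct (V := R_CompleteNormedModule)), Hg.
Qed.

Lemma RInt_pair_scal (c : C) (u : R -> C) (a b : R) :
  ex_RInt (fun t => fst (u t)) a b -> ex_RInt (fun t => snd (u t)) a b ->
  (RInt (fun t => fst (c * u t)%C) a b, RInt (fun t => snd (c * u t)%C) a b) =
  (c * (RInt (fun t => fst (u t)) a b, RInt (fun t => snd (u t)) a b))%C.
Proof.
  intros F1 F2. destruct c as [x y]. unfold Cmult; simpl. f_equal; [|apply RInt_lincomb; assumption].
  replace (x * RInt (fun t => fst (u t)) a b - y * RInt (fun t => snd (u t)) a b) with
    (x * RInt (fun t => fst (u t)) a b + - y * RInt (fun t => snd (u t)) a b) by ring.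
  rewrite <- RInt_lincomb by assumption.
  apply RInt_ext; intros t _. match goal with |- @eq _ ?v ?w => change (@eq R v w) end. ring.
Qed.

Lemma circle_int_scal (c : C) (F : C -> C) (r : R) : 0 <= r -> circle_ccont F r ->
  circle_int (fun w => c * F w)%C r = (c * circle_int F r)%C.
Proof.
  intros Hr HF. destruct (ex_RInt_circle F r 0 (2 * PI) Hr HF) as [F1 F2].
  exact (RInt_pair_scal c (fun t => F (r * cis t)%C) 0 (2 * PI) F1 F2).
Qed.

Lemma C_eq_of_close (K : R) (z w : C) : 0 < K ->
  (forall e, 0 < e -> Cmod (z - w) <= K * e) -> z = w.
Proof.
  intros HK H. destruct (Req_dec (Cmod (z - w)) 0) as [E|E].
  - apply Cmod_eq_0 in E. replace z with (z - w + w)%C by ring. rewrite E. ring.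
  - exfalso. assert (Hp := Cmod_ge_0 (z - w)).
    specialize (H (Cmod (z - w) / (2 * K)) ltac:(apply Rdiv_lt_0_compat; lra)).
    replace (K * (Cmod (z - w) / (2 * K))) with (Cmod (z - w) / 2) in H by (field; lra). lra.
Qed.

(** The constant is twice the length 2 pi because the modulus is bounded by twice the larger
    coordinate. *)
Lemma circle_int_close (F : C -> C) (c : C) (r e : R) : 0 <= r -> circle_ccont F r ->
  (forall t, Cmod (F (r * cis t)%C - c) <= e) -> Cmod (circle_int F r - 2 * PI * c) <= 4 * PI * e.
Proof.
  intros Hr HF Hb. destruct (ex_RInt_circle F r 0 (2 * PI) Hr HF) as [F1 F2].
  assert (HPI := PI_RGT_0).
  assert (A : Rabs (RInt (fun t => fst (F (r * cis t)%C)) 0 (2 * PI)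
      - (fst c * (2 * PI - 0) + 0 * ((2 * PI) ^ 2 - 0 ^ 2) / 2)) <= e * (2 * PI - 0)).
  { apply RInt_near_affine; [lra|assumption|]. intros t _.
    eapply Rle_trans; [|apply (Hb t)]. rewrite Rmult_0_l, Rplus_0_r. apply (Rabs_fst_le (F (r * cis t)%C - c)%C). }
  assert (B : Rabs (RInt (fun t => snd (F (r * cis t)%C)) 0 (2 * PI)
      - (snd c * (2 * PI - 0) + 0 * ((2 * PI) ^ 2 - 0 ^ 2) / 2)) <= e * (2 * PI - 0)).
  { apply RInt_near_affine; [lra|assumption|]. intros t _.
    eapply Rle_trans; [|apply (Hb t)]. rewrite Rmult_0_l, Rplus_0_r. apply (Rabs_snd_le (F (r * cis t)%C - c)%C). }
  eapply Rle_trans; [apply Cmod_le_2Rmax|].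
  replace (4 * PI * e) with (2 * (e * (2 * PI - 0))) by ring.
  apply Rmult_le_compat_l; [lra|]. apply Rmax_lub.
  - eapply Rle_trans; [|exact A]. right. f_equal. unfold circle_int, Cminus, Cplus, Copp, Cmult, RtoC; simpl. field.
  - eapply Rle_trans; [|exact B]. right. f_equal. unfold circle_int, Cminus, Cplus, Copp, Cmult, RtoC; simpl. field.
Qed.

(** The integral stays constant while the circle shrinks to 0, where continuity gives its value.
    Both 0 and [z0] may be points where only continuity is known. *)
Lemma circle_int_center (F : C -> C) (z0 : C) (r R0 : R) : 0 < r < R0 ->
  (forall w, Cmod w < R0 -> ccont F w) ->
  (forall w, 0 < Cmod w < R0 -> w <> z0 -> cdiff F w) ->
  circle_int F r = (2 * PI * F 0)%C.
Proof.
  intros Hr Hc Hd.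
  assert (HPI := PI_RGT_0).
  apply (C_eq_of_close (4 * PI)); [lra|].
  intros e He. destruct (Hc 0%C) with (eps := e) as (d & Hdp & Hb); [rewrite Cmod_0; lra|assumption|].
  set (s := Rmin d r / 2).
  assert (Hmin : 0 < Rmin d r) by (apply Rmin_pos; lra).
  assert (M1 := Rmin_l d r). assert (M2 := Rmin_r d r).
  assert (Hs : 0 < s < r) by (unfold s; lra).
  rewrite <- (circle_int_const F z0 s r); try lra.
  - apply circle_int_close; [lra| |].
    + intro t. apply Hc. rewrite Cmod_polar; lra.
    + intro t. left. apply Hb. replace (s * cis t - 0)%C with (s * cis t)%C by ring.
      rewrite Cmod_polar by lra. unfold s; lra.
  - intros w Hw. apply Hc; lra.
  - intros w Hw. apply Hd; lra.
Qed.

(** The difference quotient, completed at [z] so as to be continuous there when [l] is the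
    derivative. *)
Definition slope (F : C -> C) (z l w : C) : C :=
  if Ceq_dec w z then l else ((F w - F z) / (w - z))%C.

Lemma slope_spec (F : C -> C) (z l w : C) : F w = (F z + (w - z) * slope F z l w)%C.
Proof.
  unfold slope. destruct (Ceq_dec w z) as [->|H]; [ring|].
  field. intro E. apply H. replace w with (w - z + z)%C by ring. rewrite E. ring.
Qed.

Lemma slope_ccont (F : C -> C) (z l : C) : cderiv F z l -> ccont (slope F z l) z.
Proof.
  intros HF eps Heps. rewrite cderiv_eps in HF.
  destruct (HF (eps / 2) ltac:(lra)) as (d & Hd & Hb).
  exists d. split; [assumption|]. intros w Hw. specialize (Hb w Hw).
  unfold slope. destruct (Ceq_dec z z) as [_|]; [|contradiction].
  destruct (Ceq_dec w z) as [_|Hne].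
  - replace (l - l)%C with (RtoC 0) by ring. rewrite Cmod_0; assumption.
  - assert (Hz : (w - z)%C <> 0%C).
    { intro E. apply Hne. replace w with (w - z + z)%C by ring. rewrite E. ring. }
    replace ((F w - F z) / (w - z) - l)%C with ((F w - F z - (w - z) * l) / (w - z))%C by (field; assumption).
    rewrite Cmod_div by assumption. assert (Hp := proj1 (Cmod_gt_0 _) Hz).
    apply Rlt_div_l; [lra|]. nra.
Qed.

Lemma slope_cdiff (F : C -> C) (z l w : C) : w <> z -> cdiff F w -> cdiff (slope F z l) w.
Proof.
  intros Hne HF.
  assert (Hz : (w - z)%C <> 0%C).
  { intro E. apply Hne. replace w with (w - z + z)%C by ring. rewrite E. ring. }
  assert (Hp := proj1 (Cmod_gt_0 _) Hz).
  assert (HD : cdiff (fun v => (F v - F z) / (v - z))%C w).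
  { apply cdiff_div; [apply cdiff_minus; [assumption|apply cdiff_const]| |assumption].
    apply cdiff_minus; [apply cdiff_id|apply cdiff_const]. }
  destruct HD as [m Hm]. exists m. apply (cderiv_ext_loc _ _ _ _ _ Hp) with (2 := Hm).
  intros v Hv. unfold slope. destruct (Ceq_dec v z) as [->|]; [|reflexivity].
  rewrite Cmod_minus_sym in Hv. lra.
Qed.

(** The integral does not depend on the radius beyond |z|, and w / (w - z) tends to 1 as the circle
    grows. *)
Lemma cauchy_kernel (z : C) (r : R) : Cmod z < r -> circle_int (fun w => w / (w - z))%C r = (2 * PI)%C.
Proof.
  intros Hz. assert (HPI := PI_RGT_0). assert (Hz0 := Cmod_ge_0 z).
  assert (Hne : forall w, r <= Cmod w -> (w - z)%C <> 0%C).
  { intros w Hw. apply Cmod_pos_neq. generalize (Cmod_triangle_rev w z); lra. }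
  assert (Hd : forall w, r <= Cmod w -> cdiff (fun w => w / (w - z))%C w).
  { intros w Hw. apply cdiff_div; [apply cdiff_id| |apply Hne, Hw].
    apply cdiff_minus; [apply cdiff_id|apply cdiff_const]. }
  replace (2 * PI)%C with (2 * PI * 1)%C by ring.
  apply (C_eq_of_close (4 * PI)); [lra|].
  (* Large enough for |z| / |w - z| <= e on the circle of radius [s]. *)
  intros e He. set (s := r + 1 + Cmod z + Cmod z / e).
  assert (Hze : 0 <= Cmod z / e) by (apply Rdiv_le_0_compat; assumption).
  rewrite (circle_int_const _ z r s); [|lra|unfold s; lra| |].
  - apply circle_int_close; [unfold s; lra| |].
    + intro t. apply cdiff_ccont, Hd. rewrite Cmod_polar; unfold s; lra.
    + intro t.
      assert (Hw : Cmod (s * cis t) = s) by (apply Cmod_polar; unfold s; lra).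
      assert (Hw0 : (s * cis t - z)%C <> 0%C) by (apply Hne; rewrite Hw; unfold s; lra).
      replace (s * cis t / (s * cis t - z) - 1)%C with (z / (s * cis t - z))%C by (field; assumption).
      rewrite Cmod_div by assumption.
      assert (Hp := proj1 (Cmod_gt_0 _) Hw0).
      apply Rle_div_l; [assumption|].
      assert (Ht := Cmod_triangle_rev (s * cis t) z). rewrite Hw in Ht.
      assert (Hs : Cmod z / e <= Cmod (s * cis t - z)) by (unfold s in *; lra).
      apply Rle_div_l in Hs; lra.
  - intros w Hw. apply cdiff_ccont, Hd; lra.
  - intros w Hw _. apply Hd; lra.
Qed.

Lemma ccont_mult (F G : C -> C) (z : C) : ccont F z -> ccont G z -> ccont (fun w => F w * G w)%C z.
Proof.
  intros HF HG eps Heps.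
  set (M := Cmod (F z) + Cmod (G z) + 1).
  assert (HM : 1 <= M) by (unfold M; generalize (Cmod_ge_0 (F z)) (Cmod_ge_0 (G z)); lra).
  set (e := Rmin 1 (eps / (3 * M))).
  assert (He : 0 < e) by (apply Rmin_pos; [lra|apply Rdiv_lt_0_compat; lra]).
  destruct (HF e He) as (d1 & Hd1 & H1). destruct (HG e He) as (d2 & Hd2 & H2).
  exists (Rmin d1 d2). split; [apply Rmin_pos; assumption|]. intros w Hw.
  specialize (H1 w (Rlt_le_trans _ _ _ Hw (Rmin_l _ _))).
  specialize (H2 w (Rlt_le_trans _ _ _ Hw (Rmin_r _ _))).
  replace (F w * G w - F z * G z)%C with
    ((F w - F z) * (G w - G z) + ((F w - F z) * G z + F z * (G w - G z)))%C by ring.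
  eapply Rle_lt_trans; [apply Cmod_triangle|].
  assert (T := Cmod_triangle ((F w - F z) * G z) (F z * (G w - G z))).
  rewrite !Cmod_mult in *.
  assert (He1 : e <= 1) by apply Rmin_l.
  assert (He2 : e * (3 * M) <= eps).
  { assert (Q := Rmin_r 1 (eps / (3 * M))). fold e in Q. apply Rle_div_r in Q; lra. }
  assert (P1 := Cmod_ge_0 (F w - F z)). assert (P2 := Cmod_ge_0 (G w - G z)).
  assert (P3 := Cmod_ge_0 (F z)). assert (P4 := Cmod_ge_0 (G z)). unfold M in *. nra.
Qed.

(** The identity F(w) = F(z) + (w - z) slope(w) splits the integrand into w slope(w), whose mean is
    its value 0 at the origin, and F(z) times the kernel. *)
Lemma cauchy_formula (F : C -> C) (z : C) (r R0 : R) : Cmod z < r < R0 ->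
  (forall w, Cmod w < R0 -> cdiff F w) ->
  circle_int (fun w => F w * (w / (w - z)))%C r = (2 * PI * F z)%C.
Proof.
  intros Hr Hd. assert (Hz0 := Cmod_ge_0 z).
  destruct (Hd z ltac:(lra)) as [l Hl].
  assert (Hne : forall t, (r * cis t - z)%C <> 0%C).
  { intros t. apply Cmod_pos_neq. assert (Ht := Cmod_triangle_rev (r * cis t) z).
    rewrite Cmod_polar in Ht; lra. }
  assert (Hkc : circle_ccont (fun w => w / (w - z))%C r).
  { intro t. apply cdiff_ccont. apply cdiff_div; [apply cdiff_id| |apply Hne].
    apply cdiff_minus; [apply cdiff_id|apply cdiff_const]. }
  assert (Hsc : forall w, Cmod w < R0 -> ccont (fun w => w * slope F z l w)%C w).
  { intros w Hw. apply ccont_mult; [apply cdiff_ccont, cdiff_id|].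
    destruct (Ceq_dec w z) as [->|Hwz]; [apply slope_ccont; assumption|].
    apply cdiff_ccont, slope_cdiff; [assumption|apply Hd, Hw]. }
  rewrite (circle_int_ext _ (fun w => w * slope F z l w + F z * (w / (w - z)))%C).
  - rewrite circle_int_plus; [|lra| |].
    + rewrite circle_int_scal by (assumption || lra).
      rewrite cauchy_kernel by lra.
      rewrite (circle_int_center _ z r R0); [ring|lra|assumption|].
      intros w Hw Hwz. apply cdiff_mult; [apply cdiff_id|]. apply slope_cdiff; [assumption|apply Hd; lra].
    + intro t. apply Hsc. rewrite Cmod_polar; lra.
    + intro t. apply ccont_mult; [apply ccont_const|apply Hkc].
  - intro t. rewrite (slope_spec F z l (r * cis t)) at 1. field. apply Hne.
Qed.

(** With g(w) = g(0) + w h(w), the means of g and h over the circle are g(0) and l, and the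
    inequality is the integrated form of 0 <= |w (h(w) - l)|^2. *)
Lemma bessel_two_terms (g : C -> C) (l : C) (r R0 : R) : 0 < r < R0 ->
  (forall w, Cmod w < R0 -> cdiff g w) -> cderiv g 0%C l ->
  2 * PI * (Cmod (g 0%C) ^ 2 + r ^ 2 * Cmod l ^ 2) <=
    RInt (fun t => Cmod (g (r * cis t)%C) ^ 2) 0 (2 * PI).
Proof.
  intros Hr Hd Hl. assert (HPI := PI_RGT_0).
  set (h := slope g 0%C l).
  assert (Hgc : circle_ccont g r) by (apply (circle_ccont_ball g r R0); [lra|assumption]).
  assert (Hhc : forall w, Cmod w < R0 -> ccont h w).
  { intros w Hw. destruct (Ceq_dec w 0%C) as [->|Hw0]; [apply slope_ccont; assumption|].
    apply cdiff_ccont, slope_cdiff; [assumption|apply Hd, Hw]. }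
  assert (Hhcc : circle_ccont h r) by (intro t; apply Hhc; rewrite Cmod_polar; lra).
  assert (Eg : circle_int g r = (2 * PI * g 0)%C).
  { apply (circle_int_center g 0%C r R0); [lra| |].
    - intros w Hw. apply cdiff_ccont, Hd, Hw.
    - intros w Hw _. apply Hd; lra. }
  assert (Eh : circle_int h r = (2 * PI * l)%C).
  { rewrite (circle_int_center h 0%C r R0); [|lra|assumption|].
    - unfold h, slope. destruct (Ceq_dec 0%C 0%C); [reflexivity|contradiction].
    - intros w Hw Hw0. apply slope_cdiff; [assumption|apply Hd; lra]. }
  destruct (ex_RInt_circle g r 0 (2 * PI) ltac:(lra) Hgc) as [G1 G2].
  destruct (ex_RInt_circle h r 0 (2 * PI) ltac:(lra) Hhcc) as [H1 H2].
  set (a := fst (g 0%C)). set (b := snd (g 0%C)). set (c := fst l). set (d := snd l).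
  (* [lower] equals |g|^2 - r^2 |h - l|^2 and is affine in the coordinates of g and h, so its
     integral is known from their means. *)
  set (lower := fun t =>
     1 * (1 * (2 * a * fst (g (r * cis t)%C) + 2 * b * snd (g (r * cis t)%C)) +
          1 * (2 * r ^ 2 * c * fst (h (r * cis t)%C) + 2 * r ^ 2 * d * snd (h (r * cis t)%C)))
     + (- (a ^ 2 + b ^ 2 + r ^ 2 * (c ^ 2 + d ^ 2))) * 1).
  assert (Elin : forall (f g : R -> R) al be, ex_RInt f 0 (2 * PI) -> ex_RInt g 0 (2 * PI) ->
     ex_RInt (fun t => al * f t + be * g t) 0 (2 * PI)).
  { intros f k al be Hf Hk. apply (ex_RInt_plus (V := R_NormedModule) (fun t => al * f t) (fun t => be * k t)).
    - apply (ex_RInt_scal (V := R_NormedModule) f 0 (2 * PI) al Hf).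
    - apply (ex_RInt_scal (V := R_NormedModule) k 0 (2 * PI) be Hk). }
  assert (E1 : ex_RInt (fun _ : R => 1) 0 (2 * PI)) by apply ex_RInt_const.
  assert (Elow : RInt lower 0 (2 * PI) = 2 * PI * (a ^ 2 + b ^ 2 + r ^ 2 * (c ^ 2 + d ^ 2))).
  { unfold lower. rewrite RInt_lincomb; [|apply Elin; apply Elin; assumption|assumption].
    rewrite RInt_lincomb by (apply Elin; assumption).
    rewrite !RInt_lincomb by assumption. rewrite RInt_const.
    assert (Eg1 : RInt (fun t => fst (g (r * cis t)%C)) 0 (2 * PI) = 2 * PI * a).
    { transitivity (fst (circle_int g r)); [reflexivity|]. rewrite Eg. unfold a, Cmult, RtoC; simpl; ring. }
    assert (Eg2 : RInt (fun t => snd (g (r * cis t)%C)) 0 (2 * PI) = 2 * PI * b).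
    { transitivity (snd (circle_int g r)); [reflexivity|]. rewrite Eg. unfold b, Cmult, RtoC; simpl; ring. }
    assert (Eh1 : RInt (fun t => fst (h (r * cis t)%C)) 0 (2 * PI) = 2 * PI * c).
    { transitivity (fst (circle_int h r)); [reflexivity|]. rewrite Eh. unfold c, Cmult, RtoC; simpl; ring. }
    assert (Eh2 : RInt (fun t => snd (h (r * cis t)%C)) 0 (2 * PI) = 2 * PI * d).
    { transitivity (snd (circle_int h r)); [reflexivity|]. rewrite Eh. unfold d, Cmult, RtoC; simpl; ring. }
    rewrite Eg1, Eg2, Eh1, Eh2. unfold scal; simpl; unfold mult; simpl. ring. }
  rewrite !Cmod2_alt. unfold Re, Im. fold a b c d.
  rewrite <- Elow.
  apply RInt_le; [lra| | |].
  - unfold lower. apply Elin; [apply Elin; apply Elin; assumption|assumption].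
  - apply (ex_RInt_continuous (V := R_CompleteNormedModule)). intros t _.
    apply (continuous_ext (fun t => fst (g (r * cis t)%C) * fst (g (r * cis t)%C) + snd (g (r * cis t)%C) * snd (g (r * cis t)%C))).
    + intro s. rewrite Cmod2_alt. unfold Re, Im.
      match goal with |- @eq _ ?x ?y => change (@eq R x y) end. ring.
    + destruct (circle_continuous g r t ltac:(lra) Hgc).
      apply (continuous_plus (V := R_NormedModule)); apply (continuous_mult (K := R_AbsRing)); assumption.
  - intros t _. rewrite Cmod2_alt. unfold Re, Im, lower.
    assert (Hs := slope_spec g 0%C l (r * cis t)). fold h in Hs.
    set (w := (r * cis t)%C) in *.
    assert (Hwr : fst w ^ 2 + snd w ^ 2 = r ^ 2).
    { change (Re w ^ 2 + Im w ^ 2 = r ^ 2). rewrite <- (Cmod2_alt w). unfold w. rewrite Cmod_polar by lra. reflexivity. }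
    rewrite Hs. destruct w as [x y]. destruct (h (x, y)) as [u v].
    subst a b c d. destruct (g 0%C) as [a b]. destruct l as [c d]. simpl in *.
    rewrite <- Hwr.
    assert (Q : 0 <= ((x * u - y * v) - (x * c - y * d)) ^ 2 + ((x * v + y * u) - (x * d + y * c)) ^ 2)
      by (apply Rplus_le_le_0_compat; apply pow2_ge_0).
    match goal with |- ?A <= ?B => replace B with (A + (((x * u - y * v) - (x * c - y * d)) ^ 2 + ((x * v + y * u) - (x * d + y * c)) ^ 2)) by ring end.
    lra.
Qed.

(** * Polynomials: roots, reflection of zeros, approximation *)

(** Coefficients come in increasing degree, so [nth 0] and [nth 1] are the value and the derivative
    at 0. *)
Fixpoint peval (l : list C) (z : C) : C :=
  match l with nil => 0%C | c :: l => (c + z * peval l z)%C end.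

Lemma cdiff_peval (l : list C) (z : C) : cdiff (peval l) z.
Proof.
  induction l as [|c l IH]; simpl; [apply cdiff_const|].
  apply cdiff_plus; [apply cdiff_const|]. apply cdiff_mult; [apply cdiff_id|exact IH].
Qed.

Lemma Cmod_RtoC_pos (x : R) : 0 <= x -> Cmod (RtoC x) = x.
Proof. intro H. rewrite Cmod_R. apply Rabs_pos_eq, H. Qed.

Lemma peval_lower (l : list C) : l <> nil -> last l 0%C <> 0%C ->
  exists R0 m, 0 < m /\ forall z, R0 <= Cmod z -> m <= Cmod (peval l z).
Proof.
  induction l as [|c l IH]; [contradiction|]. intros _ Hl.
  destruct l as [|c' l].
  - exists 0, (Cmod c). split; [apply Cmod_gt_0, Hl|]. intros z _. simpl.
    right. f_equal. ring.
  - destruct IH as (R0 & m & Hm & Hb); [discriminate|exact Hl|].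
    exists (Rmax R0 ((1 + Cmod c) / m)), 1. split; [lra|]. intros z Hz.
    assert (H1 := Rle_trans _ _ _ (Rmax_l _ _) Hz). assert (H2 := Rle_trans _ _ _ (Rmax_r _ _) Hz).
    specialize (Hb z H1). change (peval (c :: c' :: l) z) with (c + z * peval (c' :: l) z)%C.
    set (v := peval (c' :: l) z) in *.
    assert (Ht := Cmod_triangle_rev (z * v) (- c)). replace (z * v - - c)%C with (c + z * v)%C in Ht by ring.
    rewrite Cmod_mult, Cmod_opp in Ht. apply Rle_div_l in H2; [|lra].
    assert (0 <= Cmod z) by apply Cmod_ge_0. nra.
Qed.

(** Without a root, 1/P would be entire and its value at 0 would be its mean over a large circle,
    where 1/P is small. *)
Lemma poly_has_root (c c' : C) (l : list C) : last (c' :: l) 0%C <> 0%C ->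
  exists a, peval (c :: c' :: l) a = 0%C.
Proof.
  intros Hl. apply Classical_Prop.NNPP. intros Hno.
  set (P := peval (c :: c' :: l)).
  assert (HP : forall z, P z <> 0%C) by (intros z Hz; apply Hno; exists z; exact Hz).
  assert (HPI := PI_RGT_0).
  assert (Hd : forall z, cdiff (fun w => / P w)%C z).
  { intro z. apply cdiff_inv; [apply cdiff_peval|apply HP]. }
  destruct (peval_lower (c' :: l)) as (R0 & m & Hm & Hb); [discriminate|exact Hl|].
  assert (H0 := proj1 (Cmod_gt_0 (P 0%C)) (HP 0%C)).
  assert (Hc := Cmod_ge_0 c).
  (* The factor 4 beats the constant of [circle_int_close]: the bound 4 pi / M is pi / |P(0)|, below
     the actual modulus 2 pi / |P(0)|. *)
  set (M := 4 * Cmod (P 0%C)).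
  set (r := Rmax 1 R0 + (M + Cmod c) / m).
  assert (Hq : 0 <= (M + Cmod c) / m) by (apply Rdiv_le_0_compat; unfold M; lra).
  assert (M1 := Rmax_l 1 R0). assert (M2 := Rmax_r 1 R0).
  assert (Hbig : forall w, Cmod w = r -> M <= Cmod (P w)).
  { intros w Hw. specialize (Hb w ltac:(unfold r in Hw; lra)).
    change (P w) with (c + w * peval (c' :: l) w)%C. set (v := peval (c' :: l) w) in *.
    assert (Ht := Cmod_triangle_rev (w * v) (- c)). replace (w * v - - c)%C with (c + w * v)%C in Ht by ring.
    rewrite Cmod_mult, Cmod_opp, Hw in Ht.
    assert (Hr : (M + Cmod c) / m <= r) by (unfold r; lra). apply Rle_div_l in Hr; [|lra].
    assert (Hrv : r * m <= r * Cmod v) by (apply Rmult_le_compat_l; [unfold r; lra|assumption]).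
    eapply Rle_trans; [|exact Ht]. lra. }
  assert (E : circle_int (fun w => / P w)%C r = (2 * PI * / P 0)%C).
  { apply (circle_int_center (fun w => / P w)%C 0%C r (r + 1)); [unfold r; lra| |].
    - intros w _. apply cdiff_ccont, Hd.
    - intros w _ _. apply Hd. }
  assert (B := circle_int_close (fun w => / P w)%C 0%C r (/ M)).
  rewrite E in B. specialize (B ltac:(unfold r; lra)).
  assert (Hcc : circle_ccont (fun w => / P w)%C r) by (intro t; apply cdiff_ccont, Hd).
  specialize (B Hcc).
  assert (HM : 0 < M) by (unfold M; lra).
  assert (B' : Cmod (2 * PI * / P 0 - 2 * PI * 0) <= 4 * PI * / M).
  { apply B. intro t. replace (/ P (r * cis t) - 0)%C with (/ P (r * cis t))%C by ring.
    rewrite Cmod_inv by apply HP. apply Rinv_le_contravar; [lra|]. apply Hbig. apply Cmod_polar. unfold r; lra. }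
  replace (2 * PI * / P 0 - 2 * PI * 0)%C with (2 * PI * / P 0)%C in B' by ring.
  rewrite !Cmod_mult, Cmod_inv, !Cmod_RtoC_pos in B' by (try apply HP; lra).
  unfold M in B'.
  replace (4 * PI * / (4 * Cmod (P 0%C))) with (PI * / Cmod (P 0%C)) in B' by (field; lra).
  assert (0 < / Cmod (P 0%C)) by (apply Rinv_0_lt_compat; lra). nra.
Qed.

(** Synthetic division by z - a: the coefficients of the quotient are the values at [a] of the
    successive tails. *)
Fixpoint pdivroot (a : C) (l : list C) : list C :=
  match l with
  | nil => nil
  | _ :: l' => match l' with nil => nil | _ => peval l' a :: pdivroot a l' end
  end.

Lemma pdivroot_spec (a : C) (l : list C) (z : C) :
  peval l z = (peval l a + (z - a) * peval (pdivroot a l) z)%C.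
Proof.
  induction l as [|c [|c' l] IH]; [simpl; ring|simpl; ring|].
  change (peval (c :: c' :: l) z) with (c + z * peval (c' :: l) z)%C.
  change (peval (c :: c' :: l) a) with (c + a * peval (c' :: l) a)%C.
  change (peval (pdivroot a (c :: c' :: l)) z) with (peval (c' :: l) a + z * peval (pdivroot a (c' :: l)) z)%C.
  rewrite IH. ring.
Qed.

Lemma pdivroot_length (a c : C) (l : list C) : length (pdivroot a (c :: l)) = length l.
Proof.
  revert c. induction l as [|c' l IH]; intro c; [reflexivity|].
  change (pdivroot a (c :: c' :: l)) with (peval (c' :: l) a :: pdivroot a (c' :: l)).
  exact (f_equal S (IH c')).
Qed.

Lemma pdivroot_last (a c c' : C) (l : list C) : last (pdivroot a (c :: c' :: l)) 0%C = last (c' :: l) 0%C.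
Proof.
  revert c c'. induction l as [|c'' l IH]; intros c c'; [simpl; ring|].
  change (pdivroot a (c :: c' :: c'' :: l)) with (peval (c' :: c'' :: l) a :: pdivroot a (c' :: c'' :: l)).
  change (last (c' :: c'' :: l) 0%C) with (last (c'' :: l) 0%C). rewrite <- (IH c' c'').
  change (pdivroot a (c' :: c'' :: l)) with (peval (c'' :: l) a :: pdivroot a (c'' :: l)).
  reflexivity.
Qed.

Definition csum (bs : list C) : C := fold_right Cplus 0%C bs.
Definition linprod (bs : list C) (z : C) : C := fold_right (fun b v => (1 - b * z) * v)%C 1%C bs.

Lemma Cmod_conj_mult (a : C) : (a * Cconj a)%C = RtoC (Cmod a ^ 2).
Proof. symmetry. apply Cmod2_conj. Qed.

(* [B0], [B1] are the value and the derivative at 0 of the Blaschke product of the zeros in the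
   disc, and [k * linprod bs] is the polynomial with these zeros reflected in the circle. *)
Lemma poly_blaschke (n : nat) (l : list C) : length l = S n -> last l 0%C <> 0%C ->
  exists (k B0 B1 : C) (bs : list C),
    k <> 0%C /\ List.Forall (fun b => Cmod b <= 1) bs /\
    Cmod B0 <= 1 /\ Cmod B1 <= 1 - Cmod B0 ^ 2 /\
    nth 0 l 0%C = (B0 * k)%C /\ nth 1 l 0%C = (B1 * k - B0 * k * csum bs)%C /\
    forall z, Cmod z = 1 -> Cmod (peval l z) = Cmod k * Cmod (linprod bs z).
Proof.
  revert l. induction n as [|n IH]; intros l Hlen Hlast.
  - destruct l as [|c [|c' l]]; try discriminate. simpl in Hlast.
    exists c, 1%C, 0%C, nil. rewrite Cmod_1, Cmod_0. repeat split.
    + assumption.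
    + constructor.
    + lra.
    + lra.
    + simpl; ring.
    + simpl; ring.
    + intros z _. simpl. rewrite Cmod_1, Rmult_1_r. f_equal; ring.
  - destruct l as [|c [|c' l]]; try discriminate.
    destruct (poly_has_root c c' l Hlast) as [a Ha].
    assert (Hspec := pdivroot_spec a (c :: c' :: l)). rewrite Ha in Hspec.
    set (q := pdivroot a (c :: c' :: l)) in *.
    destruct (IH q) as (k & B0 & B1 & bs & Hk & Hbs & HB0 & HB1 & Hq0 & Hq1 & Hmod).
    { unfold q. rewrite pdivroot_length. simpl in Hlen |- *. lia. }
    { unfold q. rewrite pdivroot_last. exact Hlast. }
    assert (P0 : c = (- a * nth 0 q 0)%C).
    { assert (Hs := Ha). change (peval (c :: c' :: l) a) with (c + a * peval (c' :: l) a)%C in Hs.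
      change (nth 0 q 0%C) with (peval (c' :: l) a).
      replace c with (c + a * peval (c' :: l) a - a * peval (c' :: l) a)%C by ring. rewrite Hs. ring. }
    assert (P1 : c' = (nth 0 q 0 - a * nth 1 q 0)%C).
    { change (nth 0 q 0%C) with (c' + a * peval l a)%C.
      assert (Hn : (a * nth 1 q 0)%C = (a * peval l a)%C).
      { unfold q. destruct l as [|c'' l]; reflexivity. }
      rewrite Hn. ring. }
    (* A root on or outside the circle is kept, as -a (1 - z/a); a root inside is replaced by 1 -
       conj(a) z, which has the modulus of z - a on the circle. Roots on the circle give |b| = 1. *)
    destruct (Rle_lt_dec 1 (Cmod a)) as [Ha1|Ha1].
    + assert (Ha0 : a <> 0%C) by (apply Cmod_pos_neq; lra).
      exists (- a * k)%C, B0, B1, (/ a :: bs)%C. split; [|split; [|split; [|split; [|split; [|split]]]]].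
      * apply Cmult_neq_0; [|assumption]. intro E. apply Ha0. replace a with (- - a)%C by ring. rewrite E. ring.
      * constructor; [|assumption]. rewrite Cmod_inv by assumption.
        rewrite <- Rinv_1. apply Rinv_le_contravar; lra.
      * assumption.
      * assumption.
      * simpl nth. rewrite P0, Hq0. ring.
      * simpl nth. rewrite P1, Hq0, Hq1. simpl csum. unfold csum. simpl fold_right. field. assumption.
      * intros z Hz. rewrite Hspec. specialize (Hmod z Hz).
        unfold linprod. simpl fold_right. fold (linprod bs z).
        replace (0 + (z - a) * peval q z)%C with (- a * ((1 - / a * z) * peval q z))%C by (field; assumption).
        rewrite !Cmod_mult, Hmod. ring.
    + assert (Hca : (a * Cconj a)%C = RtoC (Cmod a ^ 2)) by apply Cmod_conj_mult.
      assert (Hage := Cmod_ge_0 a). assert (HB0ge := Cmod_ge_0 B0). assert (HB1ge := Cmod_ge_0 B1).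
      (* At 0 the factor (z - a)/(1 - conj(a) z) has value -a and derivative 1 - |a|^2; the new pair
         comes from the product rule. *)
      exists k, (- a * B0)%C, ((1 - a * Cconj a) * B0 - a * B1)%C, (Cconj a :: bs)%C.
      split; [|split; [|split; [|split; [|split; [|split]]]]].
      * assumption.
      * constructor; [|assumption]. rewrite Cmod_conj; lra.
      * rewrite Cmod_mult, Cmod_opp. nra.
      * replace ((1 - a * Cconj a) * B0 - a * B1)%C with ((1 - a * Cconj a) * B0 + - a * B1)%C by ring.
        eapply Rle_trans; [apply Cmod_triangle|]. rewrite Hca, <- RtoC_minus, !Cmod_mult, Cmod_opp.
        rewrite Cmod_RtoC_pos by nra.
        set (x := Cmod a) in *. set (y := Cmod B0) in *.
        assert (x * Cmod B1 <= x * (1 - y ^ 2)) by (apply Rmult_le_compat_l; assumption).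
        (* The product expands to 1 - x^2 y^2 - (1 - x^2) y - x (1 - y^2), so the bound |B1| <= 1 -
           |B0|^2 survives the multiplication by one more Blaschke factor. *)
        assert (0 <= (1 - x) * (1 - y) * (1 - x * y)).
        { apply Rmult_le_pos; [apply Rmult_le_pos; lra|nra]. }
        nra.
      * simpl nth. rewrite P0, Hq0. ring.
      * simpl nth. rewrite P1, Hq0, Hq1. unfold csum. simpl fold_right. ring.
      * intros z Hz. rewrite Hspec. specialize (Hmod z Hz).
        unfold linprod. simpl fold_right. fold (linprod bs z).
        assert (Hza : Cmod (z - a) = Cmod (1 - Cconj a * z)).
        { assert (Hzz := Cmod_conj_mult z). rewrite Hz in Hzz.
          rewrite <- (Cmod_conj (z - a)), <- (Rmult_1_r (Cmod (Cconj (z - a)))), <- Hz, <- Cmod_mult.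
          f_equal. rewrite Cminus_conj.
          replace ((Cconj z - Cconj a) * z)%C with (z * Cconj z - Cconj a * z)%C by ring.
          rewrite Hzz. f_equal. f_equal. rewrite Hz; ring. }
        replace (0 + (z - a) * peval q z)%C with ((z - a) * peval q z)%C by ring.
        rewrite !Cmod_mult, Hmod, Hza. ring.
Qed.

(** [poly_blaschke] counts roots by the length of the list and needs a nonzero leading
    coefficient. *)
Lemma poly_trim (l : list C) :
  (forall k, nth k l 0%C = 0%C) /\ (forall z, peval l z = 0%C) \/
  exists l' : list C, l' <> nil /\ last l' 0%C <> 0%C /\ (forall k, nth k l' 0%C = nth k l 0%C) /\
    forall z, peval l' z = peval l z.
Proof.
  induction l as [|c l IH].
  - left. split; [intros [|k]; reflexivity|reflexivity].
  - destruct IH as [[H1 H2]|(l' & Hn & Hl & H1 & H2)].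
    + destruct (Ceq_dec c 0%C) as [->|Hc].
      * left. split; [intros [|k]; [reflexivity|apply H1]|intro z; simpl; rewrite H2; ring].
      * right. exists (c :: nil). split; [discriminate|split; [exact Hc|split]].
        -- intros [|k]; [reflexivity|]. simpl. rewrite H1. destruct k; reflexivity.
        -- intro z; simpl; rewrite H2; reflexivity.
    + right. exists (c :: l'). split; [discriminate|split; [|split]].
      * destruct l' as [|c' l']; [contradiction|exact Hl].
      * intros [|k]; [reflexivity|apply H1].
      * intro z; simpl; rewrite H2; reflexivity.
Qed.

(** * Taylor polynomials and uniform approximation on the closed disc *)

Fixpoint pcoefs (c : nat -> C) (k n : nat) : list C :=
  match n with O => nil | S n => c k :: pcoefs c (S k) n end.

Lemma circle_bounded (F : C -> C) (r : R) : 0 <= r -> circle_ccont F r ->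
  exists M, 0 <= M /\ forall t, 0 <= t <= 2 * PI -> Cmod (F (r * cis t)%C) <= M.
Proof.
  intros Hr HF. assert (HPI := PI_RGT_0).
  destruct (ex_RInt_circle F r 0 (2 * PI) Hr HF) as [H1 H2].
  destruct (ex_RInt_ub (V := R_NormedModule) _ _ _ H1) as [M1 HM1].
  destruct (ex_RInt_ub (V := R_NormedModule) _ _ _ H2) as [M2 HM2].
  rewrite Rmin_left, Rmax_right in HM1, HM2 by lra.
  exists (2 * Rmax (Rmax M1 M2) 0). split.
  { assert (H := Rmax_r (Rmax M1 M2) 0). lra. }
  intros t Ht. eapply Rle_trans; [apply Cmod_le_2Rmax|]. apply Rmult_le_compat_l; [lra|].
  eapply Rle_trans; [|apply Rmax_l].
  apply Rmax_lub; [eapply Rle_trans; [apply (HM1 t Ht)|apply Rmax_l]|eapply Rle_trans; [apply (HM2 t Ht)|apply Rmax_r]].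
Qed.

Lemma Cpow_nz (z : C) (n : nat) : z <> 0%C -> (z ^ n)%C <> 0%C.
Proof. intros Hz. apply Cmod_pos_neq. rewrite Cmod_pow. apply pow_lt, Cmod_gt_0, Hz. Qed.

Lemma cdiff_pow (n : nat) (z : C) : cdiff (fun w => w ^ n)%C z.
Proof.
  induction n as [|n IH]; [exact (cdiff_const 1%C z)|].
  exact (cdiff_mult (fun w => w) (fun w => w ^ n)%C z (cdiff_id z) IH).
Qed.

Lemma cis_2PI_periodic (t : R) : exists s, 0 <= s <= 2 * PI /\ cis s = cis t.
Proof.
  assert (HPI := PI_RGT_0).
  destruct (archimed (t / (2 * PI))) as [A1 A2]. set (k := up (t / (2 * PI))) in *.
  exists (t - 2 * PI * (IZR k - 1)).
  assert (Hp : 0 < / (2 * PI)) by (apply Rinv_0_lt_compat; lra).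
  assert (Ht : t = t / (2 * PI) * (2 * PI)) by (field; lra).
  split; [nra|].
  unfold cis. rewrite <- minus_IZR.
  destruct (Z.le_gt_cases 0 (k - 1)) as [Hk|Hk].
  - assert (Ek : IZR (k - 1) = INR (Z.to_nat (k - 1))) by (rewrite INR_IZR_INZ, Z2Nat.id; trivial).
    rewrite Ek. set (m := Z.to_nat (k - 1)).
    replace t with (t - 2 * PI * INR m + 2 * INR m * PI) at 3 4 by ring.
    rewrite cos_period, sin_period. reflexivity.
  - assert (Ek : IZR (k - 1) = - INR (Z.to_nat (- (k - 1)))).
    { rewrite INR_IZR_INZ, Z2Nat.id by lia. rewrite opp_IZR. ring. }
    rewrite Ek. set (m := Z.to_nat (- (k - 1))).
    replace (t - 2 * PI * - INR m) with (t + 2 * INR m * PI) by ring.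
    rewrite cos_period, sin_period. reflexivity.
Qed.

(** Cauchy's formula is expanded by iterating 1/(v - w) = 1/v + w/(v (v - w)). The remainder after n
    terms is w^n times an integral of order r^(-n), uniformly for |w| <= 1, with r > 1. The value
    and the derivative at 0 are kept exactly, as the extremal problem is about them. *)
Lemma poly_approx (F : C -> C) (l : C) (R0 eps : R) : 1 < R0 ->
  (forall w, Cmod w < R0 -> cdiff F w) -> cderiv F 0%C l -> 0 < eps ->
  exists P : list C, nth 0 P 0%C = F 0%C /\ nth 1 P 0%C = l /\
    forall z, Cmod z <= 1 -> Cmod (F z - peval P z) <= eps.
Proof.
  intros HR Hd Hl Heps. assert (HPI := PI_RGT_0).
  set (r := (1 + R0) / 2). assert (Hr : 1 < r < R0) by (unfold r; lra).
  assert (HFc : circle_ccont F r) by (apply (circle_ccont_ball F r R0); [lra|assumption]).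
  destruct (circle_bounded F r ltac:(lra) HFc) as (M & HM0 & HM).
  assert (HM' : forall t, Cmod (F (r * cis t)%C) <= M).
  { intro t. destruct (cis_2PI_periodic t) as (s & Hs & <-). apply HM, Hs. }
  assert (Hv : forall t, (r * cis t)%C <> 0%C) by (intro t; apply Cmod_pos_neq; rewrite Cmod_polar; lra).
  set (c := fun n : nat => (/ (2 * PI) * circle_int (fun v => F v * / v ^ n) r)%C).
  set (rem := fun (n : nat) (w : C) => (/ (2 * PI) * circle_int (fun v => F v * / v ^ n * (v / (v - w))) r)%C).
  assert (H2PI : (2 * PI)%C <> 0%C).
  { apply Cmod_pos_neq. rewrite Cmod_mult, !Cmod_RtoC_pos; lra. }
  assert (Hpc : forall n, circle_ccont (fun v => F v * / v ^ n)%C r).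
  { intros n t. apply ccont_mult; [apply HFc|]. apply cdiff_ccont. apply cdiff_inv; [apply cdiff_pow|apply Cpow_nz, Hv]. }
  assert (Hkc : forall w, Cmod w < r -> circle_ccont (fun v => v / (v - w))%C r).
  { intros w Hw t. apply cdiff_ccont. apply cdiff_div; [apply cdiff_id| |].
    - apply cdiff_minus; [apply cdiff_id|apply cdiff_const].
    - apply Cmod_pos_neq. assert (Ht := Cmod_triangle_rev (r * cis t) w). rewrite Cmod_polar in Ht; lra. }
  assert (Hrem0 : forall w, Cmod w < r -> rem 0%nat w = F w).
  { intros w Hw. unfold rem.
    rewrite (circle_int_ext _ (fun v => F v * (v / (v - w)))%C).
    - rewrite (cauchy_formula F w r R0); [rewrite Cmult_assoc, Cinv_l by exact H2PI; ring|lra|assumption].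
    - intro t. simpl. field. apply Cmod_pos_neq. assert (Ht := Cmod_triangle_rev (r * cis t) w). rewrite Cmod_polar in Ht; lra. }
  assert (HremS : forall n w, Cmod w < r -> rem n w = (c n + w * rem (S n) w)%C).
  { intros n w Hw. unfold rem, c.
    assert (Hcc : circle_ccont (fun v => F v * / v ^ (S n) * (v / (v - w)))%C r).
    { intro t. apply (ccont_mult (fun v => F v * / v ^ (S n))%C); [apply Hpc|apply Hkc, Hw]. }
    rewrite (circle_int_ext (fun v => F v * / v ^ n * (v / (v - w)))%C
       (fun v => F v * / v ^ n + w * (F v * / v ^ (S n) * (v / (v - w))))%C).
    - rewrite circle_int_plus; [|lra|apply Hpc|].
      + rewrite circle_int_scal by (assumption || lra). ring.
      + intro t. apply ccont_mult; [apply ccont_const|apply Hcc].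
    - intro t. set (v := (r * cis t)%C).
      assert (Hv0 : v <> 0%C) by apply Hv.
      assert (Hvn := Cpow_nz v n Hv0).
      assert (Hvw : (v - w)%C <> 0%C).
      { apply Cmod_pos_neq. assert (Ht := Cmod_triangle_rev v w). unfold v in Ht at 1. rewrite Cmod_polar in Ht; lra. }
      simpl. field. repeat split; assumption. }
  assert (Hrembound : forall n w, Cmod w <= 1 -> Cmod (rem n w) <= 2 * (M * / r ^ n * (r / (r - 1)))).
  { intros n w Hw. unfold rem.
    assert (Hcc : circle_ccont (fun v => F v * / v ^ n * (v / (v - w)))%C r).
    { intro t. apply (ccont_mult (fun v => F v * / v ^ n)%C); [apply Hpc|apply Hkc; lra]. }
    assert (B := circle_int_close _ 0%C r (M * / r ^ n * (r / (r - 1))) ltac:(lra) Hcc).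
    rewrite Cmod_mult, Cmod_inv, Cmod_mult, !Cmod_RtoC_pos by (try assumption; lra).
    assert (B' : Cmod (circle_int (fun v => F v * / v ^ n * (v / (v - w)))%C r) <= 4 * PI * (M * / r ^ n * (r / (r - 1)))).
    { replace (circle_int (fun v => F v * / v ^ n * (v / (v - w)))%C r) with
        (circle_int (fun v => F v * / v ^ n * (v / (v - w)))%C r - 2 * PI * 0)%C by ring.
      apply B. intro t. set (v := (r * cis t)%C).
      assert (Hvm : Cmod v = r) by (apply Cmod_polar; lra).
      assert (Hvw : r - 1 <= Cmod (v - w)) by (assert (Ht := Cmod_triangle_rev v w); lra).
      replace (F v * / v ^ n * (v / (v - w)) - 0)%C with (F v * / v ^ n * (v / (v - w)))%C by ring.
      assert (Hvn : (v ^ n)%C <> 0%C) by apply Cpow_nz, Hv.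
      assert (Hvw0 : (v - w)%C <> 0%C) by (apply Cmod_pos_neq; lra).
      unfold Cdiv. rewrite !Cmod_mult, (Cmod_inv (v ^ n)), (Cmod_inv (v - w)), Cmod_pow, Hvm by assumption.
      assert (0 < r ^ n) by (apply pow_lt; lra). assert (0 < / r ^ n) by (apply Rinv_0_lt_compat; lra).
      apply Rmult_le_compat.
      - apply Rmult_le_pos; [apply Cmod_ge_0|lra].
      - apply Rmult_le_pos; [lra|]. left; apply Rinv_0_lt_compat; lra.
      - apply Rmult_le_compat_r; [lra|apply HM'].
      - apply Rmult_le_compat_l; [lra|]. apply Rinv_le_contravar; lra. }
    replace (2 * (M * / r ^ n * (r / (r - 1)))) with (/ (2 * PI) * (4 * PI * (M * / r ^ n * (r / (r - 1))))).
    - apply Rmult_le_compat_l; [left; apply Rinv_0_lt_compat; lra|exact B'].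
    - field. repeat split; try lra. apply pow_nonzero; lra. }
  assert (Hexp : forall n k w, Cmod w < r -> rem k w = (peval (pcoefs c k n) w + w ^ n * rem (k + n)%nat w)%C).
  { induction n as [|n IH]; intros k w Hw.
    - simpl. rewrite Nat.add_0_r. ring.
    - rewrite HremS by assumption. simpl. rewrite (IH (S k) w Hw). rewrite Nat.add_succ_r. simpl. ring. }
  assert (Hc0 : c 0%nat = F 0%C).
  { rewrite <- (Hrem0 0%C) by (rewrite Cmod_0; lra). rewrite HremS by (rewrite Cmod_0; lra). ring. }
  (* By the expansion of order 2, F(w) - F(0) - w c(1) is w^2 times a bounded function, so c(1) is a
     derivative at 0. *)
  assert (Hc1 : c 1%nat = l).
  { apply (cderiv_unique F 0%C); [|assumption]. apply cderiv_eps. intros e He.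
    set (K := 2 * (M * / r ^ 2 * (r / (r - 1)))).
    assert (HK : 0 <= K).
    { eapply Rle_trans; [apply Cmod_ge_0|apply (Hrembound 2%nat 0%C)]. rewrite Cmod_0; lra. }
    exists (Rmin 1 (e / (K + 1))). split; [apply Rmin_pos; [lra|apply Rdiv_lt_0_compat; lra]|].
    intros w Hw. assert (W1 := Rlt_le_trans _ _ _ Hw (Rmin_l _ _)). assert (W2 := Rlt_le_trans _ _ _ Hw (Rmin_r _ _)).
    replace (w - 0)%C with w in * by ring.
    assert (Ew := Hrem0 w ltac:(lra)). rewrite (Hexp 2%nat 0%nat w ltac:(lra)) in Ew. simpl in Ew.
    rewrite <- Ew, <- Hc0.
    replace (c 0%nat + w * (c 1%nat + w * 0) + w * (w * 1) * rem 2%nat w - c 0%nat - w * c 1%nat)%C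
      with (w * w * rem 2%nat w)%C by ring.
    rewrite !Cmod_mult. assert (Hb := Hrembound 2%nat w ltac:(lra)). fold K in Hb.
    apply Rlt_div_r in W2; [|lra].
    assert (Hw0 := Cmod_ge_0 w). assert (Hr0 := Cmod_ge_0 (rem 2%nat w)).
    assert (Cmod w * Cmod (rem 2%nat w) <= e) by nra. nra. }
  assert (HN : exists N, 2 * (M * / r ^ N * (r / (r - 1))) <= eps).
  { set (K := 2 * (M * (r / (r - 1)))).
    assert (HK : 0 <= K).
    { unfold K. assert (0 < r / (r - 1)) by (apply Rdiv_lt_0_compat; lra). nra. }
    destruct (pow_lt_1_zero (/ r)) with (y := eps / (K + 1)) as [N HN].
    - rewrite Rabs_pos_eq by (left; apply Rinv_0_lt_compat; lra). rewrite <- Rinv_1. apply Rinv_lt_contravar; lra.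
    - apply Rdiv_lt_0_compat; lra.
    - exists N. specialize (HN N (Nat.le_refl N)). rewrite pow_inv in HN.
      assert (0 < / r ^ N) by (apply Rinv_0_lt_compat, pow_lt; lra).
      rewrite Rabs_pos_eq in HN by lra. apply Rlt_div_r in HN; [|lra].
      replace (2 * (M * / r ^ N * (r / (r - 1)))) with (/ r ^ N * K) by (unfold K; ring). nra. }
  destruct HN as [N HN].
  (* Two terms more than the estimate asks for, so that the coefficients of degree 0 and 1 are
     present even when N = 0. *)
  exists (pcoefs c 0 (S (S N))). split; [exact Hc0|split; [exact Hc1|]].
  intros z Hz. rewrite <- (Hrem0 z) by lra. rewrite (Hexp (S (S N)) 0%nat z) by lra.
  match goal with |- Cmod (?a + ?b - ?a') <= _ => replace (a + b - a')%C with b by ring end.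
  rewrite Cmod_mult, Cmod_pow. simpl Nat.add.
  assert (Hb := Hrembound (S (S N)) z Hz).
  assert (Hpw : Cmod z ^ S (S N) <= 1).
  { rewrite <- (pow1 (S (S N))). apply pow_incr. split; [apply Cmod_ge_0|assumption]. }
  assert (Hpw0 : 0 <= Cmod z ^ S (S N)) by (apply pow_le, Cmod_ge_0).
  assert (Hr0 := Cmod_ge_0 (rem (S (S N)) z)).
  assert (Hmono : / r ^ S (S N) <= / r ^ N).
  { apply Rinv_le_contravar; [apply pow_lt; lra|]. apply Rle_pow; [lra|lia]. }
  assert (0 < r / (r - 1)) by (apply Rdiv_lt_0_compat; lra).
  assert (2 * (M * / r ^ S (S N) * (r / (r - 1))) <= 2 * (M * / r ^ N * (r / (r - 1)))).
  { apply Rmult_le_compat_l; [lra|]. apply Rmult_le_compat_r; [lra|]. apply Rmult_le_compat_l; assumption. }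
  nra.
Qed.

(** * Powers of zero-free polynomials and the upper bound *)

Lemma rpow_pos_eq (x a : R) : 0 < x -> rpow x a = Rpower x a.
Proof. intro H. unfold rpow. destruct (Req_EM_T x 0); [lra|reflexivity]. Qed.

Lemma rpow_0 (a : R) : rpow 0 a = 0.
Proof. unfold rpow. destruct (Req_EM_T 0 0); [reflexivity|contradiction]. Qed.

Lemma Rpower_pos (x a : R) : 0 < Rpower x a.
Proof. apply exp_pos. Qed.

Lemma rpow_pos (x a : R) : 0 < x -> 0 < rpow x a.
Proof. intro H. rewrite rpow_pos_eq by assumption. apply Rpower_pos. Qed.

Lemma rpow_ge0 (x a : R) : 0 <= rpow x a.
Proof. unfold rpow. destruct (Req_EM_T x 0); [lra|left; apply Rpower_pos]. Qed.

Lemma rpow_mult (x y a : R) : 0 <= x -> 0 <= y -> rpow (x * y) a = rpow x a * rpow y a.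
Proof.
  intros [Hx| <-] [Hy| <-]; rewrite ?Rmult_0_l, ?Rmult_0_r, ?rpow_0, ?Rmult_0_l, ?Rmult_0_r; try reflexivity.
  rewrite !rpow_pos_eq by nra. symmetry. apply Rpower_mult_distr; assumption.
Qed.

Lemma rpow_lt (x y a : R) : 0 < a -> 0 <= x -> x < y -> rpow x a < rpow y a.
Proof.
  intros Ha [Hx| <-] Hxy.
  - rewrite !rpow_pos_eq by lra. unfold Rpower. apply exp_increasing, Rmult_lt_compat_l; [assumption|].
    apply ln_increasing; lra.
  - rewrite rpow_0. apply rpow_pos, Hxy.
Qed.

Lemma rpow_le (x y a : R) : 0 < a -> 0 <= x -> x <= y -> rpow x a <= rpow y a.
Proof. intros Ha Hx [H| <-]; [left; apply rpow_lt; assumption|lra]. Qed.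

Lemma rpow_1 (a : R) : rpow 1 a = 1.
Proof. rewrite rpow_pos_eq by lra. unfold Rpower. rewrite ln_1, Rmult_0_r. apply exp_0. Qed.

Lemma rpow_ge_base (x a : R) : 0 <= x <= 1 -> 0 < a <= 1 -> x <= rpow x a.
Proof.
  intros [[Hx| <-] Hx1] Ha; [|rewrite rpow_0; lra].
  rewrite rpow_pos_eq by assumption. unfold Rpower. rewrite <- (exp_ln x) at 1 by assumption.
  assert (Hl : ln x <= 0) by (rewrite <- ln_1; apply ln_le; assumption).
  assert (Hle : ln x <= a * ln x) by nra.
  destruct Hle as [Hle|Hle]; [left; apply exp_increasing, Hle|rewrite <- Hle; lra].
Qed.

(** By homogeneity one may take x + y = 1, and then u <= u^a on [0, 1]. For exponents at most 1 this
    plays the part of the triangle inequality in means. *)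
Lemma rpow_subadd (x y a : R) : 0 < a <= 1 -> 0 <= x -> 0 <= y -> rpow (x + y) a <= rpow x a + rpow y a.
Proof.
  intros Ha Hx Hy.
  destruct (Req_dec (x + y) 0) as [E|E].
  { rewrite E, rpow_0. generalize (rpow_ge0 x a) (rpow_ge0 y a); lra. }
  assert (Hs : 0 < x + y) by lra.
  replace (rpow x a) with (rpow (x + y) a * rpow (x / (x + y)) a).
  2:{ rewrite <- rpow_mult; [f_equal; field; assumption|lra|apply Rdiv_le_0_compat; lra]. }
  replace (rpow y a) with (rpow (x + y) a * rpow (y / (x + y)) a).
  2:{ rewrite <- rpow_mult; [f_equal; field; assumption|lra|apply Rdiv_le_0_compat; lra]. }
  assert (X1 : 0 <= x / (x + y)) by (apply Rdiv_le_0_compat; lra).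
  assert (Y1 : 0 <= y / (x + y)) by (apply Rdiv_le_0_compat; lra).
  assert (XY : x / (x + y) + y / (x + y) = 1) by (field; assumption).
  assert (A := rpow_ge_base (x / (x + y)) a ltac:(lra) Ha).
  assert (B := rpow_ge_base (y / (x + y)) a ltac:(lra) Ha).
  generalize (rpow_ge0 (x + y) a). nra.
Qed.

Lemma rpow_diff (x y a : R) : 0 < a <= 1 -> 0 <= x -> 0 <= y -> Rabs (rpow x a - rpow y a) <= rpow (Rabs (x - y)) a.
Proof.
  intros Ha.
  assert (H : forall u v, 0 <= v -> v <= u -> Rabs (rpow u a - rpow v a) <= rpow (Rabs (u - v)) a).
  { intros u v Hv Huv. rewrite !Rabs_pos_eq by (try apply Rge_le, Rge_minus, Rle_ge, rpow_le; lra).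
    assert (S := rpow_subadd (u - v) v a Ha ltac:(lra) Hv). replace (u - v + v) with u in S by ring. lra. }
  intros Hx Hy. destruct (Rle_lt_dec y x) as [Hl|Hl].
  - apply H; assumption.
  - rewrite Rabs_minus_sym, (Rabs_minus_sym x). apply H; lra.
Qed.

Lemma rpow_inv_l (x a : R) : 0 < a -> 0 <= x -> rpow (rpow x (1 / a)) a = x.
Proof.
  intros Ha [Hx| <-]; [|rewrite rpow_0; apply rpow_0].
  rewrite (rpow_pos_eq _ a) by (apply rpow_pos, Hx). rewrite rpow_pos_eq by assumption.
  rewrite Rpower_mult. replace (1 / a * a) with 1 by (field; lra). apply Rpower_1, Hx.
Qed.

Lemma rpow_small (a eps : R) : 0 < a -> 0 < eps -> exists d, 0 < d /\ forall x, 0 <= x < d -> rpow x a < eps.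
Proof.
  intros Ha He. exists (rpow eps (1 / a)). split; [apply rpow_pos, He|].
  intros x [Hx1 Hx2]. rewrite <- (rpow_inv_l eps a) by lra. apply rpow_lt; assumption.
Qed.

(** * Means of order at most 1 over circles *)

Lemma rpow_circle_continuous (F : C -> C) (r a t : R) : 0 < a <= 1 -> 0 <= r -> circle_ccont F r ->
  continuous (fun s => rpow (Cmod (F (r * cis s)%C)) a) t.
Proof.
  intros Ha Hr HF. apply continuous_of_eps. intros eps Heps.
  destruct (rpow_small a eps) as (e & He & Hsm); [lra|assumption|].
  destruct (ccont_circle F r t Hr (HF t) e He) as (d & Hd & Hb).
  exists d. split; [assumption|]. intros s Hs.
  eapply Rle_lt_trans; [apply rpow_diff; [assumption|apply Cmod_ge_0|apply Cmod_ge_0]|].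
  apply Hsm. split; [apply Rabs_pos|]. eapply Rle_lt_trans; [|apply (Hb s Hs)].
  apply Rabs_le. assert (A := Cmod_triangle_rev (F (r * cis s)%C) (F (r * cis t)%C)).
  assert (B := Cmod_triangle_rev (F (r * cis t)%C) (F (r * cis s)%C)). rewrite Cmod_minus_sym in B. lra.
Qed.

Lemma ex_RInt_rpow_circle (F : C -> C) (r a : R) : 0 < a <= 1 -> 0 <= r -> circle_ccont F r ->
  ex_RInt (fun s => rpow (Cmod (F (r * cis s)%C)) a) 0 (2 * PI).
Proof.
  intros Ha Hr HF. apply (ex_RInt_continuous (V := R_CompleteNormedModule)).
  intros t _. apply rpow_circle_continuous; assumption.
Qed.

(** There are two radii because one use moves [linprod] from the circle of radius r to the unit
    circle, and the other compares a polynomial on the unit circle with f on the circle of radius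
    r. *)
Lemma mean_rpow_close (F G : C -> C) (r1 r2 a e : R) : 0 < a <= 1 -> 0 <= r1 -> 0 <= r2 ->
  circle_ccont F r1 -> circle_ccont G r2 ->
  (forall t, Cmod (F (r1 * cis t)%C - G (r2 * cis t)%C) <= e) ->
  RInt (fun t => rpow (Cmod (F (r1 * cis t)%C)) a) 0 (2 * PI) <=
  RInt (fun t => rpow (Cmod (G (r2 * cis t)%C)) a) 0 (2 * PI) + 2 * PI * rpow e a.
Proof.
  intros Ha Hr1 Hr2 HF HG Hb. assert (HPI := PI_RGT_0).
  assert (EF := ex_RInt_rpow_circle F r1 a Ha Hr1 HF).
  assert (EG := ex_RInt_rpow_circle G r2 a Ha Hr2 HG).
  assert (E1 : ex_RInt (fun _ : R => 1) 0 (2 * PI)) by apply ex_RInt_const.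
  replace (RInt (fun t => rpow (Cmod (G (r2 * cis t)%C)) a) 0 (2 * PI) + 2 * PI * rpow e a) with
    (RInt (fun t => 1 * rpow (Cmod (G (r2 * cis t)%C)) a + rpow e a * 1) 0 (2 * PI)).
  2:{ rewrite RInt_lincomb by assumption. rewrite RInt_const. unfold scal; simpl; unfold mult; simpl. ring. }
  apply RInt_le; [lra|assumption| |].
  - apply (ex_RInt_plus (V := R_NormedModule) (fun t => 1 * rpow (Cmod (G (r2 * cis t)%C)) a) (fun t => rpow e a * 1)).
    + apply (ex_RInt_scal (V := R_NormedModule) _ 0 (2 * PI) 1 EG).
    + apply (ex_RInt_scal (V := R_NormedModule) _ 0 (2 * PI) (rpow e a) E1).
  - intros t _. specialize (Hb t). set (u := F (r1 * cis t)%C) in *. set (v := G (r2 * cis t)%C) in *.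
    assert (T : Cmod u <= Cmod v + Cmod (u - v)) by (generalize (Cmod_triangle_rev u v); lra).
    assert (A := rpow_le _ _ a (proj1 Ha) (Cmod_ge_0 u) T).
    assert (B := rpow_subadd (Cmod v) (Cmod (u - v)) a Ha (Cmod_ge_0 _) (Cmod_ge_0 _)).
    assert (D := rpow_le _ _ a (proj1 Ha) (Cmod_ge_0 (u - v)) Hb). lra.
Qed.

(** The principal logarithm on the right half-plane. This half-plane is enough: 1 - b z has positive
    real part for |b| <= 1 and |z| < 1. *)
Definition clog (w : C) : C := (ln (fst w * fst w + snd w * snd w) / 2, atan (snd w / fst w)).

Lemma cderiv_clog (w : C) : 0 < fst w -> cderiv clog w (/ w)%C.
Proof.
  destruct w as [x y]. simpl. intros Hx.
  assert (Hs : 0 < x * x + y * y) by nra.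
  apply (cderiv_eq _ _ (x / (x * x + y * y), - y / (x * x + y * y))).
  2:{ unfold Cinv; simpl. f_equal; field; lra. }
  apply cderiv_real. simpl. split.
  - assert (Hq : differentiable_pt_lim (fun u v => u * u + v * v) x y (2 * x) (2 * y)).
    { intros eps. assert (He : 0 < eps / 2) by (generalize (cond_pos eps); lra).
      exists (mkposreal _ He). simpl. intros u v Hu Hv.
      replace (u * u + v * v - (x * x + y * y) - (2 * x * (u - x) + 2 * y * (v - y))) with
        ((u - x) * (u - x) + (v - y) * (v - y)) by ring.
      eapply Rle_trans; [apply Rabs_triang|]. rewrite !Rabs_mult.
      assert (M1 := Rmax_l (Rabs (u - x)) (Rabs (v - y))). assert (M2 := Rmax_r (Rabs (u - x)) (Rabs (v - y))).
      assert (P1 := Rabs_pos (u - x)). assert (P2 := Rabs_pos (v - y)).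
      set (m := Rmax _ _) in *. assert (m < eps / 2) by (apply Rmax_lub_lt; assumption). nra. }
    eapply differentiable_pt_lim_eq.
    + apply (differentiable_pt_lim_comp (fun p _ => ln p / 2) (fun u v => u * u + v * v) (fun u v => u * u + v * v)).
      * apply (differentiable_pt_lim_proj1_0 (fun p => ln p / 2) _ _ (/ (2 * (x * x + y * y)))).
        apply is_derive_Reals. auto_derive; [exact Hs|field; lra].
      * exact Hq.
      * exact Hq.
    + simpl. field. lra.
    + simpl. field. lra.
  - eapply differentiable_pt_lim_eq.
    + apply (differentiable_pt_lim_comp (fun p _ => atan p) (fun u v => v / u) (fun u v => v / u)).
      * apply differentiable_pt_lim_proj1_0. apply derivable_pt_lim_atan.
      * apply (differentiable_pt_lim_mult (fun u v => v) (fun u v => / u)).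
        -- apply (differentiable_pt_lim_proj2_0 (fun v => v)), derivable_pt_lim_id.
        -- apply differentiable_pt_lim_proj1_0. apply is_derive_Reals.
           apply (is_derive_inv (fun u => u) x 1); [apply is_derive_Reals, derivable_pt_lim_id|lra].
      * apply (differentiable_pt_lim_mult (fun u v => v) (fun u v => / u)).
        -- apply (differentiable_pt_lim_proj2_0 (fun v => v)), derivable_pt_lim_id.
        -- apply differentiable_pt_lim_proj1_0. apply is_derive_Reals.
           apply (is_derive_inv (fun u => u) x 1); [apply is_derive_Reals, derivable_pt_lim_id|lra].
    + unfold Rsqr. field. repeat split; nra.
    + unfold Rsqr. field. repeat split; nra.
Qed.

Definition cpow (w : C) (a : R) : C := cexp (a * clog w)%C.

Lemma Cmod_cexp (z : C) : Cmod (cexp z) = exp (fst z).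
Proof.
  replace (cexp z) with (exp (fst z) * cis (snd z))%C.
  - apply Cmod_polar. left; apply exp_pos.
  - unfold cexp, cis, Cmult, RtoC; simpl. f_equal; ring.
Qed.

Lemma Cmod_cpow (w : C) (a : R) : 0 < fst w -> Cmod (cpow w a) = Rpower (Cmod w) a.
Proof.
  intros Hw. unfold cpow. rewrite Cmod_cexp. unfold Rpower, Cmult, clog, RtoC; simpl. f_equal.
  assert (Hm : 0 < Cmod w).
  { eapply Rlt_le_trans; [exact Hw|]. eapply Rle_trans; [apply Rle_abs|apply Rabs_fst_le]. }
  replace (fst w * fst w + snd w * snd w) with (Cmod w * Cmod w).
  2:{ replace (Cmod w * Cmod w) with (Cmod w ^ 2) by ring. rewrite Cmod2_alt. unfold Re, Im; ring. }
  rewrite ln_mult by assumption. field.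
Qed.

Lemma cpow_1 (a : R) : cpow 1%C a = 1%C.
Proof.
  unfold cpow, clog, cexp, Cmult, RtoC; simpl.
  replace (1 * 1 + 0 * 0) with 1 by ring. rewrite ln_1. replace (0 / 1) with 0 by field. rewrite atan_0.
  replace (a * (0 / 2) - 0 * 0) with 0 by field. replace (a * 0 + 0 * (0 / 2)) with 0 by field.
  rewrite exp_0, cos_0, sin_0. f_equal; ring.
Qed.

Lemma cderiv_cpow (w : C) (a : R) : 0 < fst w -> cderiv (fun w => cpow w a) w (a * / w * cpow w a)%C.
Proof.
  intros Hw. apply (cderiv_comp cexp (fun w => a * clog w)%C); [apply cderiv_cexp|].
  eapply cderiv_eq.
  - apply cderiv_mult; [apply cderiv_const|apply cderiv_clog, Hw].
  - cbv beta; ring.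
Qed.

Lemma one_minus_re_pos (b z : C) : Cmod b <= 1 -> Cmod z < 1 -> 0 < fst (1 - b * z)%C.
Proof.
  intros Hb Hz.
  assert (H : Cmod (b * z) < 1).
  { rewrite Cmod_mult. assert (A := Cmod_ge_0 b). assert (B := Cmod_ge_0 z). nra. }
  assert (K := Rabs_fst_le (b * z)%C). assert (L := Rle_abs (fst (b * z)%C)).
  change (fst (1 - b * z)%C) with (1 + - fst (b * z)%C). lra.
Qed.

Lemma cderiv_linear_factor (b z : C) : cderiv (fun z => 1 - b * z)%C z (- b)%C.
Proof.
  eapply cderiv_eq.
  - apply cderiv_minus; [apply cderiv_const|]. apply cderiv_mult; [apply cderiv_const|apply cderiv_id].
  - cbv beta; ring.
Qed.

(** The power of [linprod bs], taken factor by factor so that only principal logarithms of the 1 - b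
    z are involved. With exponent p/2 it turns a mean of order p into a mean of order 2. *)
Definition linprod_pow (a : R) (bs : list C) (z : C) : C :=
  fold_right (fun b v => cpow (1 - b * z) a * v)%C 1%C bs.

Lemma linprod_pow_cdiff (a : R) (bs : list C) (z : C) :
  List.Forall (fun b => Cmod b <= 1) bs -> Cmod z < 1 -> cdiff (linprod_pow a bs) z.
Proof.
  intros Hbs Hz. induction Hbs as [|b bs Hb Hbs IH]; [exact (cdiff_const 1%C z)|].
  apply (cdiff_mult (fun z => cpow (1 - b * z) a)); [|exact IH].
  eexists. apply (cderiv_comp (fun w => cpow w a) (fun z => 1 - b * z)%C).
  - apply cderiv_cpow, one_minus_re_pos; assumption.
  - apply cderiv_linear_factor.
Qed.

Lemma linprod_pow_jet (a : R) (bs : list C) : List.Forall (fun b => Cmod b <= 1) bs ->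
  linprod_pow a bs 0%C = 1%C /\ cderiv (linprod_pow a bs) 0%C (- a * csum bs)%C.
Proof.
  intros Hbs. induction Hbs as [|b bs Hb Hbs [IH1 IH2]].
  - split; [reflexivity|]. eapply cderiv_eq; [exact (cderiv_const 1%C 0%C)|]. unfold csum; simpl; ring.
  - assert (E0 : (1 - b * 0)%C = 1%C) by ring. split.
    + unfold linprod_pow; simpl. fold (linprod_pow a bs 0%C). rewrite IH1, E0, cpow_1. ring.
    + eapply cderiv_eq.
      * apply (cderiv_mult (fun z => cpow (1 - b * z) a) (linprod_pow a bs)); [|exact IH2].
        apply (cderiv_comp (fun w => cpow w a) (fun z => 1 - b * z)%C).
        -- apply cderiv_cpow, one_minus_re_pos; [assumption|rewrite Cmod_0; lra].
        -- apply cderiv_linear_factor.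
      * rewrite E0, cpow_1, IH1. unfold csum; simpl. field.
Qed.

Lemma linprod_pow_mod (a : R) (bs : list C) (z : C) :
  List.Forall (fun b => Cmod b <= 1) bs -> Cmod z < 1 ->
  0 < Cmod (linprod bs z) /\ Cmod (linprod_pow a bs z) = Rpower (Cmod (linprod bs z)) a.
Proof.
  intros Hbs Hz. induction Hbs as [|b bs Hb Hbs [IH1 IH2]].
  - unfold linprod, linprod_pow; simpl. rewrite Cmod_1. split; [lra|].
    unfold Rpower. rewrite ln_1, Rmult_0_r, exp_0. reflexivity.
  - assert (Hre := one_minus_re_pos b z Hb Hz).
    assert (Hm : 0 < Cmod (1 - b * z)).
    { eapply Rlt_le_trans; [exact Hre|]. eapply Rle_trans; [apply Rle_abs|apply Rabs_fst_le]. }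
    unfold linprod, linprod_pow; simpl. fold (linprod bs z) (linprod_pow a bs z).
    rewrite !Cmod_mult, IH2, Cmod_cpow by assumption. split; [nra|].
    apply Rpower_mult_distr; assumption.
Qed.

Lemma linprod_lip (bs : list C) : List.Forall (fun b => Cmod b <= 1) bs ->
  exists K M, 0 <= K /\ 0 <= M /\ forall z, Cmod z <= 1 -> Cmod (linprod bs z) <= M /\
    forall w, Cmod w <= 1 -> Cmod (linprod bs z - linprod bs w) <= K * Cmod (z - w).
Proof.
  intros Hbs. induction Hbs as [|b bs Hb Hbs (K & M & HK & HM & IH)].
  - exists 0, 1. split; [lra|split; [lra|]]. intros z _. unfold linprod; simpl. rewrite Cmod_1. split; [lra|].
    intros w _. replace (1 - 1)%C with (RtoC 0) by ring. rewrite Cmod_0. lra.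
  - exists (M + 2 * K), (2 * M). split; [lra|split; [lra|]]. intros z Hz.
    destruct (IH z Hz) as [H1 H2]. unfold linprod; simpl. fold (linprod bs z).
    assert (Hf : forall v, Cmod v <= 1 -> Cmod (1 - b * v) <= 2).
    { intros v Hv. replace (1 - b * v)%C with (1 + - (b * v))%C by ring.
      eapply Rle_trans; [apply Cmod_triangle|]. rewrite Cmod_opp, Cmod_mult, Cmod_1.
      assert (A := Cmod_ge_0 b). assert (B := Cmod_ge_0 v). nra. }
    assert (P0 := Cmod_ge_0 (linprod bs z)). split.
    + rewrite Cmod_mult. assert (A := Hf z Hz). assert (B := Cmod_ge_0 (1 - b * z)). nra.
    + intros w Hw. fold (linprod bs w). specialize (H2 w Hw).
      replace ((1 - b * z) * linprod bs z - (1 - b * w) * linprod bs w)%C with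
        (- b * (z - w) * linprod bs z + (1 - b * w) * (linprod bs z - linprod bs w))%C by ring.
      eapply Rle_trans; [apply Cmod_triangle|]. rewrite !Cmod_mult, Cmod_opp.
      assert (A := Hf w Hw). assert (B := Cmod_ge_0 (1 - b * w)). assert (D := Cmod_ge_0 (z - w)).
      assert (E := Cmod_ge_0 b). assert (G := Cmod_ge_0 (linprod bs z - linprod bs w)).
      assert (Cmod b * Cmod (z - w) * Cmod (linprod bs z) <= M * Cmod (z - w)).
      { assert (Cmod b * Cmod (z - w) <= Cmod (z - w)) by nra. nra. }
      nra.
Qed.

Lemma linprod_cdiff (bs : list C) (z : C) : cdiff (linprod bs) z.
Proof.
  induction bs as [|b bs IH]; [exact (cdiff_const 1%C z)|].
  apply (cdiff_mult (fun z => 1 - b * z)%C); [|exact IH]. eexists; apply cderiv_linear_factor.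
Qed.

(** Bessel's inequality for the power p/2, which has value 1 and derivative -(p/2) [csum bs] at 0.
    It is applied on circles of radius r < 1, because the product may vanish on the unit circle,
    where the power is then not analytic; the Lipschitz bound on [linprod] lets r tend to 1. *)
Lemma linprod_mean (p : R) (bs : list C) : 0 < p <= 1 -> List.Forall (fun b => Cmod b <= 1) bs ->
  2 * PI * (1 + (p / 2 * Cmod (csum bs)) ^ 2) <=
    RInt (fun t => rpow (Cmod (linprod bs (1 * cis t)%C)) p) 0 (2 * PI).
Proof.
  intros Hp Hbs. assert (HPI := PI_RGT_0).
  destruct (linprod_lip bs Hbs) as (K & M & HK & HM & Hlip).
  set (c := (p / 2 * Cmod (csum bs)) ^ 2).
  assert (Hc : 0 <= c) by apply pow2_ge_0.
  set (I := RInt (fun t => rpow (Cmod (linprod bs (1 * cis t)%C)) p) 0 (2 * PI)).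
  destruct (linprod_pow_jet (p / 2) bs Hbs) as [J0 J1].
  assert (Hr : forall r, 0 < r < 1 -> 2 * PI * (1 + r ^ 2 * c) <= I + 2 * PI * rpow (K * (1 - r)) p).
  { intros r Hr.
    assert (B := bessel_two_terms (linprod_pow (p / 2) bs) _ r 1 Hr
       (fun w Hw => linprod_pow_cdiff (p / 2) bs w Hbs Hw) J1).
    rewrite J0, Cmod_1, Cmod_mult, Cmod_opp, Cmod_RtoC_pos in B by lra.
    fold c in B. replace (1 ^ 2 + r ^ 2 * c) with (1 + r ^ 2 * c) in B by ring.
    eapply Rle_trans; [exact B|].
    rewrite (RInt_ext _ (fun t => rpow (Cmod (linprod bs (r * cis t)%C)) p)).
    - apply mean_rpow_close; try lra.
      + intro t. apply cdiff_ccont, linprod_cdiff.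
      + intro t. apply cdiff_ccont, linprod_cdiff.
      + intro t. assert (H1 : Cmod (r * cis t) <= 1) by (rewrite Cmod_polar; lra).
        assert (H2 : Cmod (1 * cis t) <= 1) by (rewrite Cmod_mult, Cmod_cis, Cmod_1; lra).
        eapply Rle_trans; [apply Hlip; assumption|]. right. f_equal.
        replace (r * cis t - 1 * cis t)%C with (- ((1 - r) * cis t))%C by ring.
        rewrite Cmod_opp, <- RtoC_minus. apply Cmod_polar; lra.
    - intros t _. destruct (linprod_pow_mod (p / 2) bs (r * cis t)%C Hbs) as [Q1 Q2].
      { rewrite Cmod_polar; lra. }
      rewrite Q2. rewrite rpow_pos_eq by assumption.
      simpl. rewrite Rmult_1_r, <- Rpower_plus. f_equal. field. }
  apply Rnot_lt_le. intros Hlt.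
  (* Half of the supposed deficit, measured in units of 2 pi. The choice of [u = 1 - r] below keeps
     each of the two errors, from r^2 and from the change of radius, within [d]. *)
  set (d := (2 * PI * (1 + c) - I) / (4 * PI)).
  assert (Hd : 0 < d) by (apply Rdiv_lt_0_compat; lra).
  destruct (rpow_small p d) as (e & He & Hsm); [lra|assumption|].
  set (u := Rmin (1 / 2) (Rmin (e / (2 * (K + 1))) (d / (2 * (c + 1))))).
  assert (Hu0 : 0 < u).
  { repeat apply Rmin_pos; try lra; apply Rdiv_lt_0_compat; lra. }
  assert (U1 : u <= 1 / 2) by apply Rmin_l.
  assert (U2 : u <= e / (2 * (K + 1))) by (eapply Rle_trans; [apply Rmin_r|apply Rmin_l]).
  assert (U3 : u <= d / (2 * (c + 1))) by (eapply Rle_trans; [apply Rmin_r|apply Rmin_r]).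
  apply Rle_div_r in U2; [|lra]. apply Rle_div_r in U3; [|lra].
  specialize (Hr (1 - u) ltac:(lra)). replace (K * (1 - (1 - u))) with (K * u) in Hr by ring.
  assert (Hsm' := Hsm (K * u) ltac:(nra)).
  assert (E : 2 * PI * (1 + c) - I = 4 * PI * d) by (unfold d; field; lra).
  assert (F : c - (1 - u) ^ 2 * c <= d) by nra.
  assert (2 * PI * (1 + (1 - u) ^ 2 * c) >= 2 * PI * (1 + c) - 2 * PI * d) by nra.
  assert (2 * PI * rpow (K * u) p < 2 * PI * d) by nra. lra.
Qed.

(** [A] is |F(0)| = |k|, [be] is |B0|, and [x] is |g'(0)/g(0)| for g = F^(p/2), that is (p/2) |csum
    bs|; the factor 2/p of the conclusion undoes this p/2. *)
Lemma poly_upper (p kap s : R) (P : list C) : 0 < p <= 1 -> 0 <= s -> 0 <= kap ->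
  nth 0 P 0%C = RtoC s ->
  RInt (fun t => rpow (Cmod (peval P (1 * cis t)%C)) p) 0 (2 * PI) <= 2 * PI * kap ->
  exists A x be, 0 <= A /\ 0 <= x /\ 0 <= be <= 1 /\ rpow A p * (1 + x ^ 2) <= kap /\ s = be * A /\
    fst (nth 1 P 0%C) <= A * (1 - be ^ 2) + 2 / p * be * A * x.
Proof.
  intros Hp Hs Hkap H0 HI. assert (HPI := PI_RGT_0).
  destruct (poly_trim P) as [[HP _]|(l & Hn & Hl & Hk & HP)].
  - exists 0, 0, 0. rewrite rpow_0. rewrite HP in H0. injection H0 as <-. rewrite HP. simpl. repeat split; lra.
  - destruct l as [|c l]; [contradiction|].
    destruct (poly_blaschke (length l) (c :: l) eq_refl Hl) as (k & B0 & B1 & bs & Hk0 & Hbs & HB0 & HB1 & E0 & E1 & Hm).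
    rewrite Hk in E0, E1. rewrite H0 in E0.
    assert (HB00 := Cmod_ge_0 B0). assert (HB10 := Cmod_ge_0 B1). assert (Hk00 := Cmod_ge_0 k).
    assert (Hc0 := Cmod_ge_0 (csum bs)).
    exists (Cmod k), (p / 2 * Cmod (csum bs)), (Cmod B0).
    split; [assumption|split; [|split; [lra|split; [|split]]]].
    + apply Rmult_le_pos; lra.
    + assert (B := linprod_mean p bs Hp Hbs).
      rewrite (RInt_ext _ (fun t => rpow (Cmod k) p * rpow (Cmod (linprod bs (1 * cis t)%C)) p + 0 * 0)) in HI.
      2:{ intros t _. rewrite <- HP, Hm by (rewrite Cmod_mult, Cmod_cis, Cmod_1; ring).
          rewrite rpow_mult by apply Cmod_ge_0.
          match goal with |- @eq _ ?x ?y => change (@eq R x y) end. ring. }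
      rewrite (RInt_lincomb _ (fun _ => 0)) in HI.
      * assert (rpow (Cmod k) p * (2 * PI * (1 + (p / 2 * Cmod (csum bs)) ^ 2)) <= 2 * PI * kap).
        { assert (Q := rpow_ge0 (Cmod k) p).
          assert (rpow (Cmod k) p * (2 * PI * (1 + (p / 2 * Cmod (csum bs)) ^ 2)) <=
             rpow (Cmod k) p * RInt (fun t => rpow (Cmod (linprod bs (1 * cis t)%C)) p) 0 (2 * PI)).
          { apply Rmult_le_compat_l; assumption. }
          lra. }
        apply Rmult_le_reg_l with (2 * PI); lra.
      * apply ex_RInt_rpow_circle; [assumption|lra|]. intro t. apply cdiff_ccont, linprod_cdiff.
      * apply ex_RInt_const.
    + rewrite <- (Cmod_RtoC_pos s) by assumption. rewrite E0, Cmod_mult. reflexivity.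
    + rewrite E1. eapply Rle_trans; [apply Rle_abs|]. eapply Rle_trans; [apply Rabs_fst_le|].
      replace (B1 * k - B0 * k * csum bs)%C with (B1 * k + - (B0 * k * csum bs))%C by ring.
      eapply Rle_trans; [apply Cmod_triangle|]. rewrite Cmod_opp, !Cmod_mult.
      replace (2 / p * Cmod B0 * Cmod k * (p / 2 * Cmod (csum bs))) with (Cmod B0 * Cmod k * Cmod (csum bs)) by (field; lra).
      nra.
Qed.

Lemma circle_mean_polar (p : R) (f : C -> C) (r : R) :
  circle_mean p f r = RInt (fun t => rpow (Cmod (f (r * cis t)%C)) p) 0 (2 * PI) / (2 * PI).
Proof.
  unfold circle_mean. f_equal. apply RInt_ext. intros t _. do 3 f_equal.
  unfold cis, Cmult, RtoC; simpl. f_equal; ring.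
Qed.

(** One radius r near 1 is fixed at which the mean is below 1 + eta/2. The function z -> f(rz) is
    analytic past the unit circle, so a polynomial with the same value and derivative at 0 can
    replace it, at the cost of another eta/2 in the mean. The factor r in the last line is the chain
    rule. *)
Lemma Hp_upper (p N s eta : R) (f : C -> C) : 0 < p <= 1 -> 0 <= s -> 0 < eta < 1 ->
  analytic_on_disc f -> is_Hp_norm p f N -> N <= 1 -> f 0%C = RtoC s ->
  exists r A x be, 1 - eta < r < 1 /\ 0 <= A /\ 0 <= x /\ 0 <= be <= 1 /\
    rpow A p * (1 + x ^ 2) <= 1 + eta /\ s = be * A /\
    r * Re (C_derive f 0%C) <= A * (1 - be ^ 2) + 2 / p * be * A * x.
Proof.
  intros Hp Hs Heta Han [HN0 HN] HN1 H0. assert (HPI := PI_RGT_0).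
  assert (HNp : rpow N p <= 1) by (rewrite <- (rpow_1 p); apply rpow_le; lra).
  assert (He2 : 0 < eta / 2) by lra.
  destruct (HN (ball (rpow N p) (mkposreal _ He2)) (locally_ball _ _)) as [d Hd].
  set (r := 1 - Rmin (d / 2) (eta / 2)).
  assert (Hdp := cond_pos d).
  assert (Hmin : 0 < Rmin (d / 2) (eta / 2)) by (apply Rmin_pos; lra).
  assert (M1 := Rmin_l (d / 2) (eta / 2)). assert (M2 := Rmin_r (d / 2) (eta / 2)).
  assert (Hr : 1 - eta < r < 1) by (unfold r; lra).
  assert (Hmean : circle_mean p f r < 1 + eta / 2).
  { assert (Q : ball (rpow N p) (eta / 2) (circle_mean p f r)).
    { apply Hd; [|lra]. unfold ball; simpl; unfold AbsRing_ball, abs, minus, plus, opp; simpl.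
      apply Rabs_lt_between. unfold r; lra. }
    unfold ball in Q; simpl in Q; unfold AbsRing_ball, abs, minus, plus, opp in Q; simpl in Q.
    apply Rabs_lt_between in Q. lra. }
  rewrite circle_mean_polar in Hmean. apply Rlt_div_l in Hmean; [|lra].
  set (u := fun z => f (r * z)%C).
  assert (Hu : forall w, Cmod w < / r -> cdiff u w).
  { intros w Hw. apply (cdiff_comp f (fun z => r * z)%C).
    - apply Han. rewrite Cmod_mult, Cmod_RtoC_pos by lra.
      apply Rmult_lt_compat_l with (r := r) in Hw; [|lra]. rewrite Rinv_r in Hw; lra.
    - apply cdiff_mult; [apply cdiff_const|apply cdiff_id]. }
  set (l := C_derive f 0%C).
  assert (Hl : cderiv f 0%C l).
  { apply C_derive_correct; [exact 0%C|]. apply Han. rewrite Cmod_0; lra. }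
  assert (Hul : cderiv u 0%C (r * l)%C).
  { eapply cderiv_eq.
    - apply (cderiv_comp f (fun z => r * z)%C).
      + replace (r * 0)%C with (RtoC 0) by ring. exact Hl.
      + apply cderiv_mult; [apply cderiv_const|apply cderiv_id].
    - cbv beta; ring. }
  assert (Hir : 1 < / r) by (rewrite <- Rinv_1; apply Rinv_lt_contravar; lra).
  destruct (rpow_small p (eta / 2)) as (e & He & Hsm); [lra|assumption|].
  destruct (poly_approx u (r * l)%C (/ r) (e / 2) Hir Hu Hul ltac:(lra)) as (P & P0 & P1 & HP).
  assert (Hus : u 0%C = RtoC s) by (unfold u; replace (r * 0)%C with (RtoC 0) by ring; exact H0).
  destruct (poly_upper p (1 + eta) s P Hp Hs) as (A & x & be & HA & Hx & Hbe & Hk & Es & HB).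
  - lra.
  - rewrite P0. exact Hus.
  - assert (Hcl : RInt (fun t => rpow (Cmod (peval P (1 * cis t)%C)) p) 0 (2 * PI) <=
      RInt (fun t => rpow (Cmod (f (r * cis t)%C)) p) 0 (2 * PI) + 2 * PI * rpow (e / 2) p).
    { apply mean_rpow_close; try lra.
      - intro t. apply cdiff_ccont, cdiff_peval.
      - intro t. apply cdiff_ccont, Han. rewrite Cmod_polar; lra.
      - intro t. rewrite Cmod_minus_sym. replace (r * cis t)%C with (r * (1 * cis t))%C by ring.
        apply HP. rewrite Cmod_mult, Cmod_cis, Cmod_1; lra. }
    assert (S := Hsm (e / 2) ltac:(lra)). nra.
  - exists r, A, x, be. repeat split; try assumption; try lra.
    rewrite P1 in HB. unfold Re. fold l. replace (r * fst l) with (fst (r * l)%C); [exact HB|].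
    unfold Cmult, RtoC; simpl; ring.
Qed.

(** * The function G *)

(** For 0 <= x <= 1, the amplitude A that gives A (1 + x z)^(2/p) norm 1: A^p (1 + x^2) = 1. *)
Definition amp (p x : R) : R := Rpower (1 + x ^ 2) (- (1 / p)).
Definition tau (p x : R) : R := x * amp p x.
Definition Gval (p x s : R) : R := amp p x - s ^ 2 / amp p x + 2 / p * s * x.
(** The values of G that come from actual functions: [s <= amp p x] says that the value s/A of the
    Moebius factor at 0 is at most 1, and [x <= 1] that 1 + x z has no zero in the disc. *)
Definition Val (p s y : R) : Prop := exists x, 0 <= x <= 1 /\ s <= amp p x /\ y = Gval p x s.

Lemma mono_of_deriv (f f' : R -> R) (a b : R) : a <= b ->
  (forall x, a <= x <= b -> is_derive f x (f' x)) -> (forall x, a < x < b -> 0 <= f' x) -> f a <= f b.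
Proof.
  intros [Hab| ->] Hd Hp; [|lra].
  destruct (MVT_cor2 f f' a b Hab) as (c & Hc & Hc2).
  - intros c Hc. apply is_derive_Reals, Hd, Hc.
  - specialize (Hp c Hc2). nra.
Qed.

Lemma strict_mono_of_deriv (f f' : R -> R) (a b : R) : a < b ->
  (forall x, a <= x <= b -> is_derive f x (f' x)) -> (forall x, a < x < b -> 0 < f' x) -> f a < f b.
Proof.
  intros Hab Hd Hp. destruct (MVT_cor2 f f' a b Hab) as (c & Hc & Hc2).
  - intros c Hc. apply is_derive_Reals, Hd, Hc.
  - specialize (Hp c Hc2). nra.
Qed.

Lemma anti_of_deriv (f f' : R -> R) (a b : R) : a <= b ->
  (forall x, a <= x <= b -> is_derive f x (f' x)) -> (forall x, a < x < b -> f' x <= 0) -> f b <= f a.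
Proof.
  intros Hab Hd Hp. enough (- f a <= - f b) by lra.
  apply (mono_of_deriv (fun x => - f x) (fun x => - f' x)); [assumption| |].
  - intros x Hx. apply (is_derive_opp f), Hd, Hx.
  - intros x Hx. specialize (Hp x Hx). lra.
Qed.

Lemma amp_pos (p x : R) : 0 < amp p x.
Proof. apply Rpower_pos. Qed.

Lemma is_derive_amp (p x : R) : 0 < p -> is_derive (amp p) x (- (2 / p) * x * amp p x / (1 + x ^ 2)).
Proof.
  intros Hp. unfold amp, Rpower. simpl. auto_derive; [nra|]. field. split; apply Rgt_not_eq; nra.
Qed.

Lemma amp_lt (p x y : R) : 0 < p -> 0 <= x < y -> amp p y < amp p x.
Proof.
  intros Hp Hxy. unfold amp, Rpower. apply exp_increasing.
  assert (0 < 1 / p) by (apply Rdiv_lt_0_compat; lra).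
  assert (ln (1 + x ^ 2) < ln (1 + y ^ 2)) by (apply ln_increasing; nra). nra.
Qed.

Lemma amp_le (p x y : R) : 0 < p -> 0 <= x <= y -> amp p y <= amp p x.
Proof. intros Hp [Hx [H| ->]]; [left; apply amp_lt; lra|lra]. Qed.

Lemma amp_0 (p : R) : amp p 0 = 1.
Proof.
  unfold amp, Rpower. replace (1 + 0 ^ 2) with 1 by ring. rewrite ln_1, Rmult_0_r. apply exp_0.
Qed.

Lemma amp_rpow (p x : R) : 0 < p -> rpow (amp p x) p * (1 + x ^ 2) = 1.
Proof.
  intros Hp. rewrite rpow_pos_eq by apply amp_pos. unfold amp. rewrite Rpower_mult.
  replace (- (1 / p) * p) with (Ropp 1) by (field; lra).
  rewrite Rpower_Ropp, Rpower_1 by nra. field. nra.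
Qed.

(** The inverse of A in closed form, from which [Phi1_endpoint] draws continuity in t. *)
Lemma amp_surj (p t : R) : 0 < p -> 0 < t <= 1 ->
  amp p (sqrt (Rpower t (- p) - 1)) = t.
Proof.
  intros Hp Ht.
  assert (H1 : 1 <= Rpower t (- p)).
  { unfold Rpower. rewrite <- exp_0. assert (ln t <= 0) by (rewrite <- ln_1; apply ln_le; lra).
    assert (Hle : 0 <= - p * ln t) by nra. destruct Hle as [Hle| <-]; [left; apply exp_increasing, Hle|lra]. }
  unfold amp. rewrite pow2_sqrt by lra. replace (1 + (Rpower t (- p) - 1)) with (Rpower t (- p)) by ring.
  rewrite Rpower_mult. replace (- p * - (1 / p)) with 1 by (field; lra). apply Rpower_1; lra.
Qed.

Lemma amp_surj_ex (p t : R) : 0 < p -> 0 < t <= 1 -> exists x, 0 <= x /\ amp p x = t.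
Proof. intros Hp Ht. exists (sqrt (Rpower t (- p) - 1)). split; [apply sqrt_pos|apply amp_surj; assumption]. Qed.

Lemma amp_le_inv (p x y : R) : 0 < p -> 0 <= x -> 0 <= y -> amp p x <= amp p y -> y <= x.
Proof.
  intros Hp Hx Hy H. destruct (Rle_lt_dec y x) as [|Hlt]; [assumption|].
  assert (A := amp_lt p x y Hp ltac:(lra)). lra.
Qed.

Lemma is_derive_tau (p x : R) : 0 < p ->
  is_derive (tau p) x (amp p x / (1 + x ^ 2) * (1 - (2 / p - 1) * x ^ 2)).
Proof.
  intros Hp. assert (Hx : 1 + x ^ 2 <> 0) by (apply Rgt_not_eq; nra).
  replace (amp p x / (1 + x ^ 2) * (1 - (2 / p - 1) * x ^ 2)) with
    (1 * amp p x + x * (- (2 / p) * x * amp p x / (1 + x ^ 2))) by (field; split; lra).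
  apply (is_derive_mult (K := R_AbsRing) (fun x => x) (amp p)).
  - apply (is_derive_id (K := R_AbsRing)).
  - apply is_derive_amp, Hp.
  - exact Rmult_comm.
Qed.

Lemma is_derive_Gval (p s x : R) : 0 < p ->
  is_derive (fun x => Gval p x s) x
    (2 / p / ((1 + x ^ 2) * amp p x) * ((s - tau p x) * (amp p x - x * s))).
Proof.
  intros Hp. assert (Hx : 1 + x ^ 2 <> 0) by (apply Rgt_not_eq; nra). assert (Ha := amp_pos p x).
  unfold Gval, tau.
  evar_last.
  - apply (is_derive_plus (K := R_AbsRing) (V := R_NormedModule)).
    + apply (is_derive_minus (K := R_AbsRing) (V := R_NormedModule)); [apply is_derive_amp, Hp|].
      apply (is_derive_scal (fun x => / amp p x) x (s ^ 2)).
      apply is_derive_inv; [apply is_derive_amp, Hp|lra].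
    + apply (is_derive_scal (fun x => x) x (2 / p * s)). apply (is_derive_id (K := R_AbsRing)).
  - unfold plus, minus, opp, one; simpl. unfold plus; simpl. field. repeat split; lra.
Qed.

(** The positive zero of 1 - (2/p - 1) x^2, the factor of the derivative of [tau] that changes sign;
    it lies below 1 because p < 1. *)
Definition alpha0 (p : R) : R := sqrt (p / (2 - p)).

Lemma alpha0_sq (p : R) : 0 < p < 1 -> 0 < alpha0 p < 1 /\ (2 / p - 1) * alpha0 p ^ 2 = 1.
Proof.
  intros Hp. unfold alpha0.
  assert (H : 0 < p / (2 - p)) by (apply Rdiv_lt_0_compat; lra).
  assert (H1 : p / (2 - p) < 1) by (apply Rlt_div_l; lra).
  rewrite pow2_sqrt by lra. split; [split|field; lra].
  - apply sqrt_lt_R0, H.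
  - rewrite <- sqrt_1. apply sqrt_lt_1_alt. lra.
Qed.

Lemma two_div_p (p : R) : 0 < p < 1 -> 1 < 2 / p - 1.
Proof. intros Hp. assert (2 < 2 / p) by (apply Rlt_div_r; lra). lra. Qed.

Lemma tau_lt_left (p x y : R) : 0 < p < 1 -> 0 <= x -> x < y -> y <= alpha0 p -> tau p x < tau p y.
Proof.
  intros Hp Hx Hxy Hy. destruct (alpha0_sq p Hp) as [Ha Ha2]. assert (H2 := two_div_p p Hp).
  apply (strict_mono_of_deriv _ (fun x => amp p x / (1 + x ^ 2) * (1 - (2 / p - 1) * x ^ 2))); [assumption| |].
  - intros z _. apply is_derive_tau; lra.
  - intros z Hz. apply Rmult_lt_0_compat; [apply Rdiv_lt_0_compat; [apply amp_pos|nra]|].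
    assert (z ^ 2 < alpha0 p ^ 2) by nra. nra.
Qed.

Lemma tau_anti_right (p x y : R) : 0 < p < 1 -> alpha0 p <= x -> x <= y -> tau p y <= tau p x.
Proof.
  intros Hp Hx Hxy. destruct (alpha0_sq p Hp) as [Ha Ha2]. assert (H2 := two_div_p p Hp).
  apply (anti_of_deriv _ (fun x => amp p x / (1 + x ^ 2) * (1 - (2 / p - 1) * x ^ 2))); [assumption| |].
  - intros z _. apply is_derive_tau; lra.
  - intros z Hz. assert (0 < amp p z / (1 + z ^ 2)) by (apply Rdiv_lt_0_compat; [apply amp_pos|nra]).
    assert (alpha0 p ^ 2 <= z ^ 2) by nra.
    assert ((2 / p - 1) * alpha0 p ^ 2 <= (2 / p - 1) * z ^ 2) by (apply Rmult_le_compat_l; lra). nra.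
Qed.

Lemma tau_lt_right (p x y : R) : 0 < p < 1 -> alpha0 p <= x -> x < y -> tau p y < tau p x.
Proof.
  intros Hp Hx Hxy. destruct (alpha0_sq p Hp) as [Ha Ha2]. assert (H2 := two_div_p p Hp).
  enough (- tau p x < - tau p y) by lra.
  apply (strict_mono_of_deriv (fun x => - tau p x) (fun x => - (amp p x / (1 + x ^ 2) * (1 - (2 / p - 1) * x ^ 2)))); [assumption| |].
  - intros z _. apply (is_derive_opp (tau p)), is_derive_tau; lra.
  - intros z Hz. assert (0 < amp p z / (1 + z ^ 2)) by (apply Rdiv_lt_0_compat; [apply amp_pos|nra]).
    assert (alpha0 p ^ 2 < z ^ 2) by nra.
    assert ((2 / p - 1) * alpha0 p ^ 2 < (2 / p - 1) * z ^ 2) by (apply Rmult_lt_compat_l; lra). nra.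
Qed.

Lemma tau_max (p x : R) : 0 < p < 1 -> 0 <= x -> tau p x <= tau p (alpha0 p).
Proof.
  intros Hp Hx. destruct (Rle_lt_dec (alpha0 p) x) as [H|H].
  - apply tau_anti_right; lra.
  - left. apply tau_lt_left; lra.
Qed.

Lemma tau_surj (p t : R) : 0 < p < 1 -> 0 <= t <= tau p (alpha0 p) ->
  exists a, 0 <= a <= alpha0 p /\ tau p a = t.
Proof.
  intros Hp Ht. destruct (alpha0_sq p Hp) as [Ha _].
  destruct (IVT_gen (tau p) 0 (alpha0 p) t) as (a & Ha1 & Ha2).
  - intro x. apply continuity_pt_filterlim. apply (ex_derive_continuous (V := R_NormedModule)).
    eexists. apply is_derive_tau; lra.
  - assert (E0 : tau p 0 = 0) by (unfold tau; ring). rewrite E0. rewrite Rmin_left, Rmax_right by lra. exact Ht.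
  - rewrite Rmin_left, Rmax_right in Ha1 by lra. exists a. split; assumption.
Qed.

(** * Maximum of G over the admissible x *)

Lemma Gval_incr (p s a b : R) : 0 < p -> a <= b ->
  (forall x, a < x < b -> 0 <= (s - tau p x) * (amp p x - x * s)) -> Gval p a s <= Gval p b s.
Proof.
  intros Hp Hab H.
  apply (mono_of_deriv (fun x => Gval p x s)
    (fun x => 2 / p / ((1 + x ^ 2) * amp p x) * ((s - tau p x) * (amp p x - x * s)))); [assumption| |].
  - intros x _. apply is_derive_Gval, Hp.
  - intros x Hx. apply Rmult_le_pos; [|apply H, Hx].
    assert (Hamp := amp_pos p x). left. apply Rdiv_lt_0_compat; [apply Rdiv_lt_0_compat; lra|nra].
Qed.

Lemma Gval_decr (p s a b : R) : 0 < p -> a <= b ->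
  (forall x, a < x < b -> (s - tau p x) * (amp p x - x * s) <= 0) -> Gval p b s <= Gval p a s.
Proof.
  intros Hp Hab H.
  apply (anti_of_deriv (fun x => Gval p x s)
    (fun x => 2 / p / ((1 + x ^ 2) * amp p x) * ((s - tau p x) * (amp p x - x * s)))); [assumption| |].
  - intros x _. apply is_derive_Gval, Hp.
  - intros x Hx. specialize (H x Hx).
    assert (Hamp := amp_pos p x).
    assert (0 < 2 / p / ((1 + x ^ 2) * amp p x)) by (apply Rdiv_lt_0_compat; [apply Rdiv_lt_0_compat; lra|nra]).
    nra.
Qed.

(** At the end s = A(x) of the admissible range the Moebius factor is constant, and only the
    derivative of A (1 + x z)^(2/p) remains. *)
Lemma Gval_endpoint (p x : R) : Gval p x (amp p x) = 2 / p * tau p x.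
Proof. unfold Gval, tau. assert (H := amp_pos p x). replace (amp p x ^ 2 / amp p x) with (amp p x) by (field; lra). ring. Qed.

Lemma Val_endpoint (p x : R) : 0 <= x <= 1 -> Val p (amp p x) (2 / p * tau p x).
Proof. intros Hx. exists x. split; [assumption|split; [lra|]]. symmetry; apply Gval_endpoint. Qed.

Lemma amp_minus_pos (p s x : R) : 0 <= s -> x <= 1 -> s <= amp p x -> 0 <= amp p x - x * s.
Proof. intros. nra. Qed.

Lemma Gval_le_endpoint (p x X : R) : 0 < p < 1 -> 0 <= x <= X -> X <= 1 ->
  (forall z, x <= z <= X -> tau p z <= amp p X) -> Gval p x (amp p X) <= 2 / p * tau p X.
Proof.
  intros Hp Hx HX Ht. rewrite <- Gval_endpoint. assert (HaX := amp_pos p X).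
  apply Gval_incr; [lra|lra|]. intros z Hz.
  apply Rmult_le_pos.
  - specialize (Ht z ltac:(lra)). lra.
  - apply amp_minus_pos; [lra|lra|]. apply amp_le; lra.
Qed.

(** The value of G at its critical point x = a, where s = a A(a). *)
Definition psi (p a : R) : R := amp p a * (1 + (2 / p - 1) * a ^ 2).

Lemma Gval_critical (p a : R) : Gval p a (tau p a) = psi p a.
Proof. unfold Gval, tau, psi. assert (H := amp_pos p a). replace ((a * amp p a) ^ 2 / amp p a) with (a ^ 2 * amp p a) by (field; lra). ring. Qed.

(** The derivative of [psi] is 2 (1/p - 1) x times that of [tau], and 1/p > 1, so [psi] increases
    together with [tau]. *)
Lemma psi_lt (p a b : R) : 0 < p < 1 -> 0 <= a -> a < b -> b <= alpha0 p -> psi p a < psi p b.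
Proof.
  intros Hp Ha Hab Hb. destruct (alpha0_sq p Hp) as [Ha0 Ha2]. assert (H2 := two_div_p p Hp).
  apply (strict_mono_of_deriv _ (fun x => 2 * (1 / p - 1) * x * (amp p x / (1 + x ^ 2) * (1 - (2 / p - 1) * x ^ 2)))); [assumption| |].
  - intros z _. unfold psi. assert (Hz : 1 + z ^ 2 <> 0) by (apply Rgt_not_eq; nra).
    evar_last.
    + apply (is_derive_mult (K := R_AbsRing) (amp p) (fun a => 1 + (2 / p - 1) * a ^ 2)).
      * apply is_derive_amp; lra.
      * apply (is_derive_plus (K := R_AbsRing) (V := R_NormedModule)); [apply is_derive_const|].
        apply (is_derive_scal (fun a => a ^ 2)). apply (is_derive_pow (fun a => a)). apply (is_derive_id (K := R_AbsRing)).
      * exact Rmult_comm.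
    + unfold plus, mult, zero, one; simpl. field. split; apply Rgt_not_eq; nra.
  - intros z Hz. assert (1 < 1 / p) by (apply Rlt_div_r; lra).
    assert (0 < amp p z / (1 + z ^ 2)) by (apply Rdiv_lt_0_compat; [apply amp_pos|nra]).
    assert (z ^ 2 < alpha0 p ^ 2) by nra.
    apply Rmult_lt_0_compat; [apply Rmult_lt_0_compat; lra|]. apply Rmult_lt_0_compat; [assumption|nra].
Qed.

Lemma psi_le (p a b : R) : 0 < p < 1 -> 0 <= a -> a <= b -> b <= alpha0 p -> psi p a <= psi p b.
Proof. intros Hp Ha [H| ->] Hb; [left; apply psi_lt; assumption|lra]. Qed.

Lemma Val_critical (p a : R) : 0 < p < 1 -> 0 <= a <= alpha0 p -> Val p (tau p a) (psi p a).
Proof.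
  intros Hp Ha. destruct (alpha0_sq p Hp) as [Ha0 _]. exists a. split; [lra|split; [|symmetry; apply Gval_critical]].
  unfold tau. assert (H := amp_pos p a). nra.
Qed.

(** Since [tau] rises up to [alpha0] and then falls, for s = tau(a) the function G rises up to a,
    falls as long as tau exceeds s, and rises again to the end A(X) = s. A value of G is thus
    bounded by the critical value or by the one at the end. *)
Lemma Val_below (p s a x : R) : 0 < p < 1 -> 0 <= a <= alpha0 p -> tau p a = s -> 0 <= x <= 1 -> s <= amp p x ->
  Gval p x s <= psi p a \/ exists X, x <= X <= 1 /\ amp p X = s /\ Gval p x s <= 2 / p * tau p X.
Proof.
  intros Hp Ha Es Hx Hs. destruct (alpha0_sq p Hp) as [Ha0 _].
  assert (Hs0 : 0 <= s) by (rewrite <- Es; unfold tau; generalize (amp_pos p a); nra).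
  assert (Hpos : forall z, 0 <= z <= x -> 0 <= amp p z - z * s).
  { intros z Hz. apply amp_minus_pos; [assumption|lra|]. apply Rle_trans with (1 := Hs). apply amp_le; lra. }
  assert (Hmid : forall z, a < z <= alpha0 p -> s <= tau p z).
  { intros z Hz. rewrite <- Es. left. apply tau_lt_left; lra. }
  destruct (Rle_lt_dec x a) as [Hxa|Hxa].
  { left. rewrite <- Gval_critical, Es. apply Gval_incr; [lra|lra|]. intros z Hz. apply Rmult_le_pos.
    - rewrite <- Es. assert (tau p z < tau p a) by (apply tau_lt_left; lra). lra.
    - apply amp_minus_pos; [assumption|lra|]. apply Rle_trans with (amp p a).
      + rewrite <- Es. unfold tau. generalize (amp_pos p a); nra.
      + apply amp_le; lra. }
  assert (Hdec : (forall z, a < z < x -> s <= tau p z) -> Gval p x s <= psi p a).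
  { intros Hz. rewrite <- Gval_critical, Es. apply Gval_decr; [lra|lra|]. intros z Hz'.
    specialize (Hz z Hz'). assert (Hpz := Hpos z ltac:(lra)). nra. }
  destruct (Rle_lt_dec x (alpha0 p)) as [Hxa0|Hxa0].
  { left. apply Hdec. intros z Hz. apply Hmid. lra. }
  destruct (Rle_lt_dec s (tau p x)) as [Hst|Hst].
  { left. apply Hdec. intros z Hz. destruct (Rle_lt_dec z (alpha0 p)) as [H|H]; [apply Hmid; lra|].
    apply Rle_trans with (1 := Hst). apply tau_anti_right; lra. }
  right.
  (* As tau(1) = A(1), this puts the end X of the range, where A(X) = s, at most at 1. *)
  assert (Hs1 : tau p 1 < s).
  { apply Rle_lt_trans with (2 := Hst). apply tau_anti_right; lra. }
  assert (Et1 : tau p 1 = amp p 1) by (unfold tau; ring).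
  assert (Hs1' : s <= 1) by (apply Rle_trans with (1 := Hs); rewrite <- (amp_0 p); apply amp_le; lra).
  assert (Hamp1 := amp_pos p 1).
  destruct (amp_surj_ex p s ltac:(lra) ltac:(lra)) as (X & HX0 & EX).
  exists X. assert (HX1 : X <= 1) by (apply (amp_le_inv p); lra).
  assert (HxX : x <= X) by (apply (amp_le_inv p); lra).
  split; [lra|split; [assumption|]]. rewrite <- EX. apply Gval_le_endpoint; [assumption|lra|lra|].
  intros z Hz. rewrite EX. left. apply Rle_lt_trans with (2 := Hst). apply tau_anti_right; lra.
Qed.

(** Here s - x A(x) is nowhere negative, so G increases up to the end of the admissible range. *)
Lemma Val_above (p s x X : R) : 0 < p < 1 -> tau p (alpha0 p) <= s -> 0 <= X -> amp p X = s ->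
  0 <= x <= 1 -> s <= amp p x -> X <= 1 /\ Gval p x s <= 2 / p * tau p X.
Proof.
  intros Hp Hs HX EX Hx Hsx.
  assert (Et1 : tau p 1 = amp p 1) by (unfold tau; ring).
  assert (H1 := tau_max p 1 Hp ltac:(lra)).
  assert (HX1 : X <= 1) by (apply (amp_le_inv p); lra).
  assert (HxX : x <= X) by (apply (amp_le_inv p); lra).
  split; [assumption|]. rewrite <- EX. apply Gval_le_endpoint; [assumption|lra|lra|].
  intros z Hz. rewrite EX. apply Rle_trans with (2 := Hs). apply tau_max; [assumption|lra].
Qed.

Lemma tau_lt_amp (p a : R) : 0 <= a < 1 -> tau p a < amp p a.
Proof. intros Ha. unfold tau. generalize (amp_pos p a). nra. Qed.

(** Both candidates for the maximum increase with s: psi(a) because a does, and (2/p) tau(X) because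
    X decreases while staying at or beyond [alpha0], where [tau] falls. [y0] is the larger candidate
    at t. The bound covers all s < t at once so as to survive the loss in the upper bound for
    competitors. *)
Lemma Val_dominated (p t : R) : 0 < p < 1 -> 0 < t <= amp p (alpha0 p) ->
  exists y0, Val p t y0 /\ forall s y, 0 <= s < t -> Val p s y -> y < y0.
Proof.
  intros Hp Ht. destruct (alpha0_sq p Hp) as [Ha0 _].
  assert (Hamp0 : amp p (alpha0 p) <= 1) by (rewrite <- (amp_0 p); apply amp_le; lra).
  destruct (amp_surj_ex p t ltac:(lra) ltac:(lra)) as (X & HX0 & EX).
  assert (HXa : alpha0 p <= X) by (apply (amp_le_inv p); lra).
  assert (H2p : 0 < 2 / p) by (apply Rdiv_lt_0_compat; lra).
  assert (Hend : forall s Z, s < t -> 0 <= Z -> amp p Z = s -> 2 / p * tau p Z < 2 / p * tau p X).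
  { intros s Z Hs HZ EZ. apply Rmult_lt_compat_l; [assumption|]. apply tau_lt_right; [assumption|assumption|].
    apply Rnot_le_lt. intro H. assert (Q := amp_le p Z X ltac:(lra) ltac:(lra)). lra. }
  destruct (Rle_lt_dec t (tau p (alpha0 p))) as [Ht1|Ht1].
  - destruct (tau_surj p t Hp ltac:(lra)) as (b & Hb & Eb).
    assert (Hcrit : forall s y, 0 <= s < t -> Val p s y -> y < psi p b \/ (X <= 1 /\ y < 2 / p * tau p X)).
    { intros s y Hs (x & Hx & Hsx & ->).
      destruct (tau_surj p s Hp ltac:(lra)) as (a & Ha & Ea).
      assert (Hab : a < b).
      { apply Rnot_le_lt. intros [H|H]; [|subst; lra]. assert (Q := tau_lt_left p b a Hp ltac:(lra) H ltac:(lra)). lra. }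
      destruct (Val_below p s a x Hp Ha Ea Hx Hsx) as [H|(Z & HZ & EZ & H)].
      - left. apply Rle_lt_trans with (1 := H). apply psi_lt; lra.
      - right. split.
        + apply Rle_trans with Z; [|lra]. apply (amp_le_inv p); lra.
        + apply Rle_lt_trans with (1 := H). apply (Hend s); lra. }
    (* If X > 1, the end of the range is not admissible, neither at t nor at any smaller s, and only
       the critical value counts. *)
    destruct (Rle_lt_dec X 1) as [HX1|HX1].
    + destruct (Rle_lt_dec (psi p b) (2 / p * tau p X)) as [H|H].
      * exists (2 / p * tau p X). split; [rewrite <- EX; apply Val_endpoint; lra|].
        intros s y Hs Hy. destruct (Hcrit s y Hs Hy) as [Q|[_ Q]]; lra.
      * exists (psi p b). split; [rewrite <- Eb; apply Val_critical; assumption|].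
        intros s y Hs Hy. destruct (Hcrit s y Hs Hy) as [Q|[_ Q]]; lra.
    + exists (psi p b). split; [rewrite <- Eb; apply Val_critical; assumption|].
      intros s y Hs Hy. destruct (Hcrit s y Hs Hy) as [Q|[Q _]]; lra.
  - assert (HX1 : X <= 1).
    { assert (Et1 : tau p 1 = amp p 1) by (unfold tau; ring).
      assert (H1 := tau_max p 1 Hp ltac:(lra)). apply (amp_le_inv p); lra. }
    exists (2 / p * tau p X). split; [rewrite <- EX; apply Val_endpoint; lra|].
    intros s y Hs (x & Hx & Hsx & ->).
    destruct (Rle_lt_dec (tau p (alpha0 p)) s) as [Hst|Hst].
    + assert (Hspos : 0 < s). { assert (Q := amp_pos p (alpha0 p)). unfold tau in Hst. nra. }
      destruct (amp_surj_ex p s ltac:(lra) ltac:(lra)) as (Z & HZ0 & EZ).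
      destruct (Val_above p s x Z Hp Hst HZ0 EZ Hx Hsx) as [_ H].
      apply Rle_lt_trans with (1 := H). apply (Hend s); lra.
    + destruct (tau_surj p s Hp ltac:(lra)) as (a & Ha & Ea).
      destruct (Val_below p s a x Hp Ha Ea Hx Hsx) as [H|(Z & HZ & EZ & H)].
      * apply Rle_lt_trans with (1 := H).
        (* A critical value is compared with the end value at t through the level t1 = tau(alpha0):
           there [Val_above] applies at x = alpha0, so the critical value is at most the end value
           for t1, which is less than the one for t. *)
        apply Rle_lt_trans with (psi p (alpha0 p)); [apply psi_le; lra|].
        rewrite <- Gval_critical. set (t1 := tau p (alpha0 p)) in *.
        assert (Ht1p : 0 < t1). { assert (Q := amp_pos p (alpha0 p)). unfold t1, tau. nra. }
        destruct (amp_surj_ex p t1 ltac:(lra) ltac:(lra)) as (Z & HZ0 & EZ).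
        assert (Hlt : t1 < amp p (alpha0 p)) by (apply tau_lt_amp; lra).
        destruct (Val_above p t1 (alpha0 p) Z Hp ltac:(unfold t1; lra) HZ0 EZ ltac:(lra) ltac:(lra)) as [_ Q].
        apply Rle_lt_trans with (1 := Q). apply (Hend t1); lra.
      * apply Rle_lt_trans with (1 := H). apply (Hend s); lra.
Qed.

(* With [q = 1/p], this is [sinh (q u) >= q sinh u] at [u = ln x]. *)
Lemma power_gap (q x : R) : 1 <= q -> 1 <= x -> q * (x - / x) <= Rpower x q - / Rpower x q.
Proof.
  intros Hq Hx.
  enough (H : Rpower 1 q - / Rpower 1 q - q * (1 - / 1) <= Rpower x q - / Rpower x q - q * (x - / x)).
  { assert (E : Rpower 1 q = 1) by (unfold Rpower; rewrite ln_1, Rmult_0_r; apply exp_0).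
    rewrite E, Rinv_1 in H. lra. }
  apply (mono_of_deriv (fun x => Rpower x q - / Rpower x q - q * (x - / x))
    (fun x => q / x * ((Rpower x q + / Rpower x q) - (x + / x)))); [assumption| |].
  - intros z Hz. assert (Hp := exp_pos (q * ln z)). unfold Rpower. auto_derive.
    + repeat split; lra.
    + field. lra.
  - intros z Hz. apply Rmult_le_pos; [left; apply Rdiv_lt_0_compat; lra|].
    (* The derivative is nonnegative because w + 1/w increases for w >= 1. *)
    assert (Hge : z <= Rpower z q).
    { rewrite <- (Rpower_1 z) at 1 by lra. apply Rle_Rpower; lra. }
    set (k := Rpower z q) in *.
    replace (k + / k - (z + / z)) with ((k - z) * (k * z - 1) / (k * z)) by (field; lra).
    apply Rdiv_le_0_compat; [|nra]. apply Rmult_le_pos; nra.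
Qed.

(** For x > 1 the factor 1 + x z has a zero in the disc, so such x must be exchanged for 1/x. With k
    = x^(1/p) and a = A(x) one has A(1/x) = k^2 a, and the difference of the two values is (k - 1/k)
    (a k + s^2/(a k)) - (2 s/p) (x - 1/x). The second bracket is at least 2 s, and [power_gap]
    compares k - 1/k with (1/p) (x - 1/x). *)
Lemma Gval_reflect (p s x : R) : 0 < p < 1 -> 1 <= x -> 0 <= s ->
  amp p x <= amp p (/ x) /\ Gval p x s <= Gval p (/ x) s.
Proof.
  intros Hp Hx Hs.
  assert (Hxi : 0 < / x <= 1).
  { split; [apply Rinv_0_lt_compat; lra|]. rewrite <- Rinv_1. apply Rinv_le_contravar; lra. }
  split; [apply amp_le; lra|].
  set (k := Rpower x (1 / p)).
  assert (Hk : 1 <= k).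
  { unfold k, Rpower. apply Rle_trans with (exp 0); [rewrite exp_0; lra|]. assert (0 < 1 / p) by (apply Rdiv_lt_0_compat; lra).
    assert (0 <= ln x) by (rewrite <- ln_1; apply ln_le; lra).
    assert (Hle : 0 <= 1 / p * ln x) by nra. destruct Hle as [Hle|Hle]; [left; apply exp_increasing, Hle|rewrite <- Hle; lra]. }
  assert (Eamp : amp p (/ x) = k ^ 2 * amp p x).
  { unfold amp, k. replace (1 + (/ x) ^ 2) with ((1 + x ^ 2) * / (x * x)) by (field; lra).
    assert (Hx2 : 0 < x * x) by nra.
    rewrite <- Rpower_mult_distr by (try apply Rinv_0_lt_compat; nra).
    rewrite Rmult_comm. f_equal. unfold Rpower.
    rewrite ln_Rinv, ln_mult by lra. simpl. rewrite Rmult_1_r, <- exp_plus. f_equal. ring. }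
  assert (Ha := amp_pos p x). unfold Gval. rewrite Eamp. set (a := amp p x) in *.
  assert (Hq : 1 <= 1 / p) by (apply Rle_div_r; lra).
  assert (Hgap := power_gap (1 / p) x Hq Hx). fold k in Hgap.
  assert (Hak : 0 < a * k) by nra.
  assert (Hamgm : 2 * s <= a * k + s ^ 2 / (a * k)).
  { replace (a * k + s ^ 2 / (a * k)) with (2 * s + (a * k - s) ^ 2 / (a * k)) by (field; lra).
    assert (0 <= (a * k - s) ^ 2 / (a * k)) by (apply Rdiv_le_0_compat; [apply pow2_ge_0|assumption]). lra. }
  assert (Hk1 : / k <= 1) by (rewrite <- Rinv_1; apply Rinv_le_contravar; lra).
  enough (0 <= k ^ 2 * a - s ^ 2 / (k ^ 2 * a) + 2 / p * s * / x - (a - s ^ 2 / a + 2 / p * s * x)) by lra.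
  replace (k ^ 2 * a - s ^ 2 / (k ^ 2 * a) + 2 / p * s * / x - (a - s ^ 2 / a + 2 / p * s * x)) with
    ((k - / k) * (a * k + s ^ 2 / (a * k)) - 2 * s * (1 / p * (x - / x))) by (field; repeat split; lra).
  assert ((k - / k) * (2 * s) <= (k - / k) * (a * k + s ^ 2 / (a * k))) by (apply Rmult_le_compat_l; lra).
  nra.
Qed.

(** For fixed s the quantity A - s^2/A increases with A, so A may be raised to the largest amplitude
    A(x) allowed by the norm; an x beyond 1 is then reflected. *)
Lemma Val_of_factors (p s A x be D : R) : 0 < p < 1 -> 0 <= A -> 0 <= x -> 0 <= be <= 1 ->
  rpow A p * (1 + x ^ 2) <= 1 -> s = be * A -> D <= A * (1 - be ^ 2) + 2 / p * be * A * x ->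
  exists y, Val p s y /\ D <= y.
Proof.
  intros Hp HA Hx Hbe HAx Es HD.
  assert (Ha := amp_pos p x). assert (H2p : 0 < 2 / p) by (apply Rdiv_lt_0_compat; lra).
  assert (HAa : A <= amp p x).
  { apply Rnot_lt_le. intro Hlt. assert (Q := rpow_lt (amp p x) A p ltac:(lra) ltac:(lra) Hlt).
    assert (E := amp_rpow p x ltac:(lra)). nra. }
  assert (Hs0 : 0 <= s) by nra.
  assert (Hsa : s <= amp p x) by nra.
  assert (HG : D <= Gval p x s).
  { apply Rle_trans with (1 := HD). unfold Gval.
    replace (2 / p * be * A * x) with (2 / p * s * x) by (subst; ring).
    apply Rplus_le_compat_r. subst s.
    replace (amp p x - (be * A) ^ 2 / amp p x) with (A * (1 - be ^ 2) + (amp p x - A) * (1 + be ^ 2 * A / amp p x)) by (field; lra).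
    assert (0 <= be ^ 2 * A / amp p x) by (apply Rdiv_le_0_compat; [apply Rmult_le_pos; [apply pow2_ge_0|assumption]|assumption]).
    nra. }
  destruct (Rle_lt_dec x 1) as [Hx1|Hx1].
  - exists (Gval p x s). split; [|assumption]. exists x. repeat split; try lra.
  - destruct (Gval_reflect p s x Hp ltac:(lra) Hs0) as [R1 R2].
    exists (Gval p (/ x) s). split; [|lra]. exists (/ x). repeat split; try lra.
    + left. apply Rinv_0_lt_compat; lra.
    + rewrite <- Rinv_1. apply Rinv_le_contravar; lra.
Qed.

(** * Extremal functions *)

(** The set whose least upper bound is [Phi1 p s], named so that [Lub_Rbar_correct] applies by
    conversion. *)
Definition competitor (p s y : R) : Prop :=
  exists f : C -> C, in_Hp p f /\ (exists N : R, is_Hp_norm p f N /\ N <= 1) /\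
    f (RtoC 0) = RtoC s /\ y = Re (C_derive f (RtoC 0)).

(** The factors come with the norm bound 1 + e instead of 1. Multiplying by [la] = (1 + e)^(-1/p)
    repairs this but moves the value at 0 to [la * s], which is why G is evaluated at [sg * s]. *)
Lemma competitor_upper (p s D eta : R) : 0 < p < 1 -> 0 <= s -> 0 < eta < 1 -> competitor p s D ->
  exists sg k y, 1 - eta < sg < 1 /\ 1 - eta < k < 1 /\ Val p (sg * s) y /\ k * D <= y.
Proof.
  intros Hp Hs Heta (f & [Han _] & (N & HN & HN1) & H0 & ->).
  (* Chosen so that e <= 1/q - 1 forces la >= 1 - eta/2; together with r > 1 - eta/2 this gives la r
     > 1 - eta. *)
  set (q := rpow (1 - eta / 2) p).
  assert (Hq0 : 0 < q) by (apply rpow_pos; lra).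
  assert (Hq1 : q < 1) by (apply Rlt_le_trans with (rpow 1 p); [apply rpow_lt; lra|rewrite rpow_1; lra]).
  assert (Hiq : 1 < / q) by (rewrite <- Rinv_1; apply Rinv_lt_contravar; lra).
  set (e := Rmin (eta / 2) (/ q - 1)).
  assert (He : 0 < e) by (apply Rmin_pos; lra).
  assert (He1 : e <= eta / 2) by apply Rmin_l. assert (He2 : e <= / q - 1) by apply Rmin_r.
  destruct (Hp_upper p N s e f ltac:(lra) Hs ltac:(lra) Han HN HN1 H0) as
    (r & A & x & be & Hr & HA & Hx & Hbe & HAx & Es & HD).
  set (la := rpow (/ (1 + e)) (1 / p)).
  assert (Hie : 0 < / (1 + e)) by (apply Rinv_0_lt_compat; lra).
  assert (Hla : 0 < la) by (apply rpow_pos; assumption).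
  assert (Hlap : rpow la p = / (1 + e)) by (apply rpow_inv_l; lra).
  assert (Hla1 : la < 1).
  { apply Rnot_le_lt. intro H. assert (Q := rpow_le 1 la p ltac:(lra) ltac:(lra) H).
    rewrite rpow_1, Hlap in Q. assert (/ (1 + e) < 1) by (rewrite <- Rinv_1; apply Rinv_lt_contravar; lra). lra. }
  assert (Hla2 : 1 - eta / 2 <= la).
  { apply Rnot_lt_le. intro H. assert (Q := rpow_lt la (1 - eta / 2) p ltac:(lra) ltac:(lra) H).
    rewrite Hlap in Q. fold q in Q. assert (H1e : (1 + e) * q <= 1).
    { replace 1 with (/ q * q) at 2 by (field; lra). apply Rmult_le_compat_r; lra. }
    apply Rmult_lt_compat_l with (r := 1 + e) in Q; [|lra]. rewrite Rinv_r in Q; lra. }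
  destruct (Val_of_factors p (la * s) (la * A) x be (la * r * Re (C_derive f 0%C)) Hp) as (y & Hy & HyD).
  - apply Rmult_le_pos; lra.
  - assumption.
  - assumption.
  - rewrite rpow_mult, Hlap by lra. apply Rmult_le_reg_l with (1 + e); [lra|].
    replace ((1 + e) * (/ (1 + e) * rpow A p * (1 + x ^ 2))) with (rpow A p * (1 + x ^ 2)) by (field; lra). lra.
  - rewrite Es. ring.
  - rewrite Rmult_assoc. apply Rle_trans with (la * (A * (1 - be ^ 2) + 2 / p * be * A * x)).
    + apply Rmult_le_compat_l; [lra|exact HD].
    + right; ring.
  - exists la, (la * r), y. split; [lra|split; [split; nra|split; assumption]].
Qed.

(** From |1 + be z|^2 - |be + z|^2 = (1 - be^2) (1 - |z|^2). The quotient has modulus near 1 close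
    to the circle, uniformly in the angle, which serves in place of boundary values when the norm is
    computed. *)
Lemma moebius_bound (be : R) : 0 <= be <= 1 -> exists ka, 0 <= ka /\ forall z, Cmod z < 1 ->
  0 < Cmod (1 + be * z) /\
  1 - ka * (1 - Cmod z ^ 2) <= Cmod ((be + z) / (1 + be * z)) ^ 2 <= 1.
Proof.
  intros Hbe.
  assert (Hgap : forall z, Cmod (1 + be * z) ^ 2 - Cmod (be + z) ^ 2 = (1 - be ^ 2) * (1 - Cmod z ^ 2)).
  { intros [x y]. rewrite !Cmod2_alt. unfold Re, Im, Cplus, Cmult, RtoC; simpl. ring. }
  assert (Hden : forall z, Cmod z < 1 -> 1 - be < Cmod (1 + be * z) \/ be = 0).
  { intros z Hz. destruct (Req_dec be 0) as [|H]; [right; assumption|left].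
    assert (T := Cmod_triangle_rev 1 (- (be * z))). replace (1 - - (be * z))%C with (1 + be * z)%C in T by ring.
    rewrite Cmod_1, Cmod_opp, Cmod_mult, Cmod_RtoC_pos in T by lra. nra. }
  assert (Hpos : forall z, Cmod z < 1 -> 0 < Cmod (1 + be * z)).
  { intros z Hz. destruct (Hden z Hz) as [H|H]; [lra|]. rewrite H. replace (1 + 0 * z)%C with (RtoC 1) by ring. rewrite Cmod_1; lra. }
  assert (Hmod : forall z, Cmod z < 1 -> Cmod ((be + z) / (1 + be * z)) ^ 2 =
      1 - (1 - be ^ 2) * (1 - Cmod z ^ 2) / Cmod (1 + be * z) ^ 2).
  { intros z Hz. assert (P := Hpos z Hz). rewrite Cmod_div by (apply Cmod_pos_neq, P).
    rewrite <- Hgap. field. lra. }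
  assert (Hz2 : forall z, Cmod z < 1 -> 0 < 1 - Cmod z ^ 2).
  { intros z Hz. assert (P := Cmod_ge_0 z). nra. }
  assert (Hbe2 : 0 <= 1 - be ^ 2) by nra.
  (* For be = 1 the quotient is constant, whereas the general constant would divide by 0. *)
  exists (if Req_EM_T be 1 then 0 else (1 - be ^ 2) / (1 - be) ^ 2).
  destruct (Req_EM_T be 1) as [E|E].
  - split; [lra|]. intros z Hz. split; [apply Hpos, Hz|]. rewrite (Hmod z Hz), E.
    replace (1 - 1 ^ 2) with 0 by ring. unfold Rdiv. rewrite !Rmult_0_l. lra.
  - assert (Hb1 : 0 < (1 - be) ^ 2) by (apply pow_lt; lra). split; [apply Rdiv_le_0_compat; assumption|].
    intros z Hz. split; [apply Hpos, Hz|]. rewrite (Hmod z Hz).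
    assert (P := Hpos z Hz). assert (Q := Hz2 z Hz).
    assert (P2 : 0 < Cmod (1 + be * z) ^ 2) by (apply pow_lt, P).
    split.
    + assert (Hle : (1 - be) ^ 2 <= Cmod (1 + be * z) ^ 2).
      { destruct (Hden z Hz) as [H|H]; [apply pow_incr; lra|]. rewrite H.
        replace (1 + 0 * z)%C with (RtoC 1) by ring. rewrite Cmod_1. lra. }
      assert ((1 - be ^ 2) * (1 - Cmod z ^ 2) / Cmod (1 + be * z) ^ 2 <= (1 - be ^ 2) / (1 - be) ^ 2 * (1 - Cmod z ^ 2)); [|lra].
      replace ((1 - be ^ 2) / (1 - be) ^ 2 * (1 - Cmod z ^ 2)) with ((1 - be ^ 2) * (1 - Cmod z ^ 2) / (1 - be) ^ 2) by (field; lra).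
      apply Rmult_le_compat_l; [apply Rmult_le_pos; lra|]. apply Rinv_le_contravar; assumption.
    + assert (0 <= (1 - be ^ 2) * (1 - Cmod z ^ 2) / Cmod (1 + be * z) ^ 2); [|lra].
      apply Rdiv_le_0_compat; [apply Rmult_le_pos; lra|assumption].
Qed.

Lemma circle_mean_linear (x r : R) : 0 < r ->
  ex_RInt (fun t => Cmod (1 + x * (r * cis t)) ^ 2) 0 (2 * PI) /\
  RInt (fun t => Cmod (1 + x * (r * cis t)) ^ 2) 0 (2 * PI) = 2 * PI * (1 + x ^ 2 * r ^ 2).
Proof.
  intros Hr.
  set (F := fun z : C => (1 + x * z)%C).
  assert (HF : forall z, cdiff F z).
  { intro z. apply cdiff_plus; [apply cdiff_const|]. apply cdiff_mult; [apply cdiff_const|apply cdiff_id]. }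
  assert (HFc : circle_ccont F r) by (intro t; apply cdiff_ccont, HF).
  destruct (ex_RInt_circle F r 0 (2 * PI) ltac:(lra) HFc) as [E1 _].
  assert (Ec : circle_int F r = (2 * PI * F 0)%C).
  { apply (circle_int_center F 0%C r (r + 1)); [lra| |]; intros w _; [apply cdiff_ccont, HF|intros _; apply HF]. }
  assert (Ec1 : RInt (fun t => fst (F (r * cis t)%C)) 0 (2 * PI) = 2 * PI).
  { transitivity (fst (circle_int F r)); [reflexivity|]. rewrite Ec. unfold F, Cplus, Cmult, RtoC; simpl; ring. }
  assert (Hpt : forall t, 2 * fst (F (r * cis t)%C) + (x ^ 2 * r ^ 2 - 1) * 1 = Cmod (1 + x * (r * cis t)) ^ 2).
  { intro t. fold (F (r * cis t)%C). assert (M : fst (r * cis t)%C ^ 2 + snd (r * cis t)%C ^ 2 = r ^ 2).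
    { change (Re (r * cis t) ^ 2 + Im (r * cis t) ^ 2 = r ^ 2). rewrite <- Cmod2_alt, Cmod_polar by lra. reflexivity. }
    rewrite Cmod2_alt. unfold F. destruct (r * cis t)%C as [u v]. unfold Re, Im, Cplus, Cmult, RtoC; simpl in *.
    rewrite !Rmult_1_r in *. rewrite <- M. ring. }
  assert (E2 : ex_RInt (fun _ : R => 1) 0 (2 * PI)) by apply ex_RInt_const.
  split.
  - apply (ex_RInt_ext (fun t => 2 * fst (F (r * cis t)%C) + (x ^ 2 * r ^ 2 - 1) * 1)); [intros t _; apply Hpt|].
    apply (ex_RInt_plus (V := R_NormedModule) (fun t => 2 * fst (F (r * cis t)%C)) (fun t => (x ^ 2 * r ^ 2 - 1) * 1)).
    + apply (ex_RInt_scal (V := R_NormedModule) _ 0 (2 * PI) 2 E1).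
    + apply (ex_RInt_scal (V := R_NormedModule) _ 0 (2 * PI) (x ^ 2 * r ^ 2 - 1) E2).
  - rewrite <- (RInt_ext (fun t => 2 * fst (F (r * cis t)%C) + (x ^ 2 * r ^ 2 - 1) * 1)) by (intros t _; apply Hpt).
    rewrite RInt_lincomb by assumption. rewrite Ec1, RInt_const. unfold scal; simpl; unfold mult; simpl. ring.
Qed.

(** For the function named in the overview, |f|^p = A^p |B|^p |1 + x z|^2 with B the Moebius factor.
    It is squeezed between multiples of A^p |1 + x z|^2, whose mean A^p (1 + x^2 r^2) tends to 1, so
    the norm is exactly 1. *)
Lemma Val_attained (p s y : R) : 0 < p < 1 -> 0 <= s -> Val p s y -> competitor p s y.
Proof.
  intros Hp Hs (x & Hx & Hsx & ->). assert (HPI := PI_RGT_0).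
  assert (Ha := amp_pos p x). set (a := amp p x) in *.
  set (be := s / a).
  assert (Hbe : 0 <= be <= 1).
  { split; [apply Rdiv_le_0_compat; assumption|apply Rle_div_l; lra]. }
  destruct (moebius_bound be Hbe) as (ka & Hka & Hmb).
  set (f := fun z : C => (a * ((be + z) / (1 + be * z)) * cpow (1 + x * z) (2 / p))%C).
  assert (Hre : forall z, Cmod z < 1 -> 0 < fst (1 + x * z)%C).
  { intros z Hz. replace (1 + x * z)%C with (1 - RtoC (- x) * z)%C by (rewrite RtoC_opp; ring).
    apply one_minus_re_pos; [|assumption]. rewrite Cmod_R, Rabs_Ropp, Rabs_pos_eq; lra. }
  assert (Hlin : forall c z : C, cderiv (fun z => 1 + c * z)%C z c).
  { intros c z. eapply cderiv_eq.
    - apply cderiv_plus; [apply cderiv_const|]. apply cderiv_mult; [apply cderiv_const|apply cderiv_id].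
    - cbv beta; ring. }
  assert (Hd : forall z, Cmod z < 1 -> cderiv f z
    (a * (1 / (1 + be * z) - (be + z) * (be / ((1 + be * z) * (1 + be * z)))) * cpow (1 + x * z) (2 / p)
     + a * ((be + z) / (1 + be * z)) * (x * ((2 / p)%R * / (1 + x * z) * cpow (1 + x * z) (2 / p))))%C).
  { intros z Hz. destruct (Hmb z Hz) as [Hm0 _]. assert (Hm1 := Cmod_pos_neq _ Hm0).
    apply (cderiv_mult (fun z => a * ((be + z) / (1 + be * z)))%C (fun z => cpow (1 + x * z) (2 / p))).
    - eapply cderiv_eq.
      + apply (cderiv_mult (fun _ => RtoC a) (fun z => (be + z) / (1 + be * z))%C); [apply cderiv_const|].
        apply (cderiv_mult (fun z => be + z)%C (fun z => / (1 + be * z))%C).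
        * apply cderiv_plus; [apply cderiv_const|apply cderiv_id].
        * apply (cderiv_comp Cinv (fun z => 1 + be * z)%C); [apply cderiv_inv, Hm1|apply Hlin].
      + cbv beta. field. assumption.
    - apply (cderiv_comp (fun w => cpow w (2 / p)) (fun z => 1 + x * z)%C); [|apply Hlin].
      apply cderiv_cpow, Hre, Hz. }
  assert (Han : analytic_on_disc f) by (intros z Hz; eexists; apply (Hd z Hz)).
  assert (H0 : f 0%C = RtoC s).
  { unfold f. replace (1 + x * 0)%C with (RtoC 1) by ring. rewrite cpow_1.
    replace (a * ((be + 0) / (1 + be * 0)) * 1)%C with (a * be)%C by (field; apply Cmod_pos_neq; rewrite ?Cmod_1; lra).
    rewrite <- RtoC_mult. f_equal. unfold be. field. lra. }
  assert (Hder : C_derive f 0%C = RtoC (Gval p x s)).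
  { apply is_C_derive_unique. eapply cderiv_eq; [apply Hd; rewrite Cmod_0; lra|].
    replace (1 + x * 0)%C with (RtoC 1) by ring. rewrite cpow_1.
    replace (1 + be * 0)%C with (RtoC 1) by ring.
    unfold Gval. fold a.
    replace (a - s ^ 2 / a + 2 / p * s * x) with (a * (1 - be * be) + a * be * x * (2 / p)) by (unfold be; field; lra).
    rewrite !RtoC_plus, !RtoC_mult, RtoC_minus, RtoC_mult.
    field. }
  assert (Hmean : forall r, 0 < r < 1 -> 1 - (ka + 1) * (1 - r ^ 2) <= circle_mean p f r <= 1).
  { intros r Hr. rewrite circle_mean_polar.
    assert (Hcc : circle_ccont f r) by (apply (circle_ccont_ball f r 1); [lra|exact Han]).
    assert (Hex := ex_RInt_rpow_circle f r p ltac:(lra) ltac:(lra) Hcc).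
    destruct (circle_mean_linear x r ltac:(lra)) as [El Il].
    set (al := rpow a p). assert (Hal : 0 < al) by (apply rpow_pos, Ha).
    assert (Hal1 : al * (1 + x ^ 2) = 1) by (apply amp_rpow; lra).
    set (u := 1 - r ^ 2). assert (Hu : 0 < u) by (unfold u; nra).
    assert (Hpt : forall t, (1 - ka * u) * al * Cmod (1 + x * (r * cis t)) ^ 2 <= rpow (Cmod (f (r * cis t)%C)) p
         <= al * Cmod (1 + x * (r * cis t)) ^ 2).
    { intro t. assert (Hz : Cmod (r * cis t) < 1) by (rewrite Cmod_polar; lra).
      destruct (Hmb _ Hz) as [_ Hm]. rewrite Cmod_polar in Hm by lra. fold u in Hm.
      unfold f. set (z := (r * cis t)%C) in *. assert (Hrz := Hre z Hz).
      set (m := Cmod ((be + z) / (1 + be * z))) in *.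
      assert (Hm0 : 0 <= m) by apply Cmod_ge_0.
      assert (Hm1 : m <= 1) by nra.
      set (w := Cmod (1 + x * z)).
      assert (Hw : 0 < w).
      { eapply Rlt_le_trans; [exact Hrz|]. eapply Rle_trans; [apply Rle_abs|apply Rabs_fst_le]. }
      rewrite !Cmod_mult. fold m. rewrite Cmod_cpow by assumption. fold w.
      rewrite Cmod_RtoC_pos by lra.
      rewrite !rpow_mult by (try apply Rmult_le_pos; try lra; left; apply Rpower_pos). fold al.
      rewrite (rpow_pos_eq (Rpower w (2 / p))) by apply Rpower_pos.
      rewrite Rpower_mult. replace (2 / p * p) with (INR 2) by (simpl; field; lra).
      rewrite Rpower_pow by assumption.
      assert (Hb1 : m <= rpow m p) by (apply rpow_ge_base; lra).
      assert (Hb2 : rpow m p <= 1) by (rewrite <- (rpow_1 p); apply rpow_le; lra).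
      assert (Hw2 : 0 < al * w ^ 2) by (apply Rmult_lt_0_compat; [assumption|apply pow_lt; assumption]).
      (* m^p >= m >= m^2, as m <= 1 and p < 1. *)
      assert (Hb3 : 1 - ka * u <= rpow m p) by nra.
      split; nra. }
    assert (Hlow : (1 - ka * u) * al * (2 * PI * (1 + x ^ 2 * r ^ 2)) <= RInt (fun t => rpow (Cmod (f (r * cis t)%C)) p) 0 (2 * PI)).
    { rewrite <- Il. rewrite <- (RInt_scal (V := R_CompleteNormedModule)) by exact El.
      apply RInt_le; [lra| |assumption|].
      - apply (ex_RInt_scal (V := R_NormedModule)), El.
      - intros t _. apply Hpt. }
    assert (Hup : RInt (fun t => rpow (Cmod (f (r * cis t)%C)) p) 0 (2 * PI) <= al * (2 * PI * (1 + x ^ 2 * r ^ 2))).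
    { rewrite <- Il. rewrite <- (RInt_scal (V := R_CompleteNormedModule)) by exact El.
      apply RInt_le; [lra|assumption| |].
      - apply (ex_RInt_scal (V := R_NormedModule)), El.
      - intros t _. apply Hpt. }
    assert (Ev : al * (1 + x ^ 2 * r ^ 2) = 1 - al * x ^ 2 * u).
    { transitivity (al * (1 + x ^ 2) - al * x ^ 2 * u); [unfold u; ring|rewrite Hal1; reflexivity]. }
    assert (Hv : 0 <= al * x ^ 2 <= 1).
    { assert (0 <= x ^ 2) by apply pow2_ge_0. nra. }
    set (v := al * x ^ 2 * u) in *. assert (Hvu : 0 <= v <= u) by (unfold v; nra).
    split.
    - apply Rle_div_r; [lra|]. apply Rle_trans with (2 := Hlow).
      replace ((1 - ka * u) * al * (2 * PI * (1 + x ^ 2 * r ^ 2))) with ((1 - ka * u) * (al * (1 + x ^ 2 * r ^ 2)) * (2 * PI)) by ring.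
      rewrite Ev. apply Rmult_le_compat_r; [lra|].
      assert (0 <= ka * u * v) by (repeat apply Rmult_le_pos; lra). nra.
    - apply Rle_div_l; [lra|]. apply Rle_trans with (1 := Hup).
      replace (al * (2 * PI * (1 + x ^ 2 * r ^ 2))) with (al * (1 + x ^ 2 * r ^ 2) * (2 * PI)) by ring.
      rewrite Ev. nra. }
  assert (HN : is_Hp_norm p f 1).
  { split; [lra|]. rewrite rpow_1. intros P [e He].
    assert (Hd1 : 0 < Rmin (1 / 2) (e / (2 * (ka + 1)))).
    { apply Rmin_pos; [lra|]. apply Rdiv_lt_0_compat; [apply cond_pos|lra]. }
    exists (mkposreal _ Hd1). intros r Hr Hr1. apply He.
    unfold ball in Hr; simpl in Hr; unfold AbsRing_ball, abs, minus, plus, opp in Hr; simpl in Hr.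
    apply Rabs_lt_between in Hr.
    assert (M1 := Rmin_l (1 / 2) (e / (2 * (ka + 1)))). assert (M2 := Rmin_r (1 / 2) (e / (2 * (ka + 1)))).
    assert (H1r : 1 - r < e / (2 * (ka + 1))) by lra.
    apply Rlt_div_r in H1r; [|lra].
    destruct (Hmean r ltac:(lra)) as [L1 L2].
    unfold ball; simpl; unfold AbsRing_ball, abs, minus, plus, opp; simpl.
    apply Rabs_lt_between. split; [|generalize (cond_pos e); lra].
    assert ((ka + 1) * (1 - r ^ 2) <= (1 - r) * (2 * (ka + 1))).
    { replace (1 - r ^ 2) with ((1 - r) * (1 + r)) by ring. assert (0 <= (1 - r) * (ka + 1)) by nra. nra. }
    lra. }
  exists f. split; [split; [exact Han|exists 1; exact HN]|].
  split; [exists 1; split; [exact HN|lra]|]. split; [exact H0|]. rewrite Hder. reflexivity.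
Qed.

(** * Bounds for the supremum and its monotonicity *)

Lemma Phi1_ge (p s y : R) : 0 < p < 1 -> 0 <= s -> Val p s y -> Rbar_le y (Phi1 p s).
Proof.
  intros Hp Hs Hy. apply (proj1 (Lub_Rbar_correct (competitor p s))). apply Val_attained; assumption.
Qed.

(** Competitors at s are controlled by values of G at [sg * s] with sg slightly below 1, so the
    bound has to be supplied there, up to an arbitrary e. *)
Lemma Phi1_le (p s b : R) : 0 < p < 1 -> 0 <= s ->
  (forall e, 0 < e -> exists d, 0 < d /\ forall sg y, 1 - d < sg < 1 -> Val p (sg * s) y -> y <= b + e) ->
  Rbar_le (Phi1 p s) b.
Proof.
  intros Hp Hs Hb. apply (proj2 (Lub_Rbar_correct (competitor p s))).
  intros D HD. simpl. apply Rnot_lt_le. intro Hlt.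
  destruct (Hb ((D - b) / 2) ltac:(lra)) as (d & Hd & Hd2).
  (* Makes (1 - k) |D| at most (D - b)/4, which together with the error e = (D - b)/2 contradicts b
     < D. *)
  set (eta := Rmin (Rmin (1 / 2) d) ((D - b) / (4 * (Rabs D + 1)))).
  assert (HD0 := Rabs_pos D).
  assert (Heta : 0 < eta).
  { repeat apply Rmin_pos; try lra. apply Rdiv_lt_0_compat; lra. }
  assert (E1 : eta <= 1 / 2) by (eapply Rle_trans; [apply Rmin_l|apply Rmin_l]).
  assert (E2 : eta <= d) by (eapply Rle_trans; [apply Rmin_l|apply Rmin_r]).
  assert (E3 : eta <= (D - b) / (4 * (Rabs D + 1))) by apply Rmin_r.
  apply Rle_div_r in E3; [|lra].
  destruct (competitor_upper p s D eta Hp Hs ltac:(lra) HD) as (sg & k & y & Hsg & Hk & Hy & HkD).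
  specialize (Hd2 sg y ltac:(lra) Hy).
  assert (Hk2 : D - k * D <= eta * Rabs D).
  { assert (A := Rle_abs D). assert ((1 - k) * D <= (1 - k) * Rabs D) by (apply Rmult_le_compat_l; lra). nra. }
  nra.
Qed.

(** The loss is harmless: [sg * s] is still in [0, t), where the domination holds. *)
Lemma Phi1_le_dominated (p s t y0 : R) : 0 < p < 1 -> 0 <= s < t ->
  (forall s y, 0 <= s < t -> Val p s y -> y < y0) -> Rbar_le (Phi1 p s) y0.
Proof.
  intros Hp Hs Hdom. apply Phi1_le; [assumption|lra|]. intros e He. exists 1. split; [lra|].
  intros sg y Hsg Hy. assert (y < y0); [|lra]. apply (Hdom (sg * s)); [split; nra|assumption].
Qed.

(** Above the maximum of [tau] only the end of the admissible range counts, and the value there is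
    continuous in t, which absorbs the factor sg. *)
Lemma Phi1_endpoint (p X : R) : 0 < p < 1 -> 0 <= X -> tau p (alpha0 p) < amp p X ->
  Phi1 p (amp p X) = Finite (2 / p * tau p X).
Proof.
  intros Hp HX HtX. set (t := amp p X) in *.
  destruct (alpha0_sq p Hp) as [Ha0 _].
  assert (Ht1 : t <= 1) by (unfold t; rewrite <- (amp_0 p); apply amp_le; lra).
  assert (Ht0 : 0 < t) by apply amp_pos.
  assert (Et1 : tau p 1 = amp p 1) by (unfold tau; ring).
  assert (H1 := tau_max p 1 Hp ltac:(lra)).
  assert (HX1 : X <= 1) by (apply (amp_le_inv p); fold t; lra).
  apply Rbar_le_antisym; [|apply Phi1_ge; [assumption|lra|apply Val_endpoint; lra]].
  apply Phi1_le; [assumption|lra|]. intros e He.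
  (* The end value (2/p) tau(X), with X eliminated by A(X) = s. *)
  set (h := fun s => 2 / p * (s * sqrt (Rpower s (- p) - 1))).
  assert (Hh : forall s, 0 < s <= 1 -> forall Z, 0 <= Z -> amp p Z = s -> 2 / p * tau p Z = h s).
  { intros s Hs Z HZ EZ. unfold h, tau.
    assert (EZ2 : Z = sqrt (Rpower s (- p) - 1)).
    { assert (Q := amp_surj p s ltac:(lra) Hs). apply Rle_antisym; apply (amp_le_inv p); try lra; apply sqrt_pos. }
    rewrite <- EZ2, EZ. ring. }
  assert (Hc : continuous h t).
  { assert (Hge : 0 <= Rpower t (- p) - 1).
    { assert (E : Rpower t (- p) = 1 + X ^ 2).
      { unfold t, amp. rewrite Rpower_mult. replace (- (1 / p) * - p) with 1 by (field; lra). apply Rpower_1. nra. }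
      rewrite E. nra. }
    unfold h. apply (continuous_mult (K := R_AbsRing)); [apply continuous_const|].
    apply (continuous_mult (K := R_AbsRing)); [apply continuous_id|].
    apply (continuous_comp (fun s => Rpower s (- p) - 1) sqrt).
    - apply (ex_derive_continuous (V := R_NormedModule)). unfold Rpower. auto_derive. assumption.
    (* For t = 1 the root is taken at 0, where it is continuous but not differentiable. *)
    - apply continuity_pt_filterlim, continuity_pt_sqrt, Hge. }
  destruct (Hc (ball (h t) (mkposreal e He)) (locally_ball _ _)) as [d Hd].
  assert (Hdp := cond_pos d).
  (* As t <= 1, the second bound keeps [sg * t] above the maximum of [tau]. *)
  exists (Rmin d (t - tau p (alpha0 p))). split; [apply Rmin_pos; lra|].
  intros sg y Hsg (x & Hx & Hsx & ->).
  assert (M1 := Rmin_l d (t - tau p (alpha0 p))). assert (M2 := Rmin_r d (t - tau p (alpha0 p))).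
  assert (Hge : tau p (alpha0 p) <= sg * t) by nra.
  assert (Hpos : 0 < sg * t).
  { apply Rlt_le_trans with (2 := Hge). unfold tau. generalize (amp_pos p (alpha0 p)); nra. }
  destruct (amp_surj_ex p (sg * t) ltac:(lra) ltac:(split; nra)) as (Z & HZ & EZ).
  destruct (Val_above p (sg * t) x Z Hp Hge HZ EZ Hx Hsx) as [_ Q].
  rewrite (Hh (sg * t)) in Q; [|split; nra|assumption|assumption].
  rewrite (Hh t); [|lra|assumption|reflexivity].
  assert (B : ball (h t) e (h (sg * t))).
  { apply Hd. unfold ball; simpl; unfold AbsRing_ball, abs, minus, plus, opp; simpl.
    apply Rabs_lt_between. split; nra. }
  unfold ball in B; simpl in B; unfold AbsRing_ball, abs, minus, plus, opp in B; simpl in B.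
  apply Rabs_lt_between in B. lra.
Qed.

Lemma amp_alpha0 (p : R) : 0 < p < 1 -> amp p (alpha0 p) = Rpower (1 - p / 2) (1 / p).
Proof.
  intros Hp. unfold amp, alpha0. assert (0 < p / (2 - p)) by (apply Rdiv_lt_0_compat; lra).
  rewrite pow2_sqrt by lra. replace (1 + p / (2 - p)) with (/ (1 - p / 2)) by (field; lra).
  unfold Rpower. rewrite ln_Rinv by lra. f_equal. ring.
Qed.

Theorem corollary13 (p : R) (hp : 0 < p < 1) :
  let t0 := Rpower (1 - p / 2) (1 / p) in
  Phi1 p 0 = Finite 1 /\
  (forall s t : R, 0 <= s -> s < t -> t <= t0 -> Rbar_lt (Phi1 p s) (Phi1 p t)) /\
  Phi1 p t0 = Finite (t0 * (2 / sqrt (p * (2 - p)))) /\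
  (forall s t : R, t0 <= s -> s < t -> t <= 1 -> Rbar_lt (Phi1 p t) (Phi1 p s)) /\
  Phi1 p 1 = Finite 0.
Proof.
  intro t0. unfold t0. rewrite <- (amp_alpha0 p hp). clear t0.
  destruct (alpha0_sq p hp) as [Ha0 _].
  assert (Hta : tau p (alpha0 p) < amp p (alpha0 p)) by (apply tau_lt_amp; lra).
  assert (Hpos := amp_pos p (alpha0 p)).
  split; [|split; [|split; [|split]]].
  (* At t = 0 one has G(x, 0) = A(x), which is largest at x = 0. *)
  - apply Rbar_le_antisym.
    + apply Phi1_le; [assumption|lra|]. intros e He. exists 1. split; [lra|].
      intros sg y _ (x & Hx & _ & ->). unfold Gval. rewrite Rmult_0_r.
      assert (amp p x <= 1) by (rewrite <- (amp_0 p); apply amp_le; lra).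
      unfold Rdiv. rewrite pow_i by (apply Nat.lt_0_succ). lra.
    + apply Phi1_ge; [assumption|lra|]. exists 0. rewrite amp_0. repeat split; try lra.
      unfold Gval. rewrite amp_0. field. lra.
  - intros s t Hs Hst Ht.
    (* The value [y0] at the midpoint bounds the supremum at s and lies strictly below a value at t;
       without the midpoint, passing to the supremum would lose strictness. *)
    destruct (Val_dominated p ((s + t) / 2) hp ltac:(lra)) as (y0 & Hy0 & Hdom0).
    destruct (Val_dominated p t hp ltac:(lra)) as (y1 & Hy1 & Hdom1).
    apply Rbar_le_lt_trans with y0; [apply (Phi1_le_dominated p s ((s + t) / 2)); [assumption|lra|exact Hdom0]|].
    apply Rbar_lt_le_trans with y1; [|apply Phi1_ge; [assumption|lra|exact Hy1]].
    simpl. apply (Hdom1 ((s + t) / 2)); [lra|exact Hy0].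
  (* Since alpha0 < 1, tau(alpha0) < A(alpha0), so the end formula holds at this point and beyond it
     up to 1. *)
  - rewrite Phi1_endpoint; [|assumption|lra|assumption]. f_equal. unfold tau.
    set (t0 := amp p (alpha0 p)). unfold alpha0.
    rewrite sqrt_div, sqrt_mult by lra.
    assert (A := sqrt_lt_R0 p ltac:(lra)). assert (B := sqrt_lt_R0 (2 - p) ltac:(lra)).
    rewrite <- (sqrt_sqrt p) at 1 by lra. field. lra.
  (* On this side the end X of the range lies in [0, alpha0], where [tau] increases, and X decreases
     as t grows. *)
  - intros s t Hs Hst Ht.
    destruct (amp_surj_ex p s ltac:(lra) ltac:(lra)) as (X & HX & EX).
    destruct (amp_surj_ex p t ltac:(lra) ltac:(lra)) as (Y & HY & EY).
    assert (HXa : X <= alpha0 p) by (apply (amp_le_inv p); lra).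
    assert (HYX : Y < X).
    { apply Rnot_le_lt. intro H. assert (Q := amp_le p X Y ltac:(lra) ltac:(lra)). lra. }
    rewrite <- EX, <- EY. rewrite !Phi1_endpoint by (try assumption; lra).
    simpl. apply Rmult_lt_compat_l; [apply Rdiv_lt_0_compat; lra|]. apply tau_lt_left; lra.
  - rewrite <- (amp_0 p). rewrite Phi1_endpoint; [|assumption|lra|].
    + f_equal. unfold tau. ring.
    + rewrite amp_0. apply Rlt_le_trans with (1 := Hta). rewrite <- (amp_0 p). apply amp_le; lra.
Qed.
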